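(* Let $\mathcal{F}$ be a family of extrapolation pairs on $\mathbb{R}^n$. Suppose that $u$ and $v$ are weights on $\mathbb{R}^n$ such that $v\in A_\infty$, and $\mathbb{X}_v$ is a Banach function space over $(\mathbb{R}^n,v\,dx)$. Suppose that for some $p_0\in(0,\infty)$ and for every $w\in A_\infty$, $$\|f\|_{L^{p_0}(w)}\le C\,\|g\|_{L^{p_0}(w)},\qquad (f,g)\in\mathcal{F},\tag{H}$$ where $C$ is independent of $(f,g)$ and depends on $w$ only through its $A_\infty$ characteristic. Then for every $p\in(0,\infty)$ there is a constant $C$ such that $$\|f^pu\|_{\mathbb{X}_v}\le C\,\|g^pu\|_{\mathbb{X}_v},\qquad (f,g)\in\mathcal{F},$$ provided that there is a constant $K_0$ with $$\|(M_vf)\,u^{-1}\|_{\mathbb{X}_v'}\le K_0\,\|f\,u^{-1}\|_{\mathbb{X}_v'}\qquad\text{for all measurable } f.\tag{M}$$ Moreover, under hypothesis (M), (H) implies that for every $p,q\in(0,\infty)$ there is a constant $C$ such that $$\Big\|\Big(\sum_jf_j^q\Big)^{p/q}u\Big\|_{\mathbb{X}_v}\le C\,\Big\|\Big(\sum_jg_j^q\Big)^{p/q}u\Big\|_{\mathbb{X}_v},\qquad \{(f_j,g_j)\}_j\subset\mathcal{F}.$$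
   Context: A weight on $\mathbb{R}^n$ is a measurable $w$ with $0<w<\infty$ a.e.; $w(E)=\int_E w\,dx$; $\|f\|_{L^p(w)}=(\int|f|^p w\,dx)^{1/p}$. The Hardy–Littlewood maximal operator is $Mf(x)=\sup_{Q\ni x}\frac1{|Q|}\int_Q|f|\,dy$ (sup over cubes $Q\ni x$). For $1<p<\infty$, $w\in A_p$ if $[w]_{A_p}=\sup_Q\big(\frac1{|Q|}\int_Q w\big)\big(\frac1{|Q|}\int_Q w^{1-p'}\big)^{p-1}<\infty$, where $1/p+1/p'=1$; $w\in A_1$ if $[w]_{A_1}=\|Mw/w\|_{L^\infty}<\infty$; $A_\infty=\bigcup_{p\ge1}A_p$. A constant depends on $w\in A_\infty$ only through its $A_\infty$ characteristic if, for every $q\in[1,\infty)$ and $K\ge1$, the same constant can be taken for all $w$ with $[w]_{A_q}\le K$. For a weight $v$, $M_vf(x)=\sup_{Q\ni x}\frac1{v(Q)}\int_Q|f|v\,dy$. A family of extrapolation pairs is a collection of pairs $(f,g)$ of nonnegative measurable functions on $\mathbb{R}^n$. Let $\mathbb{M}$ be the set of (classes of) measurable functions on $\mathbb{R}^n$. A Banach function space (BFS) over $(\mathbb{R}^n,v\,dx)$ is $\mathbb{X}_v=\{f\in\mathbb{M}:\|f\|_{\mathbb{X}_v}<\infty\}$, where $\|\cdot\|=\|\cdot\|_{\mathbb{X}_v}:\mathbb{M}\to[0,\infty]$ satisfies: (1) $\|f\|=\||f|\|$, and $\|f\|=0$ iff $f=0$ a.e.; (2) $\|f+g\|\le\|f\|+\|g\|$;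 (3) $\|\lambda f\|=|\lambda|\|f\|$; (4) $|f|\le|g|$ a.e. implies $\|f\|\le\|g\|$; (5) $|f_j|\uparrow|f|$ a.e. implies $\|f_j\|\uparrow\|f\|$; (6) if $v(E)<\infty$ then $\|\mathbf{1}_E\|<\infty$ and $\int_E|f|\,v\,dx\le C_E\|f\|$. The associate space $\mathbb{X}_v'$ has norm $\|f\|_{\mathbb{X}_v'}=\sup\{\int|fg|\,v\,dx:\|g\|_{\mathbb{X}_v}\le1\}$. Functions not in a space have norm $+\infty$. *)

(* Defs.v *)
From HB Require Import structures.
From mathcomp Require Import all_boot all_order all_algebra.
From mathcomp Require Import all_classical all_reals all_analysis.
From mathcomp Require Import measurable_realfun.

Set Implicit Arguments.
Unset Strict Implicit.
Unset Printing Implicit Defensive.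
Import Order.TTheory GRing.Theory Num.Theory.
Import numFieldNormedType.Exports.

Local Open Scope classical_set_scope.
Local Open Scope ring_scope.
Local Open Scope ereal_scope.

Section cons_measure.
Context d (T : measurableType d) (R : realType) (n : nat).
Variables (m1 : {sigma_finite_measure set T -> \bar R})
  (m2 : {sigma_finite_measure set (n.-tuple T) -> \bar R}).

Definition tcons (p : T * n.-tuple T) : n.+1.-tuple T :=
  [tuple of p.1 :: p.2].

Lemma measurable_tcons : measurable_fun [set: T * n.-tuple T] tcons.
Proof. exact: (measurable_cons measurable_fst measurable_snd). Qed.

Definition cons_measure : set (n.+1.-tuple T) -> \bar R :=
  pushforward (m1 \x m2) tcons.

Let cons_measure0 : cons_measure set0 = 0.
Proof. by rewrite /cons_measure /pushforward preimage_set0 measure0. Qed.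

Let cons_measure_ge0 A : 0 <= cons_measure A.
Proof. exact: (measure_ge0 (m1 \x m2)). Qed.

Let cons_measure_sigma_additive : semi_sigma_additive cons_measure.
Proof.
move=> F mF tF mUF; rewrite /cons_measure /pushforward preimage_bigcup.
apply: (@measure_semi_sigma_additive _ _ _ (m1 \x m2)).
- by move=> i; rewrite -[X in measurable X]setTI; exact: measurable_tcons.
- apply/trivIsetP => i j _ _ ij; rewrite -preimage_setI.
  by move/trivIsetP : tF => /(_ _ _ _ _ ij) ->//; rewrite preimage_set0.
- by rewrite -preimage_bigcup -[X in measurable X]setTI; exact: measurable_tcons.
Qed.

HB.instance Definition _ := isMeasure.Build _ _ _ cons_measure
  cons_measure0 cons_measure_ge0 cons_measure_sigma_additive.

Let cons_measure_sigma_finite : sigma_finite [set: n.+1.-tuple T] cons_measure.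
Proof.
have /sigma_finiteP[F [TF ndF mF]] := sigma_finiteT m1.
have /sigma_finiteP[G [TG ndG mG]] := sigma_finiteT m2.
pose H k := [set t : n.+1.-tuple T |
  F k (thead t) /\ G k [tuple of behead t]].
have mH k : measurable (H k).
  apply: measurableI; rewrite -[X in measurable X]setTI.
    exact: (@measurable_tnth _ T n.+1 ord0 _ _ (mF k).1).
  exact: (@measurable_behead _ T n _ _ (mG k).1).
exists H.
  apply/esym; rewrite -subTset => t _.
  have [i _ Fi] : (\bigcup_k F k) (thead t) by rewrite -TF.
  have [j _ Gj] : (\bigcup_k G k) [tuple of behead t] by rewrite -TG.
  exists (maxn i j) => //; split.
    by apply: (subsetPset _ _ (ndF i (maxn i j) (leq_maxl _ _))).
  by apply: (subsetPset _ _ (ndG j (maxn i j) (leq_maxr _ _))).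
move=> k; split; first exact: mH.
rewrite /cons_measure /pushforward (_ : tcons @^-1` H k = F k `*` G k).
  rewrite product_measure1E; [|exact: (mF k).1|exact: (mG k).1].
  by apply: lte_mul_pinfty; rewrite ?ge0_fin_numE//; [exact: (mF k).2|exact: (mG k).2].
apply/seteqP; split => -[x t] /=; rewrite /H /tcons /= theadE;
  by rewrite (_ : [tuple of _] = t)//; exact: val_inj.
Qed.

HB.instance Definition _ := @Measure_isSigmaFinite.Build _ _ _ cons_measure
  cons_measure_sigma_finite.

End cons_measure.

Fixpoint borel_lebesgue (R : realType) (n : nat) :
    {sigma_finite_measure set (n.-tuple (measurableTypeR R)) -> \bar R} :=
  match n with
  | 0 => \d_([tuple] : 0.-tuple (measurableTypeR R))
  | n'.+1 => cons_measure (@lebesgue_measure R) (borel_lebesgue R n')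
  end.

(* The points of [Rn R n] are n-tuples, but its measurable sets are the
   Lebesgue (Caratheodory) measurable ones, rather than only the Borel ones. *)
Definition Rn (R : realType) (n : nat) : measurableType _ :=
  caratheodory_type ((borel_lebesgue R n)^*)%mu.

Definition lebesgue (R : realType) (n : nat) : {measure set (Rn R n) -> \bar R} :=
  @completed_measure_extension _ _ _ (borel_lebesgue R n).

Section definitions.
Context {R : realType} {n : nat}.
Notation E := (Rn R n).
Notation mu := (lebesgue R n).
Implicit Types (f g w v : E -> \bar R) (p : R).

(* Open cubes with sides parallel to the axes. Using closed cubes would not
   change the suprema below, as faces are null sets. *)
Definition cube (a : 'I_n -> R) (l : R) : set E :=
  [set x | forall i, (a i < tnth x i < a i + l)%R].

Definition cubes : set (set E) :=
  [set Q | exists a l, (0 < l)%R /\ Q = cube a l].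

Definition average f (Q : set E) : \bar R := (mu Q)^-1 * \int[mu]_(y in Q) f y.

Definition maximal f (x : E) : \bar R :=
  ereal_sup [set average (fun y => `|f y|) Q | Q in cubes `&` [set Q | Q x]].

Definition weight w : Prop :=
  measurable_fun setT w /\ {ae mu, forall x, 0 < w x < +oo}.

Definition weight_measure w (A : set E) : \bar R := \int[mu]_(x in A) w x.

Definition weighted_maximal v f (x : E) : \bar R :=
  ereal_sup [set (weight_measure v Q)^-1 * \int[mu]_(y in Q) (`|f y| * v y)
            | Q in cubes `&` [set Q | Q x]].

(* At a point where w is 0 or +oo the library's conventions for powers and
   inverses are immaterial: these points form a null set when w is a weight. *)
Definition A1_const w : \bar R :=
  Lnorm mu +oo (fun x => maximal w x / w x).

Definition Ap_const p w : \bar R :=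
  if p == 1%R then A1_const w else
  let p' := fine (hoelder_conjugate p%:E) in
  ereal_sup [set average w Q *
                 average (fun x => w x `^ (1 - p')) Q `^ (p - 1) | Q in cubes].

Definition A_infty w : Prop :=
  weight w /\ exists2 p, (1 <= p)%R & Ap_const p w < +oo.

Definition weighted_Lnorm p w f : \bar R :=
  (\int[mu]_x (`|f x| `^ p * w x)) `^ p^-1.

Definition extrapolation_family (F : set ((E -> \bar R) * (E -> \bar R))) :=
  forall f g, F (f, g) ->
    [/\ measurable_fun setT f, measurable_fun setT g,
        (forall x, 0 <= f x) & (forall x, 0 <= g x)].

(* A Banach function space over (R^n, v dx) is given by its norm. Functions are
   extended real valued; those outside the space have norm +oo. Values of the
   norm on non-measurable functions carry no information. *)
Record banach_function_space v := BanachFunctionSpace {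
  bfs_norm :> (E -> \bar R) -> \bar R ;
  bfs_ge0 : forall f, measurable_fun setT f -> 0 <= bfs_norm f ;
  bfs_abs : forall f, measurable_fun setT f ->
    bfs_norm f = bfs_norm (fun x => `|f x|) ;
  bfs_eq0 : forall f, measurable_fun setT f ->
    bfs_norm f = 0 <-> {ae mu, forall x, f x = 0} ;
  bfs_triangle : forall f g, measurable_fun setT f -> measurable_fun setT g ->
    bfs_norm (f \+ g) <= bfs_norm f + bfs_norm g ;
  bfs_homogeneous : forall (c : R) f, measurable_fun setT f ->
    bfs_norm (fun x => c%:E * f x) = `|c%:E| * bfs_norm f ;
  bfs_monotone : forall f g, measurable_fun setT f -> measurable_fun setT g ->
    {ae mu, forall x, `|f x| <= `|g x|} -> bfs_norm f <= bfs_norm g ;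
  bfs_fatou : forall (fs : nat -> E -> \bar R) f,
    (forall j, measurable_fun setT (fs j)) -> measurable_fun setT f ->
    {ae mu, forall x, nondecreasing_seq (fun j => `|fs j x|) /\
      `|fs j x| @[j --> \oo] --> `|f x|} ->
    nondecreasing_seq (fun j => bfs_norm (fs j)) /\
      bfs_norm (fs j) @[j --> \oo] --> bfs_norm f ;
  bfs_indic : forall A : set E, measurable A -> weight_measure v A < +oo ->
    bfs_norm (fun x => (\1_A x)%:E) < +oo ;
  bfs_integral : forall A : set E, measurable A -> weight_measure v A < +oo ->
    exists2 C : R, (0 < C)%R & forall f, measurable_fun setT f ->
      \int[mu]_(x in A) (`|f x| * v x) <= C%:E * bfs_norm f }.

Definition associate_norm v (X : banach_function_space v) f : \bar R :=
  ereal_sup [set \int[mu]_x (`|f x * g x| * v x)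
            | g in [set g | measurable_fun setT g /\ X g <= 1]].

End definitions.

(* Main.v *)
Require Import Defs.
From HB Require Import structures.
From mathcomp Require Import all_boot all_order all_algebra.
From mathcomp Require Import all_classical all_reals all_analysis.
From mathcomp Require Import measurable_realfun ess_sup_inf.
From mathcomp Require Import ring lra.

Set Implicit Arguments.
Unset Strict Implicit.
Unset Printing Implicit Defensive.
Import Order.TTheory GRing.Theory Num.Theory.
Import numFieldNormedType.Exports.

Local Open Scope classical_set_scope.
Local Open Scope ring_scope.
Local Open Scope ereal_scope.

(** Duality reduces the statement to inequalities with Muckenhoupt weights.

    Suppose that f^p u has norm greater than 1 in X_v. Then a function h in the
    unit ball of the associate space X_v' has a pairing greater than 1 with it:
    int f^p u h v > 1. Hypothesis (M) says that M_v is bounded for the norm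
    b |-> ||b / u||_{X_v'}, so the Rubio de Francia algorithm
    [rubio_de_francia], started from b = h u, produces G with b <= 2 G, with G / u
    in the unit ball of X_v', and with M_v G <= k G; that is, G is an A_1 weight
    relative to v. If v is in A_r, then so is G v [Ap_over_A1_mul]. Hence, once the
    weighted hypothesis is known for the exponent p,
      int f^p h u v <= 2 int f^p G v <= C int g^p G v
                     = C int (g^p u) (G / u) v <= C ||g^p u||_{X_v},
    which bounds the norm of f^p u [function_norm_extrapolation].

    Two facts remain. The first is the existence of h, the Lorentz-Luxemburg
    theorem X_v'' = X_v [associate_witness]. A truncation y of the given function
    has norm greater than 1 by the Fatou property. It is projected, in the sense of
    L^2(v), onto the functions between 0 and y of the unit ball of X_v; if b is the
    nearest one [exists_minimiser], then y - b is, after normalisation, the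
    required h, since the first variation of the distance at b shows that
    int z (y - b) v <= int b (y - b) v for all z of the unit ball.

    The second is the passage from p0 to every exponent p for weights in A_infty
    [weighted_bound_all]. Its tool is that every function in L^2(w) has an A_1(w)
    majorant z in L^2(w) with comparable norm [L2_majorant]: an A_r weight is
    doubling, so M_w is bounded on L^2(w) [maximal_strong_type], and the algorithm
    applies again. To decrease the exponent, take z to be a majorant of g^(p/2) and
    use f^p <= f^(p0) z^(-N) + z^2, where w z^(-N) is a Muckenhoupt weight
    [Ap_over_A1_pow]; this is [weighted_bound_down]. To pass from p to 2 p, take z to
    be a majorant of f^p itself: int f^(2p) w <= 2 int f^p z w <= 2 C int g^p z w,
    and the last integral is split by Young's inequality into a part absorbed by the
    left-hand side and a multiple of int g^(2p) w; this is [weighted_bound_double].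

    The vector-valued inequality is the scalar one for the pairs of l^q norms of
    sequences of pairs of the family: for the exponent q these pairs inherit the
    weighted inequality term by term [lq_pairs_bound].

    The argument is carried out on a measure space with a family of sets sharing a
    few properties of cubes [cube_basis], so that the geometry of R^n enters only
    through [cubes_basis]. *)

(** * Cubes of R^n *)

Section cubes.
Context {R : realType} {n : nat}.
Notation E := (Rn R n).
Notation mu := (lebesgue R n).

Lemma Rn_measurable (A : set (n.-tuple (measurableTypeR R))) :
  measurable A -> measurable (A : set E).
Proof. exact: caratheodory_measurable_mu_ext. Qed.

Lemma lebesgueE (A : set (n.-tuple (measurableTypeR R))) :
  measurable A -> mu A = borel_lebesgue R n A.
Proof. exact: measurable_mu_extE. Qed.

End cubes.

(** By induction on the dimension: a cube of R^(n+1) is the product of an interval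
    and a cube of R^n, and the measure is a product measure. *)
Lemma borel_cube {R : realType} {n : nat} (a : 'I_n -> R) (l : R) :
  (0 <= l)%R ->
  measurable (cube a l : set (n.-tuple (measurableTypeR R))) /\
  borel_lebesgue R n (cube a l) = (l ^+ n)%:E.
Proof.
move=> l0; elim: n a => [|n IH] a.
  rewrite (_ : cube a l = setT); last by apply/seteqP; split=> x // _ [].
  split => //=; rewrite expr0.
  exact: diracT.
have [mC muC] := IH (fun i => a (lift ord0 i)).
have E1 : (cube a l : set (n.+1.-tuple (measurableTypeR R))) =
   ((fun t : n.+1.-tuple (measurableTypeR R) => thead t) @^-1` `]a ord0, (a ord0 + l)%R[%classic) `&`
   ((fun t : n.+1.-tuple (measurableTypeR R) => [tuple of behead t]) @^-1` (cube (fun i => a (lift ord0 i)) l)).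
  apply/seteqP; split => x /=.
    move=> h; split; first by rewrite in_itv /= h.
    by move=> i; have := h (lift ord0 i); rewrite !tnth_behead /= (_ : inord _ = lift ord0 i)// ; apply: val_inj; rewrite /= inordK //= ltnS.
  rewrite in_itv /= => -[h1 h2] i.
  case: (unliftP ord0 i) => [j|] -> //.
  by have := h2 j; rewrite !tnth_behead /= (_ : inord _ = lift ord0 j)// ; apply: val_inj; rewrite /= inordK //= ltnS.
split.
  rewrite E1; apply: measurableI; rewrite -[X in measurable X]setTI.
    by apply: (@measurable_tnth _ (measurableTypeR R) n.+1 ord0) => //.
  by apply: (@measurable_behead _ (measurableTypeR R) n).
rewrite /= /cons_measure /pushforward.
have -> : @tcons _ _ n @^-1` cube a l =
   `]a ord0, (a ord0 + l)%R[%classic `*` cube (fun i => a (lift ord0 i)) l.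
  rewrite E1; apply/seteqP; split => -[x t] /=; rewrite /tcons /= theadE;
  by rewrite (_ : [tuple of _] = t)//; exact: val_inj.
rewrite product_measure1E//=.
rewrite muC lebesgue_measure_itv /= lte_fin.
case: ifP => [_|].
  by rewrite -EFinD addrC addKr -EFinM exprS.
move=> /negbT; rewrite -leNgt => h.
have -> : l = 0%R by lra.
by rewrite exprS mul0r mul0e.
Qed.

Section cube_geometry.
Context {R : realType} {n : nat}.
Notation E := (Rn R n).
Notation mu := (lebesgue R n).
Implicit Types (a : 'I_n -> R) (l : R).

Lemma cubes_cube a l : (0 < l)%R -> cubes (cube a l : set E).
Proof. by exists a, l. Qed.

Lemma measurable_cube a l : (0 <= l)%R -> measurable (cube a l : set E).
Proof. by move=> l0; apply: Rn_measurable; case: (borel_cube a l0). Qed.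

Lemma lebesgue_cube a l : (0 <= l)%R -> mu (cube a l) = (l ^+ n)%:E.
Proof.
by move=> l0; rewrite lebesgueE ?(borel_cube a l0).2//; exact: (borel_cube a l0).1.
Qed.

Lemma measurable_cubes (Q : set E) : cubes Q -> measurable Q.
Proof. by move=> [a [l [/ltW l0 ->]]]; exact: measurable_cube. Qed.

Lemma lebesgue_cubes (Q : set E) : cubes Q -> exists2 m : R, (0 < m)%R & mu Q = m%:E.
Proof.
move=> [a [l [l0 ->]]]; exists (l ^+ n)%R; first exact: exprn_gt0.
exact/lebesgue_cube/ltW.
Qed.

Definition big_cube (k : nat) : set E := cube (fun=> - k.+1%:R)%R (2 * k.+1%:R)%R.

Lemma big_cubeP k (x : E) : big_cube k x <-> forall i, (`|tnth x i| < k.+1%:R)%R.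
Proof.
by split => h i; have := h i; rewrite ltr_norml => /andP[h1 h2]; apply/andP; split; lra.
Qed.

Lemma cubes_big_cube k : cubes (big_cube k).
Proof. by apply: cubes_cube; rewrite mulr_gt0. Qed.

Lemma big_cube_nd : nondecreasing_seq big_cube.
Proof.
move=> i j ij; apply/subsetPset => x /big_cubeP h; apply/big_cubeP => k.
by apply: lt_le_trans (h k) _; rewrite ler_nat ltnS.
Qed.

Lemma big_cube_exhaust (x : E) : exists k, big_cube k x.
Proof.
pose M : R := (\sum_(i < n) `|tnth x i|)%R.
exists (Num.truncn M); apply/big_cubeP => i.
apply: (@le_lt_trans _ _ M); last exact: Num.Theory.truncnS_gt.
by rewrite /M (bigD1 i)//= lerDl sumr_ge0.
Qed.

Lemma bigcup_big_cube : \bigcup_k big_cube k = [set: E].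
Proof. by apply/seteqP; split=> // x _; have [k] := big_cube_exhaust x; exists k. Qed.

(** The rational cubes form a countable base, which makes arbitrary unions of cubes
    countable unions in [countable_subcubes]. *)
Lemma rational_subcube a l (x : E) : cube a l x ->
  exists (b : {ffun 'I_n -> rat}) (q : rat),
    let Q : set E := cube (fun i => ratr (b i)) (ratr q) in
    [/\ (0 < q)%R, Q x & Q `<=` cube a l].
Proof.
move=> xQ.
pose e := \big[Num.min/1%R]_(i < n) Num.min (tnth x i - a i)%R (a i + l - tnth x i)%R.
have e0 : (0 < e)%R.
  apply/Order.TotalTheory.bigmin_gtP; split => // i _.
  by rewrite lt_min !subr_gt0; exact: xQ.
have ei i : (e <= tnth x i - a i)%R /\ (e <= a i + l - tnth x i)%R.
  by apply/andP; rewrite -le_min; exact: bigmin_le_cond.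
have [q] := rat_in_itvoo e0; rewrite in_itv /= => /andP[q0 qe].
have hb i : exists b : rat, (tnth x i - ratr q < ratr b < tnth x i)%R.
  have : (tnth x i - ratr q < tnth x i)%R by rewrite ltrBlDr ltrDl.
  by move=> /rat_in_itvoo[b]; rewrite in_itv; exists b.
have [b bP] := choice hb.
exists [ffun i => b i], q; split.
- by move: q0; rewrite ltr0q.
- by move=> i; rewrite ffunE; have /andP[h1 h2] := bP i; apply/andP; split => //; lra.
- move=> y yQ i; have := yQ i; rewrite ffunE => /andP[h1 h2].
  have /andP[h3 h4] := bP i; have [h5 h6] := ei i.
  by apply/andP; split; lra.
Qed.

(** The q k enumerate the rational cubes that lie in some member of P, and Q k is
    such a member. *)
Lemma countable_subcubes (P : set (set E)) (Q0 : set E) : P `<=` cubes -> P Q0 ->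
  exists q Q : nat -> set E,
    [/\ forall k, measurable (q k), forall k, P (Q k), forall k, q k `<=` Q k &
        \bigcup_(A in P) A = \bigcup_k q k].
Proof.
move=> Pc PQ0.
pose code (k : nat) : set E :=
  if @unpickle ({ffun 'I_n -> rat} * rat)%type k is Some p then
    if (0 < p.2)%R then cube (fun i => ratr (p.1 i)) (ratr p.2) else set0
  else set0.
have mcode k : measurable (code k).
  rewrite /code; case: unpickle => [p|] //; case: ifP => // p0.
  by apply: measurable_cube; rewrite ler0q ltW.
have hQ k : exists A : set E,
    P A /\ ((exists2 A', P A' & code k `<=` A') -> code k `<=` A).
  have [[A PA kA]|h] := pselect (exists2 A, P A & code k `<=` A).
    by exists A.
  by exists Q0; split => // /h.
have [Q QP] := choice hQ.
(* Q0 is the value of Q k when the k-th rational cube lies in no member of P. *)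
exists (fun k => if `[< code k `<=` Q k >] then code k else set0), Q; split.
- by move=> k; case: ifP.
- by move=> k; exact: (QP k).1.
- by move=> k; case: asboolP => // _; exact: sub0set.
apply/seteqP; split => x.
  move=> [A PA Ax]; have [a [l [l0 AE]]] := Pc _ PA.
  move: Ax; rewrite AE => /rational_subcube[b [q [q0 qx qA]]].
  exists (pickle (b, q)) => //.
  have cE : code (pickle (b, q)) = cube (fun i => ratr (b i)) (ratr q).
    by rewrite /code pickleK /= q0.
  case: asboolP => [_|]; first by rewrite cE.
  by case; apply: (QP _).2; exists A => //; rewrite cE AE.
move=> [k _]; case: asboolP => // kQ /kQ ?; exists (Q k) => //; exact: (QP k).1.
Qed.

Definition triple a l : set E := cube (fun i => a i - l)%R (3 * l)%R.

Lemma sub_triple a l : (0 < l)%R -> cube a l `<=` triple a l.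
Proof. by move=> l0 x xQ i; have /andP[] := xQ i => *; apply/andP; split; lra. Qed.

Lemma meet_sub_triple a l b m : (m <= l)%R ->
  (cube a l : set E) `&` cube b m !=set0 -> (cube b m : set E) `<=` triple a l.
Proof.
move=> ml [y [ya yb]] x xb i.
have /andP[? ?] := ya i; have /andP[? ?] := yb i; have /andP[? ?] := xb i.
by apply/andP; split; lra.
Qed.

Lemma cube_center a l : (0 < l)%R -> (cube a l : set E) [tuple (a i + l / 2)%R | i < n].
Proof. by move=> l0 i; rewrite tnth_mktuple; apply/andP; split; lra. Qed.

(** Greedy selection: a cube of largest side is chosen, the cubes that meet it lie
    in its triple, and the selection goes on among the others. *)
Lemma vitali_cubes (a : nat -> 'I_n -> R) (l : nat -> R) (s : seq nat) :
  (forall k, 0 < l k)%R ->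
  exists D : seq nat, [/\ {subset D <= s}, uniq D,
    trivIset [set` D] (fun k => cube (a k) (l k) : set E) &
    forall k, k \in s -> exists2 j, j \in D & cube (a k) (l k) `<=` triple (a j) (l j)].
Proof.
move=> l0; have [m] := ubnP (size s); elim: m s => // m IH s; rewrite ltnS => sm.
have [->|s0] := eqVneq s [::]; first by exists [::]; split.
have [i [si imax]] : exists i, i \in s /\ forall k, k \in s -> (l k <= l i)%R.
  elim: s s0 {sm} => // k s IHs _; have [->|/IHs[i [si imax]]] := eqVneq s [::].
    by exists k; split; [rewrite inE|move=> j; rewrite inE => /eqP ->].
  have [ki|ik] := leP (l k) (l i).
    exists i; split; first by rewrite inE si orbT.
    by move=> j; rewrite inE => /predU1P[->//|/imax].
  exists k; split; first by rewrite inE eqxx.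
  by move=> j; rewrite inE => /predU1P[->//|/imax h]; rewrite (le_trans h)// ltW.
pose meets k := `[< (cube (a i) (l i) : set E) `&` cube (a k) (l k) !=set0 >].
have ii : meets i.
  by apply/asboolP; exists [tuple (a i j + l i / 2)%R | j < n]; split; exact: cube_center.
pose s' := [seq k <- s | ~~ meets k].
have [|D [Ds' uD tD coverD]] := IH s'.
  apply: leq_trans sm; rewrite size_filter -(count_predC meets s).
  rewrite -[X in (X < _)%N]add0n ltn_add2r -has_count; apply/hasP; by exists i.
exists (i :: D); split.
- by move=> k; rewrite inE => /predU1P[->//|/Ds']; rewrite mem_filter => /andP[].
- rewrite /= uD andbT; apply/negP => /Ds'; rewrite mem_filter ii; exact/negP.
- have dis k : k \in D -> (cube (a i) (l i) : set E) `&` cube (a k) (l k) = set0.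
    move=> /Ds'; rewrite mem_filter => /andP[/asboolPn/set0P/negP/negPn/eqP //].
  move=> j k; rewrite /= !inE => /predU1P[->|jD] /predU1P[->|kD] //.
  + by rewrite dis // => /set0P; rewrite eqxx.
  + by rewrite setIC dis // => /set0P; rewrite eqxx.
  + exact: tD.
- move=> k sk; have [/asboolP mk|mk] := boolP (meets k).
    by exists i; [rewrite inE eqxx|apply: meet_sub_triple mk; exact: imax].
  have [|j jD kj] := coverD k; first by rewrite mem_filter mk.
  by exists j => //; rewrite inE jD orbT.
Qed.

End cube_geometry.

(** * Measurability and integrals of nonnegative functions *)

Section measurability_tools.
Context d (T : measurableType d) (R : realType).
Implicit Types (f g : T -> \bar R) (w z : T -> R).

Lemma measurable_abs f : measurable_fun setT f -> measurable_fun setT (fun x => `|f x|).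
Proof. by move=> mf; apply: (measurableT_comp (@abse_measurable R setT)). Qed.

Lemma measurable_mul f g : measurable_fun setT f -> measurable_fun setT g ->
  measurable_fun setT (fun x => f x * g x).
Proof. by move=> mf mg; apply: emeasurable_funM. Qed.

Lemma measurable_add f g : measurable_fun setT f -> measurable_fun setT g ->
  measurable_fun setT (fun x => f x + g x).
Proof. by move=> mf mg; apply: emeasurable_funD. Qed.

Lemma measurable_scale (k : \bar R) f : measurable_fun setT f ->
  measurable_fun setT (fun x => k * f x).
Proof. by move=> mf; apply: measurable_funeM. Qed.

Lemma measurable_efin w : measurable_fun setT w ->
  measurable_fun setT (fun x => (w x)%:E).
Proof. by move=> mw; apply/measurable_EFinP. Qed.

Lemma measurable_eindic (A : set T) : measurable A ->
  measurable_fun setT (fun x => (\1_A x)%:E : \bar R).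
Proof. by move=> mA; apply/measurable_EFinP; exact: measurable_indic. Qed.

Lemma measurable_poweRr f (p : R) : measurable_fun setT f ->
  measurable_fun setT (fun x => f x `^ p).
Proof. by move=> mf; apply: (measurableT_comp (measurable_poweR p)). Qed.

Lemma measurable_expe f k : measurable_fun setT f ->
  measurable_fun setT (fun x => f x ^+ k).
Proof.
move=> mf; elim: k => [|k IH]; first exact: measurable_cst.
under eq_fun do rewrite expeS.
exact: measurable_mul.
Qed.

Lemma measurable_rmul w z : measurable_fun setT w -> measurable_fun setT z ->
  measurable_fun setT (fun x => w x * z x)%R.
Proof. by move=> mw mz; apply: measurable_funM. Qed.

Lemma measurable_rpow w (p : R) : measurable_fun setT w ->
  measurable_fun setT (fun x => w x `^ p)%R.
Proof. by move=> mw; apply: (measurableT_comp (measurable_powR p)). Qed.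

Lemma measurable_superlevel f (y : \bar R) : measurable_fun setT f ->
  measurable [set x | y < f x].
Proof. by move=> mf; rewrite -[X in measurable X]setTI; exact: emeasurable_fun_o_infty. Qed.

End measurability_tools.

Section integral_tools.
Context d (T : measurableType d) (R : realType) (m : {measure set T -> \bar R}).
Implicit Types (f g : T -> \bar R) (A B : set T).

Lemma nn_le_integral_ae A f g : measurable A -> measurable_fun setT f ->
  measurable_fun setT g -> (forall x, 0 <= f x) -> (forall x, 0 <= g x) ->
  {ae m, forall x, A x -> f x <= g x} ->
  \int[m]_(x in A) f x <= \int[m]_(x in A) g x.
Proof.
move=> mA mf mg f0 g0 fg; apply: ae_ge0_le_integral => //.
- exact: measurable_funTS.
- exact: measurable_funTS.
Qed.

Lemma nn_le_integral A f g : measurable A -> measurable_fun setT f ->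
  measurable_fun setT g -> (forall x, 0 <= f x) ->
  (forall x, A x -> f x <= g x) ->
  \int[m]_(x in A) f x <= \int[m]_(x in A) g x.
Proof.
move=> mA mf mg f0 fg; apply: ge0_le_integral => //; exact: measurable_funTS.
Qed.

Lemma nn_le_integral_set A B f : measurable A -> measurable B ->
  measurable_fun setT f -> (forall x, 0 <= f x) -> A `<=` B ->
  \int[m]_(x in A) f x <= \int[m]_(x in B) f x.
Proof.
by move=> mA mB mf f0 AB; apply: ge0_subset_integral => //; exact: measurable_funTS.
Qed.

Lemma integral_setU_le A B f : measurable A -> measurable B ->
  measurable_fun setT f -> (forall x, 0 <= f x) ->
  \int[m]_(x in A `|` B) f x <= \int[m]_(x in A) f x + \int[m]_(x in B) f x.
Proof.
move=> mA mB mf f0.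
have -> : A `|` B = A `|` (B `\` A) by rewrite setUDr setDv setD0.
rewrite ge0_integral_setU//.
- rewrite leeD2l//; apply: nn_le_integral_set => //; exact: measurableD.
- exact: measurableD.
- exact: measurable_funTS.
- by rewrite disj_set2E setDIK.
Qed.

Lemma integral_bigsetU_le (I : eqType) (F : I -> set T) (s : seq I) f :
  (forall i, measurable (F i)) -> measurable_fun setT f -> (forall x, 0 <= f x) ->
  \int[m]_(x in \big[setU/set0]_(i <- s) F i) f x <=
  \sum_(i <- s) \int[m]_(x in F i) f x.
Proof.
move=> mF mf f0; elim: s => [|i s IH]; first by rewrite !big_nil integral_set0.
rewrite !big_cons; apply: le_trans (integral_setU_le _ _ _ _) _ => //.
  exact: bigsetU_measurable.
exact: leeD2l.
Qed.

Lemma integral_indic_mul A f : measurable A ->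
  \int[m]_x (f x * (\1_A x)%:E) = \int[m]_(x in A) f x.
Proof.
move=> mA; rewrite [RHS]integral_mkcond; apply: eq_integral => x _.
rewrite patchE indicE; case: ifPn => xA; first by rewrite mule1.
by rewrite mule0.
Qed.

Lemma integral_gt0 A f : measurable A -> measurable_fun setT f ->
  (forall x, 0 < f x) -> 0 < m A -> 0 < \int[m]_(x in A) f x.
Proof.
move=> mA mf f0 A0; rewrite lt_neqAle eq_sym integral_ge0 ?andbT; last first.
  by move=> x _; exact: ltW.
apply/negP => /eqP I0.
have [N [mN N0 sub]] : ae_eq m A f (cst 0).
  apply/ae_eq_integral_abs => //; first exact: measurable_funTS.
  by rewrite -[RHS]I0; apply: eq_integral => x _; rewrite gee0_abs// ltW.
suff: m A <= m N by rewrite N0 leNgt A0.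
apply: le_measure; rewrite ?inE// => x Ax; apply: sub => /= /(_ Ax) h.
by have := f0 x; rewrite h ltxx.
Qed.

Lemma integral_eq0_ae A f : measurable A -> measurable_fun setT f ->
  (forall x, 0 <= f x) -> \int[m]_(x in A) f x = 0 ->
  {ae m, forall x, A x -> f x = 0}.
Proof.
move=> mA mf f0 I0; apply/(ae_eq_integral_abs m mA); first exact: measurable_funTS.
by rewrite -[RHS]I0; apply: eq_integral => x _; rewrite gee0_abs.
Qed.

Lemma sum_disjoint_integral_le (I : eqType) (F : I -> set T) (s : seq I) f :
  (forall i, measurable (F i)) -> uniq s -> trivIset [set` s] F ->
  measurable_fun setT f -> (forall x, 0 <= f x) ->
  \sum_(i <- s) \int[m]_(x in F i) f x <= \int[m]_x f x.
Proof.
move=> mF us tF mf f0.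
rewrite -(ge0_integral_bigsetU m mF us tF); last 2 first.
- exact: measurable_funTS.
- by move=> x _.
by apply: nn_le_integral_set => //; exact: bigsetU_measurable.
Qed.

(** Continuity from below reduces countable unions to finite ones. *)
Lemma integral_bigcup_le (F : nat -> set T) f (y : R) (b : \bar R) :
  (forall i, measurable (F i)) -> measurable_fun setT f -> (forall x, 0 <= f x) ->
  (0 < y)%R ->
  (forall N, y%:E * \int[m]_(x in \big[setU/set0]_(i <- iota 0 N) F i) f x <= b) ->
  y%:E * \int[m]_(x in \bigcup_i F i) f x <= b.
Proof.
move=> mF mf f0 y0 h.
pose U N := \big[setU/set0]_(i <- iota 0 N) F i.
have mU N : measurable (U N) by exact: bigsetU_measurable.
have UE : \bigcup_k F k = \bigcup_N U N.
  apply/seteqP; split => x [k _ kx].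
    exists k.+1 => //; rewrite /U -bigcup_seq; exists k => //.
    by rewrite /mkset mem_iota leq0n add0n ltnS leqnn.
  by move: kx; rewrite /U -bigcup_seq => -[i _ ix]; exists i.
have ndU : nondecreasing_seq U.
  move=> i j ij; apply/subsetPset; rewrite /U -!bigcup_seq => x [k /= ki kx].
  exists k => //; move: ki; rewrite /mkset !mem_iota !leq0n !add0n /= => ki.
  exact: leq_trans ki ij.
rewrite UE -lee_pdivlMl//.
apply: (@cvge_to_le _ \oo _ R (fun N => \int[m]_(x in U N) f x)).
  apply: (@ge0_nondecreasing_set_cvg_integral _ _ _ U f) => //.
  by move=> i; exact: measurable_funTS.
by apply: nearW => N; rewrite lee_pdivlMl//; exact: h.
Qed.

End integral_tools.

(** * Maximal operators of a basis of sets *)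

Section basis.
Context d (E : measurableType d) (R : realType) (mu : {measure set E -> \bar R}).

(** The properties of cubes used in the proof. For cubes of R^n, dil Q is the cube
    with the centre of Q and three times its side, and c = 3^n. [basis_lindelof]
    gives the measurability of maximal functions and, with [basis_vitali], the
    covering of their superlevel sets. *)
Record cube_basis (B : set (set E)) (dil : set E -> set E) (c : R) := CubeBasis {
  basis_measurable : forall Q, B Q -> measurable Q ;
  basis_measure : forall Q, B Q -> exists2 m : R, (0 < m)%R & mu Q = m%:E ;
  basis_dil : forall Q, B Q -> [/\ B (dil Q), Q `<=` dil Q & mu (dil Q) <= c%:E * mu Q] ;
  basis_exhaust : exists F : nat -> set E,
    [/\ forall k, B (F k), nondecreasing_seq F & \bigcup_k F k = setT] ;
  basis_lindelof : forall P Q0, P `<=` B -> P Q0 ->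
    exists q Q : nat -> set E,
    [/\ forall k, measurable (q k), forall k, P (Q k), forall k, q k `<=` Q k &
        \bigcup_(A in P) A = \bigcup_k q k] ;
  basis_vitali : forall (Q : nat -> set E) (s : seq nat), (forall k, B (Q k)) ->
    exists D : seq nat, [/\ {subset D <= s}, uniq D, trivIset [set` D] Q &
      forall k, k \in s -> exists2 j, j \in D & Q k `<=` dil (Q j)] }.

Variables (B : set (set E)) (dil : set E -> set E) (c : R).
Hypothesis hB : cube_basis B dil c.
Implicit Types (v f : E -> \bar R) (w : E -> R).

Lemma basis_mem x : exists2 Q, B Q & Q x.
Proof.
have [F [BF _ FT]] := basis_exhaust hB.
by have [k _ kx] : (\bigcup_k F k) x; [rewrite FT|exists (F k)].
Qed.

Lemma basis_ae (P : E -> Prop) : (forall Q, B Q -> {ae mu, forall x, Q x -> P x}) ->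
  {ae mu, forall x, P x}.
Proof.
move=> h; have [F [BF _ FT]] := basis_exhaust hB.
have : {ae mu, forall x k, F k x -> P x} by apply: ae_foralln => k; exact: h.
apply: filterS => x hx.
by have [k _ kx] : (\bigcup_k F k) x; [rewrite FT|exact: hx kx].
Qed.

(** A weight is determined only almost everywhere, so a version with real positive
    values at every point is used throughout; see [real_version]. *)
Definition pos_weight w := measurable_fun setT w /\ forall x, (0 < w x)%R.

Definition locally_finite w := forall Q, B Q -> \int[mu]_(x in Q) (w x)%:E < +oo.

Definition doubling (D : R) w := forall Q, B Q ->
  \int[mu]_(x in dil Q) (w x)%:E <= D%:E * \int[mu]_(x in Q) (w x)%:E.

Lemma pos_weightE w : pos_weight w -> measurable_fun setT (EFin \o w).
Proof. by move=> [mw _]; exact: measurable_efin. Qed.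

Lemma pos_weight_div w1 w2 : pos_weight w1 -> pos_weight w2 ->
  pos_weight (fun x => w1 x / w2 x)%R.
Proof.
move=> [m1 p1] [m2 p2]; split; last by move=> x; rewrite divr_gt0.
apply: measurable_rmul => //.
rewrite (_ : (fun x => (w2 x)^-1)%R = (fun x => w2 x `^ (- 1))%R).
  exact: measurable_rpow.
by apply/funext => x; rewrite powR_inv1// ltW.
Qed.

Lemma basis_weight w (Q : set E) : pos_weight w -> locally_finite w -> B Q ->
  exists2 s : R, (0 < s)%R & \int[mu]_(x in Q) (w x)%:E = s%:E.
Proof.
move=> pw lw cQ; have := lw _ cQ.
have : 0 < \int[mu]_(x in Q) (w x)%:E.
  apply: integral_gt0.
  - exact: basis_measurable hB _ cQ.
  - exact: pos_weightE.
  - by move=> x; rewrite lte_fin pw.2.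
  - by have [m m0 ->] := basis_measure hB cQ; rewrite lte_fin.
by case: integral => // s; rewrite lte_fin => s0 _; exists s.
Qed.

Definition basis_maximal v f x : \bar R :=
  ereal_sup [set (\int[mu]_(y in Q) v y)^-1 * \int[mu]_(y in Q) (`|f y| * v y)
            | Q in B `&` [set Q | Q x]].

Lemma basis_maximal_superlevel v f (y : \bar R) :
  [set x | y < basis_maximal v f x] =
  \bigcup_(Q in [set Q | B Q /\
    y < (\int[mu]_(z in Q) v z)^-1 * \int[mu]_(z in Q) (`|f z| * v z)]) Q.
Proof.
apply/seteqP; split => x /=.
  by move=> /ereal_sup_gt[_ [Q [cQ Qx] <-] yQ]; exists Q.
move=> [Q [cQ yQ] Qx]; apply: lt_le_trans yQ _.
by apply: ereal_sup_ubound; exists Q.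
Qed.

Lemma measurable_basis_union P : P `<=` B -> measurable (\bigcup_(A in P) A).
Proof.
move=> Pc; have [[Q0 PQ0]|h] := pselect (exists Q, P Q).
  have [q [Q [mq _ _ ->]]] := basis_lindelof hB Pc PQ0.
  exact: bigcupT_measurable.
rewrite (_ : \bigcup_(A in P) A = set0)//.
by apply/seteqP; split => // x [A PA _]; case: h; exists A.
Qed.

(** The superlevel sets are unions of basis sets, perhaps uncountably many; such
    unions are measurable by [basis_lindelof]. *)
Lemma measurable_basis_maximal v f : measurable_fun setT (basis_maximal v f).
Proof.
apply: (measurability (@ErealGenOInfty.G R)).
  exact: ErealGenOInfty.measurableE.
move=> /= _ [_ [x ->] <-]; rewrite setTI [X in measurable X](_ : _ =
  [set z | x%:E < basis_maximal v f z]).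
  by rewrite basis_maximal_superlevel; apply: measurable_basis_union => Q [].
by apply/seteqP; split => z /=; rewrite in_itv /= andbT.
Qed.

Lemma basis_maximal_ge v f (Q : set E) x : B Q -> Q x ->
  (\int[mu]_(y in Q) v y)^-1 * \int[mu]_(y in Q) (`|f y| * v y) <= basis_maximal v f x.
Proof. by move=> cQ Qx; apply: ereal_sup_ubound; exists Q. Qed.

Lemma basis_maximal_ge0 w f x : pos_weight w -> 0 <= basis_maximal (EFin \o w) f x.
Proof.
move=> pw; have [Q BQ Qx] := basis_mem x.
apply: le_trans (basis_maximal_ge _ _ BQ Qx).
apply: mule_ge0; rewrite ?inve_ge0; apply: integral_ge0 => y _ /=.
  by rewrite lee_fin ltW// pw.2.
by rewrite mule_ge0// lee_fin ltW// pw.2.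
Qed.

End basis.

(** * The weighted maximal operator on L^2 *)

Section weak_type.
Context d (E : measurableType d) (R : realType) (mu : {measure set E -> \bar R}).
Variables (B : set (set E)) (dil : set E -> set E) (c : R).
Hypothesis hB : cube_basis mu B dil c.
Variables (w : E -> R) (D : R).
Hypotheses (pw : pos_weight w) (lw : locally_finite mu B w) (D0 : (0 < D)%R)
  (dw : doubling mu B dil D w).
Implicit Types (f : E -> \bar R).

Let mw : measurable_fun setT (EFin \o w) := pos_weightE pw.
Let w0 x : 0 <= (w x)%:E. Proof. by rewrite lee_fin ltW// pw.2. Qed.

Let mfw f : measurable_fun setT f -> measurable_fun setT (fun x => `|f x| * (w x)%:E).
Proof. by move=> mf; apply: measurable_mul mw; exact: measurable_abs. Qed.

Let fw0 f x : 0 <= `|f x| * (w x)%:E. Proof. exact: mule_ge0. Qed.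

(** The superlevel set is covered by countably many sets q k, each inside a basis
    set Q k on which the weighted average of |f| exceeds y. Among finitely many of
    the Q k, disjoint ones are selected whose dilates cover the q k; the doubling
    property pays for the dilation, and disjointness makes the integrals of |f| add
    up to at most the whole integral. *)
Lemma maximal_weak_type f (y : R) : measurable_fun setT f -> (0 < y)%R ->
  y%:E * \int[mu]_(x in [set x | y%:E < basis_maximal mu B (EFin \o w) f x]) (w x)%:E
  <= D%:E * \int[mu]_x (`|f x| * (w x)%:E).
Proof.
move=> mf y0; rewrite basis_maximal_superlevel.
set P := [set Q | _].
have Pc : P `<=` B by move=> Q [].
have [[Q0 PQ0]|h] := pselect (exists Q, P Q); last first.
  rewrite (_ : \bigcup_(A in P) A = set0) ?integral_set0 ?mule0.
    by rewrite mule_ge0 ?lee_fin ?(ltW D0)// integral_ge0.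
  by apply/seteqP; split => // x [A PA _]; case: h; exists A.
have [q [Q [mq PQ qQ ->]]] := basis_lindelof hB Pc PQ0.
have PI A : P A -> y%:E * \int[mu]_(x in A) (w x)%:E <=
    \int[mu]_(x in A) (`|f x| * (w x)%:E).
  move=> [cA]; have [s s0] := basis_weight hB pw lw cA.
  move=> /= -> /ltW.
  by rewrite inver gt_eqF// lee_pdivlMl// muleC.
apply: integral_bigcup_le => // N.
have [V [Vs uV tV cV]] := basis_vitali hB (iota 0 N) (fun k => Pc _ (PQ k)).
have mQ k : measurable (Q k) by apply: basis_measurable hB _ _; exact: Pc.
have mT k : measurable (dil (Q k)).
  by apply: basis_measurable hB _ _; case: (basis_dil hB (Pc _ (PQ k))).
apply: (@le_trans _ _ (y%:E * \sum_(i <- V) \int[mu]_(x in dil (Q i)) (w x)%:E)).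
  rewrite lee_pmul2l ?lte_fin//.
  apply: (@le_trans _ _
    (\int[mu]_(x in \big[setU/set0]_(i <- V) dil (Q i)) (w x)%:E)); last first.
    exact: integral_bigsetU_le.
  apply: nn_le_integral_set => //; [exact: bigsetU_measurable|exact: bigsetU_measurable|].
  rewrite -!bigcup_seq => x [k /= kN /qQ kx].
  by have [j jV /(_ _ kx) jx] := cV _ kN; exists j.
apply: (@le_trans _ _ (y%:E * \sum_(i <- V) (D%:E * \int[mu]_(x in Q i) (w x)%:E))).
  by rewrite lee_pmul2l ?lte_fin//; apply: lee_sum => i _; apply: dw; exact: Pc.
rewrite -ge0_sume_distrr; last by move=> i _; exact: integral_ge0.
rewrite muleCA lee_pmul2l ?lte_fin// ge0_sume_distrr; last by move=> i _; exact: integral_ge0.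
apply: (@le_trans _ _ (\sum_(i <- V) \int[mu]_(x in Q i) (`|f x| * (w x)%:E))).
  by apply: lee_sum => i _; exact: PI.
by apply: sum_disjoint_integral_le => //; exact: mfw.
Qed.

(** The part of f below y / 2 contributes at most y / 2 to every average. So where
    the maximal function of f exceeds y, that of the part of f above y / 2 exceeds
    y / 2, and the weak type inequality applies to that part at the height y / 2. *)
Lemma maximal_weak_type_truncated f (y : R) : measurable_fun setT f ->
  (forall x, 0 <= f x) -> (0 < y)%R ->
  y%:E * \int[mu]_(x in [set x | y%:E < basis_maximal mu B (EFin \o w) f x]) (w x)%:E
  <= (2 * D)%:E * \int[mu]_x (f x * (w x)%:E * (\1_[set z : E | (y%:E < 2%:E * f z)%E] x)%:E).
Proof.
move=> mf f0 y0.
pose A := [set z : E | (y%:E < 2%:E * f z)%E].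
have mA : measurable A by apply: measurable_superlevel; exact: measurable_scale.
pose g x := f x * (\1_A x)%:E.
have mg : measurable_fun setT g by apply: measurable_mul => //; exact: measurable_eindic.
have g0 x : 0 <= g x by rewrite mule_ge0// lee_fin.
have fg x : f x <= g x + (y / 2)%:E.
  rewrite /g indicE; have [xA|xA] := boolP (x \in A).
    by rewrite mule1 leeDl// lee_fin divr_ge0// ltW.
  move: xA; rewrite notin_setE /A /= mule0 add0e => /negP; rewrite -leNgt.
  by rewrite -lee_pdivlMl// muleC -EFinM mulrC.
have y20 : (0 < y / 2)%R by rewrite divr_gt0.
have sub : \int[mu]_(x in [set x | y%:E < basis_maximal mu B (EFin \o w) f x]) (w x)%:E
    <= \int[mu]_(x in [set x | (y / 2)%:E < basis_maximal mu B (EFin \o w) g x]) (w x)%:E.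
  apply: nn_le_integral_set => //.
  - exact/measurable_superlevel/(measurable_basis_maximal hB).
  - exact/measurable_superlevel/(measurable_basis_maximal hB).
  move=> x /= /ereal_sup_gt[_ [Q [cQ Qx] <-] yQ].
  apply: (lt_le_trans _ (basis_maximal_ge mu (EFin \o w) g cQ Qx)).
  have [s s0 sE] := basis_weight hB pw lw cQ.
  move: yQ; rewrite sE inver gt_eqF// !lte_pdivlMl// => yQ.
  have mQ := basis_measurable hB cQ.
  have : \int[mu]_(x in Q) (`|f x| * (w x)%:E) <=
     \int[mu]_(x in Q) (`|g x| * (w x)%:E) + (y / 2)%:E * s%:E.
    rewrite -sE.
    have mcw : measurable_fun setT (fun z => (y / 2)%:E * (w z)%:E) by exact: measurable_scale.
    have cw0 z : 0 <= (y / 2)%:E * (w z)%:E by rewrite mule_ge0// lee_fin ltW.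
    have -> : (y / 2)%:E * \int[mu]_(x in Q) (w x)%:E = \int[mu]_(x in Q) ((y / 2)%:E * (w x)%:E).
      rewrite ge0_integralZl// ?lee_fin ?(ltW y20)//; exact: measurable_funTS.
    rewrite -ge0_integralD//; last 2 first.
    - by apply: measurable_funTS; exact: mfw.
    - exact: measurable_funTS.
    apply: nn_le_integral => //; first exact: mfw.
      by apply: measurable_add => //; exact: mfw.
    move=> z _; rewrite -ge0_muleDl ?lee_fin ?(ltW y20)//.
    by rewrite lee_wpmul2r// !gee0_abs.
  move=> /(lt_le_trans yQ); rewrite -lteBlDr; last by rewrite -EFinM.
  move=> /le_lt_trans; apply; rewrite -!EFinM -EFinB lee_fin.
  by rewrite [leRHS](_ : _ = s * (y / 2))%R//; field.
have H := maximal_weak_type mg y20.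
have gE : \int[mu]_x (`|g x| * (w x)%:E) =
    \int[mu]_x (f x * (w x)%:E * (\1_A x)%:E).
  by apply: eq_integral => x _; rewrite gee0_abs// /g muleAC.
rewrite gE in H; apply: (@le_trans _ _ (2%:E * ((y / 2)%:E *
  \int[mu]_(x in [set x | (y / 2)%:E < basis_maximal mu B (EFin \o w) g x]) (w x)%:E))).
  rewrite muleA -EFinM [X in X%:E * _ <= _](_ : _ = 2 * (y / 2))%R; last by field.
  by rewrite lee_pmul2l ?lte_fin// mulr_gt0.
by rewrite (EFinM 2 D) -muleA lee_pmul2l ?lte_fin.
Qed.

End weak_type.

Section layer_cake.
Context {R : realType}.
Implicit Types (y : \bar R) (e : R).

(** The heights of a layer cake decomposition in dyadic steps, starting at e. *)
Definition level e k : R := (2 ^+ k * e)%R.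

Lemma level_gt0 e k : (0 < e)%R -> (0 < level e k)%R.
Proof. by move=> e0; rewrite mulr_gt0// exprn_gt0. Qed.

Definition above (r : R) y : \bar R := (if (r%:E < y)%E then 1%R else 0%R)%:E.

Lemma above_ge0 r y : 0 <= above r y.
Proof. by rewrite /above lee_fin; case: ifP. Qed.

(** If 2^k e < y <= 2^(k+1) e, then the k-th term alone is at least y^2. For
    y = +oo the series is at least r^2 for every real r, by the case y = r. *)
Lemma square_le_layers e y : (0 < e)%R -> e%:E < y ->
  y ^+ 2 <= \sum_(k <oo) (4 * level e k ^+ 2)%:E * above (level e k) y.
Proof.
move=> e0 ey.
have t0 k z : 0 <= (4 * level e k ^+ 2)%:E * above (level e k) z.
  by rewrite mule_ge0 ?above_ge0// lee_fin mulr_ge0// sqr_ge0.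
have key (r : R) : (e < r)%R ->
    (r%:E) ^+ 2 <= \sum_(k <oo) (4 * level e k ^+ 2)%:E * above (level e k) r%:E.
  move=> er.
  have [k /andP[k1 k2]] : exists k, (level e k < r <= level e k.+1)%R.
    have ex : exists k, (r <= level e k)%R.
      exists (Num.truncn (r / e)); rewrite /level -ler_pdivrMr//.
      apply: le_trans (ltW (truncnS_gt _)) _.
      by rewrite -natrX ler_nat ltn_expl.
    case: (ex_minnP ex) => -[|k] rk kmin.
      by move: rk; rewrite /level expr0 mul1r leNgt er.
    by exists k; rewrite rk andbT ltNge; apply/negP => /kmin; rewrite ltnn.
  apply: (@le_trans _ _ ((4 * level e k ^+ 2)%:E * above (level e k) r%:E)).
    rewrite /above lte_fin k1 mule1 -EFin_expe lee_fin.
    have r0 := lt_trans e0 er.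
    apply: (@le_trans _ _ (level e k.+1 ^+ 2)%R); first by rewrite lerXn2r// ?nnegrE ?(ltW r0)// (ltW (level_gt0 _ e0)).
    by rewrite [leLHS](_ : _ = 4 * level e k ^+ 2)%R// /level (exprS _ k); ring.
  apply: le_trans (nneseries_lim_ge k.+1 _) => //.
  by rewrite big_nat_recr//= leeDr// sume_ge0.
case: y ey => [r| |//]; first by rewrite lte_fin => /key.
move=> _; rewrite [leRHS](_ : _ = +oo) ?leey//; apply/eqyP => A A0.
pose r := (Num.max (e + 1) (Num.max A 1))%R.
have er : (e < r)%R by rewrite lt_max ltrDl ltr01.
have Ar : (A <= r)%R by rewrite /r !le_max lexx orbT.
have r1 : (1 <= r)%R by rewrite /r !le_max lexx !orbT.
apply: (@le_trans _ _ (r%:E ^+ 2)).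
  rewrite -EFin_expe lee_fin; apply: (le_trans Ar).
  by rewrite expr2 ler_peMr// (le_trans ler01).
apply: le_trans (key _ er) _; apply: lee_nneseries => // k _.
apply: lee_wpmul2l; first by rewrite lee_fin mulr_ge0// sqr_ge0.
by rewrite /above lee_fin ltry; case: ifP.
Qed.

(** The terms are successive powers of two, so that their sum is at most twice the
    largest of them, which is below a. *)
Lemma sum_levels_le e (a : \bar R) : (0 < e)%R -> 0 <= a ->
  \sum_(k <oo) (level e k)%:E * above (level e k) a <= 2%:E * a.
Proof.
move=> e0 a0.
have t0 k : 0 <= (level e k)%:E * above (level e k) a.
  by rewrite mule_ge0 ?above_ge0// lee_fin ltW// level_gt0.
(* The sum of the levels below the N-th one is at most that level. *)
have geo N : \sum_(0 <= k < N) (level e k)%:E * above (level e k) a <= (level e N)%:E.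
  elim: N => [|N IH]; first by rewrite big_geq// lee_fin ltW// level_gt0.
  have -> : (level e N.+1)%:E = (level e N)%:E + (level e N)%:E.
    by rewrite -EFinD /level exprS; congr EFin; ring.
  rewrite big_nat_recr//=.
  apply: leeD => //; rewrite -[leRHS]mule1 lee_wpmul2l ?lee_fin ?(ltW (level_gt0 _ e0))//.
  by rewrite /above; case: ifP => _; [exact: lexx|exact: lee01].
apply: lime_le; first exact: is_cvg_nneseries.
apply: nearW => N.
elim: N => [|N IH]; first by rewrite big_geq// mule_ge0.
rewrite big_nat_recr//=; rewrite {2}/above; case: ifPn => h; last by rewrite mule0 adde0.
have {}h := ltW h.
rewrite mule1 mule_natl mule2n; apply: leeD => //; exact: le_trans (geo N) _.
Qed.

End layer_cake.

Section strong_type.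
Context d (E : measurableType d) (R : realType) (mu : {measure set E -> \bar R}).
Variables (B : set (set E)) (dil : set E -> set E) (c : R).
Hypothesis hB : cube_basis mu B dil c.
Variables (w : E -> R) (D : R).
Hypotheses (pw : pos_weight w) (lw : locally_finite mu B w) (D0 : (0 < D)%R)
  (dw : doubling mu B dil D w).

Let mw : measurable_fun setT (EFin \o w) := pos_weightE pw.
Let w0 x : 0 <= (w x)%:E. Proof. by rewrite lee_fin ltW// pw.2. Qed.

(** Marcinkiewicz interpolation in discrete form. The square of the maximal function
    is split into dyadic layers, the truncated weak type inequality is applied at
    each level, and the levels are summed back at each point. The constant is
    4 from the layers, times 2 D from the weak type, times 2 * 2 from the sum of the
    levels below 2 f. *)
Lemma maximal_strong_type (f : E -> \bar R) : measurable_fun setT f -> (forall x, 0 <= f x) ->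
  \int[mu]_x (basis_maximal mu B (EFin \o w) f x ^+ 2 * (w x)%:E) <=
  (32 * D)%:E * \int[mu]_x (f x ^+ 2 * (w x)%:E).
Proof.
move=> mf f0; set Mf := basis_maximal mu B (EFin \o w) f.
have mM : measurable_fun setT Mf by exact: measurable_basis_maximal hB _ _.
have M0 x : 0 <= Mf x by apply: (basis_maximal_ge0 hB).
have m2 : measurable_fun setT (fun x => Mf x ^+ 2 * (w x)%:E).
  by apply: measurable_mul mw; exact: measurable_expe.
have p2 x : 0 <= Mf x ^+ 2 * (w x)%:E by rewrite mule_ge0// expe_ge0.
(* The layers start at a positive height e k; the sets A k, where the maximal
   function vanishes or exceeds e k, exhaust the space. *)
pose e (k : nat) := (k.+1%:R^-1 : R)%R.
have e0 k : (0 < e k)%R by rewrite invr_gt0.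
pose A k := [set x | Mf x <= 0] `|` [set x | (e k)%:E < Mf x].
have mA k : measurable (A k).
  apply: measurableU; last exact: measurable_superlevel.
  by rewrite -[X in measurable X]setTI; exact: emeasurable_fun_infty_c.
have AT : setT = \bigcup_k A k.
  apply/seteqP; split => // x _.
  have [x0|] := leP (Mf x) 0; first by exists 0%N => //; left.
  case Mx : (Mf x) => [r| |//].
    rewrite lte_fin => r0; exists (Num.truncn r^-1) => //; right.
    rewrite /= Mx lte_fin /e invf_plt ?posrE//.
    exact: truncnS_gt.
  by move=> _; exists 0%N => //; right; rewrite /= Mx ltry.
have ndA : nondecreasing_seq A.
  move=> i j ij; apply/subsetPset => x [xl|xr]; [by left|right].
  apply: le_lt_trans xr; rewrite lee_fin /e lef_pV2 ?posrE// ler_nat ltnS.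
  exact: ij.
rewrite [X in \int[mu]_(x in X) _]AT.
apply: (@cvge_to_le _ \oo _ R (fun k => \int[mu]_(x in A k) (Mf x ^+ 2 * (w x)%:E))).
  apply: (@ge0_nondecreasing_set_cvg_integral _ _ _ A) => //.
  by move=> i; exact: measurable_funTS.
apply: nearW => N; have := mA N; rewrite /A; move: (e N) (e0 N) => eN eN0 mAN.
pose l k := level eN k.
have l0 k : (0 < l k)%R by exact: level_gt0.
have aboveE (g : E -> \bar R) k x : above (l k) (g x) = (\1_[set z : E | ((l k)%:E < g z)%E] x)%:E.
  rewrite /above indicE; case: ifPn => h; first by rewrite mem_set.
  by rewrite memNset//=; exact/negP.
have mabove (g : E -> \bar R) k : measurable_fun setT g ->
    measurable_fun setT (fun x => above (l k) (g x)).
  move=> mg; under eq_fun do rewrite aboveE.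
  by apply: measurable_eindic; exact: measurable_superlevel.
have mS : measurable_fun setT (fun x => f x * (w x)%:E) by exact: measurable_mul.
have m2f : measurable_fun setT (fun x => 2%:E * f x) by exact: measurable_scale.
pose t k x := ((4 * l k ^+ 2)%:E * above (l k) (Mf x)) * (w x)%:E.
have mt k : measurable_fun setT (t k).
  by apply: measurable_mul mw; apply: measurable_scale; exact: mabove.
have t0 k x : 0 <= t k x.
  by rewrite mule_ge0// mule_ge0 ?above_ge0// lee_fin mulr_ge0// sqr_ge0.
pose s k x := (8 * D * l k)%:E * (f x * (w x)%:E * above (l k) (2%:E * f x)).
have ms k : measurable_fun setT (s k).
  by apply: measurable_scale; apply: measurable_mul => //; exact: (mabove (fun x => 2%:E * f x)).
have s0 k x : 0 <= s k x.
  by rewrite !mule_ge0 ?above_ge0// lee_fin !mulr_ge0// ltW.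
apply: (@le_trans _ _ (\int[mu]_x \sum_(k <oo) t k x)).
  apply: (@le_trans _ _ (\int[mu]_(x in [set x | Mf x <= 0] `|` [set x | eN%:E < Mf x])
      \sum_(k <oo) t k x)).
    apply: nn_le_integral => //.
      by apply: ge0_emeasurable_sum => // k x _ _.
    move=> x xA.
    have tE : \sum_(k <oo) t k x =
        (\sum_(k <oo) (4 * l k ^+ 2)%:E * above (l k) (Mf x)) * (w x)%:E.
      rewrite muleC -nneseriesZl; last first.
        by move=> k _; rewrite mule_ge0 ?above_ge0// lee_fin mulr_ge0// sqr_ge0.
      by apply: eq_eseriesr => k _; rewrite muleC.
    case: xA => [/= xl|/= xr].
      have -> : Mf x = 0 by apply/eqP; rewrite eq_le xl M0.
      by rewrite ?expe2 !mul0e nneseries_ge0.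
    by rewrite tE lee_wpmul2r//; exact: square_le_layers.
  apply: nn_le_integral_set => //.
    by apply: ge0_emeasurable_sum => // k x _ _.
  by move=> x; exact: nneseries_ge0.
rewrite integral_nneseries//.
apply: (@le_trans _ _ (\sum_(k <oo) \int[mu]_x s k x)).
  apply: lee_nneseries => k; first by move=> _ _; exact: integral_ge0.
  move=> _.
  have -> : \int[mu]_x t k x =
      (4 * l k)%:E * ((l k)%:E * \int[mu]_(x in [set x | (l k)%:E < Mf x]) (w x)%:E).
    have -> : \int[mu]_(x in [set x | (l k)%:E < Mf x]) (w x)%:E =
        \int[mu]_x ((w x)%:E * (\1_[set z : E | ((l k)%:E < Mf z)%E] x)%:E).
      by rewrite integral_indic_mul//; exact: measurable_superlevel.
    rewrite muleA -EFinM -mulrA -expr2.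
    rewrite -ge0_integralZl//; last 3 first.
    - by apply: measurable_mul mw _; apply: measurable_eindic; exact: measurable_superlevel.
    - by move=> x _; rewrite mule_ge0// lee_fin.
    - by rewrite lee_fin mulr_ge0// sqr_ge0.
    by apply: eq_integral => x _; rewrite /t aboveE -muleA [X in _ * X]muleC.
  have -> : \int[mu]_x s k x = (4 * l k)%:E * ((2 * D)%:E *
      \int[mu]_x (f x * (w x)%:E * (\1_[set z : E | ((l k)%:E < 2%:E * f z)%E] x)%:E)).
    rewrite muleA -EFinM -ge0_integralZl//; last 3 first.
    - by apply: measurable_mul => //; apply: measurable_eindic; exact: measurable_superlevel.
    - by move=> x _; rewrite !mule_ge0// lee_fin.
    - by rewrite lee_fin !mulr_ge0// ltW.
    apply: eq_integral => x _; rewrite /s (aboveE (fun x => 2%:E * f x)).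
    by congr (_%:E * _); ring.
  rewrite lee_pmul2l ?lte_fin ?mulr_gt0//.
  exact: (maximal_weak_type_truncated hB).
rewrite -integral_nneseries//.
rewrite -ge0_integralZl//; last 3 first.
- by apply: measurable_mul mw; exact: measurable_expe.
- by move=> x _; rewrite mule_ge0// expe_ge0.
- by rewrite lee_fin mulr_ge0// ltW.
apply: nn_le_integral => //.
- by apply: ge0_emeasurable_sum => // k x _ _.
- by apply: measurable_scale; apply: measurable_mul mw; exact: measurable_expe.
- by move=> x; exact: nneseries_ge0.
move=> x _; have [fx|] := boolP (f x \is a fin_num); last first.
  rewrite ge0_fin_numE// -leNgt leye_eq => /eqP ->.
  by rewrite expe2 mulyy gt0_mulye ?lte_fin ?pw.2// gt0_muley ?leey// lte_fin mulr_gt0.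
have := f0 x; move: fx; rewrite fin_numE /s; case: (f x) => [a _|//|//].
rewrite lee_fin => a0.
apply: (@le_trans _ _ ((8 * D * a * w x)%:E *
    \sum_(k <oo) (l k)%:E * above (l k) (2%:E * a%:E))).
  rewrite -nneseriesZl; last by move=> k _; rewrite mule_ge0 ?above_ge0// lee_fin ltW.
  apply: lee_nneseries => k.
    by move=> _ _; rewrite !mule_ge0 ?above_ge0// lee_fin !mulr_ge0// ltW.
  move=> _; rewrite !muleA -(EFinM (8 * D * l k)%R) -(EFinM _ (w x)) -(EFinM _ (l k)) le_eqVlt; apply/orP; left; apply/eqP.
  by congr (_%:E * _); ring.
apply: (@le_trans _ _ ((8 * D * a * w x)%:E * (2%:E * (2%:E * a%:E)))).
  apply: lee_wpmul2l; first by rewrite lee_fin !mulr_ge0// ltW// pw.2.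
  by apply: sum_levels_le => //; rewrite mule_ge0 ?lee_fin.
rewrite -EFin_expe -!EFinM lee_fin le_eqVlt; apply/orP; left; apply/eqP; ring.
Qed.

End strong_type.

(** * The Rubio de Francia algorithm *)

Section dyadic_series.
Context {R : realType}.
Implicit Types (u : nat -> \bar R).

Definition dyadic k : R := ((2 ^+ k.+1)^-1)%R.

Lemma dyadic_gt0 k : (0 < dyadic k)%R.
Proof. by rewrite invr_gt0 exprn_gt0. Qed.

Lemma dyadicS k : (dyadic k = 2 * dyadic k.+1)%R.
Proof. by rewrite /dyadic [in RHS]exprS invfM mulrA divff ?mul1r. Qed.

Lemma sum_dyadic : \sum_(k <oo) (dyadic k)%:E <= 1.
Proof.
apply: lime_le; first by apply: is_cvg_nneseries => k _ _; rewrite lee_fin ltW// dyadic_gt0.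
apply: nearW => N; suff -> : \sum_(0 <= k < N) (dyadic k)%:E = (1 - (2 ^+ N)^-1)%:E.
  by rewrite lee_fin lerBlDr lerDl invr_ge0 exprn_ge0.
elim: N => [|N IH]; first by rewrite big_geq// expr0 invr1 subrr.
rewrite big_nat_recr//= IH -EFinD; congr EFin; rewrite /dyadic exprS.
have h : (2 ^+ N != 0 :> R)%R by rewrite expf_neq0.
field; exact: h.
Qed.

Lemma series_shift_le u : (forall k, 0 <= u k) ->
  \sum_(k <oo) u k.+1 <= \sum_(k <oo) u k.
Proof.
move=> u0; apply: lime_le; first by apply: is_cvg_nneseries => k _ _.
apply: nearW => N; apply: le_trans (nneseries_lim_ge N.+1 _) => //.
by rewrite [leRHS]big_nat_recl//= leeDr.
Qed.

Lemma series_term_le u k : (forall k, 0 <= u k) -> u k <= \sum_(k <oo) u k.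
Proof.
move=> u0; apply: le_trans (nneseries_lim_ge k.+1 _) => //.
by rewrite big_nat_recr//= leeDr// sume_ge0.
Qed.

End dyadic_series.

Section real_version.
Context d (E : measurableType d) (R : realType) (mu : {measure set E -> \bar R}).

(** Where G vanishes or is infinite, its value is replaced by 1. *)
Lemma real_version (G : E -> \bar R) : measurable_fun setT G ->
  {ae mu, forall x, 0 < G x < +oo} ->
  exists2 z : E -> R, pos_weight z & {ae mu, forall x, G x = (z x)%:E}.
Proof.
move=> mG aeG.
pose A := [set x | 0 < G x] `&` [set x | G x < +oo].
have mA : measurable A.
  apply: measurableI; first exact: measurable_superlevel.
  by rewrite -[X in measurable X]setTI; exact: emeasurable_fun_infty_o.
have AE x : A x <-> 0 < G x < +oo.
  by split => [[/= -> ->]|/andP[? ?]].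
pose g x := G x * (\1_A x)%:E + (\1_(~` A) x)%:E.
have mg : measurable_fun setT g.
  apply: measurable_add; [apply: measurable_mul => //|]; apply: measurable_eindic => //.
  exact: measurableC.
have gA x : A x -> g x = G x.
  by move=> Ax; rewrite /g !indicE in_setC mem_set//= mule1 adde0.
have gN x : ~ A x -> g x = 1.
  by move=> Ax; rewrite /g !indicE in_setC memNset//= mule0 add0e.
exists (fine \o g); first split.
- apply: (measurableT_comp (@fine_measurable R setT measurableT) mg).
- move=> x /=; have [Ax|Ax] := pselect (A x).
    by rewrite gA//; apply: fine_gt0; exact/AE.
  by rewrite gN// ltr01.
apply: filterS aeG => x Gx /=; rewrite gA; last exact/AE.
by rewrite fineK// gt0_fin_numE//; case/andP: Gx.
Qed.

End real_version.

Section rubio_de_francia.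
Context d (E : measurableType d) (R : realType) (mu : {measure set E -> \bar R}).
Variables (B : set (set E)) (dil : set E -> set E) (c : R).
Hypothesis hB : cube_basis mu B dil c.
Implicit Types (w z : E -> R).

(** The condition M_w z <= k z, that is, A_1 relative to the measure w dmu, stated for
    one basis set at a time and without division by w(Q). *)
Definition A1_over w z (k : R) := pos_weight z /\ forall Q, B Q ->
  {ae mu, forall x, Q x ->
    \int[mu]_(y in Q) (z y * w y)%:E <= (k * z x)%:E * \int[mu]_(y in Q) (w y)%:E}.

Variables (w : E -> R).
Hypotheses (pw : pos_weight w) (lw : locally_finite mu B w).

Let mw : measurable_fun setT (EFin \o w) := pos_weightE pw.
Let w0 x : 0 <= (w x)%:E. Proof. by rewrite lee_fin ltW// pw.2. Qed.

Notation M := (basis_maximal mu B (EFin \o w)).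

(** Some F k of the exhaustion carries a part of f; if k is large, then x is in F k,
    and the average of |f| over F k is a positive lower bound. *)
Lemma basis_maximal_gt0 (f : E -> \bar R) : measurable_fun setT f ->
  ~ {ae mu, forall x, f x = 0} -> forall x, 0 < M f x.
Proof.
move=> mf fN0 x; have [F [BF ndF FT]] := basis_exhaust hB.
have mfw : measurable_fun setT (fun y => `|f y| * (w y)%:E).
  by apply: measurable_mul mw; exact: measurable_abs.
have fw0 y : 0 <= `|f y| * (w y)%:E by exact: mule_ge0.
have mF k : measurable (F k) by apply: (basis_measurable hB).
have [k0 k0P] : exists k, 0 < \int[mu]_(y in F k) (`|f y| * (w y)%:E).
  apply: contrapT => /forallNP h; apply: fN0.
  have : {ae mu, forall y k, F k y -> `|f y| * (w y)%:E = 0}.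
    apply: ae_foralln => k; apply: integral_eq0_ae => //.
    apply/eqP; rewrite eq_le integral_ge0// andbT leNgt; exact/negP/h.
  apply: filterS => y hy.
  have [k _ ky] : (\bigcup_k F k) y by rewrite FT.
  move/eqP : (hy k ky); rewrite mule_eq0 abse_eq0 => /orP[/eqP//|].
  by rewrite eqe gt_eqF// pw.2.
have [k1 _ k1x] : (\bigcup_k F k) x by rewrite FT.
pose k := maxn k0 k1.
have kx : F k x by apply: (subsetPset _ _ (ndF k1 k (leq_maxr _ _))).
have kP : 0 < \int[mu]_(y in F k) (`|f y| * (w y)%:E).
  apply: lt_le_trans k0P _; apply: nn_le_integral_set => //.
  exact: (subsetPset _ _ (ndF k0 k (leq_maxl _ _))).
apply: lt_le_trans (basis_maximal_ge mu (EFin \o w) f (BF k) kx).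
have [s s0 ->] := basis_weight hB pw lw (BF k).
by rewrite inver gt_eqF// mule_gt0// lte_fin invr_gt0.
Qed.

Variables (S : set (E -> \bar R)) (th : R).
Hypotheses (th0 : (0 < th)%R)
  (S_meas : forall b, S b -> measurable_fun setT b /\ forall x, 0 <= b x)
  (S_max : forall b, S b -> S (fun x => th%:E * M b x))
  (S_series : forall b : nat -> E -> \bar R, (forall k, S (b k)) ->
     S (fun x => \sum_(k <oo) (dyadic k)%:E * b k x))
  (S_finite : forall b, S b -> {ae mu, forall x, b x < +oo}).

(** The function is G = sum_k 2^-(k+1) (th M)^k f. As M is sublinear, th M G is at
    most twice the series shifted by one term, so M G <= (2 / th) G. The set S is
    meant to be the unit ball of a space on which th M is a contraction: it contains
    the iterates of f and then G by convexity. As f does not vanish almost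
    everywhere, the second term of the series makes G positive. *)
Lemma rubio_de_francia f : S f -> ~ {ae mu, forall x, f x = 0} ->
  exists (G : E -> \bar R) (z : E -> R),
  [/\ S G, {ae mu, forall x, G x = (z x)%:E}, A1_over w z (2 / th) &
      forall x, f x <= 2%:E * G x].
Proof.
move=> Sf fN0.
pose b k := iter k (fun g x => th%:E * M g x) f.
have Sb k : S (b k) by elim: k => //= k IH; exact: S_max.
have b0 k x : 0 <= b k x by apply: (S_meas (Sb k)).2.
have mb k : measurable_fun setT (b k) by apply: (S_meas (Sb k)).1.
pose G x := \sum_(k <oo) (dyadic k)%:E * b k x.
have SG : S G by exact: S_series.
have t0 x k : 0 <= (dyadic k)%:E * b k x by rewrite mule_ge0// lee_fin ltW// dyadic_gt0.
have [mG G0] := S_meas SG.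
have Gpos x : 0 < G x.
  apply: lt_le_trans (series_term_le 1 (t0 x)).
  rewrite mule_gt0 ?lte_fin ?dyadic_gt0//= mule_gt0 ?lte_fin//.
  apply: basis_maximal_gt0 => //; exact: (S_meas Sf).1.
have [z pz Gz] : exists2 z : E -> R, pos_weight z & {ae mu, forall x, G x = (z x)%:E}.
  by apply: real_version => //; apply: filterS (S_finite SG) => x ->; rewrite Gpos.
exists G, z; split => //; last first.
  move=> x; apply: (@le_trans _ _ (2%:E * ((dyadic 0)%:E * b 0%N x))).
    rewrite muleA -EFinM /dyadic expr1 divff// mul1e; exact: lexx.
  by rewrite lee_pmul2l ?lte_fin//; exact: (series_term_le 0 (t0 x)).
split => // Q BQ; have mQ := basis_measurable hB BQ.
have [s s0 sE] := basis_weight hB pw lw BQ.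
have mGw : measurable_fun setT (fun y => G y * (w y)%:E) by exact: measurable_mul.
have -> : \int[mu]_(y in Q) (z y * w y)%:E = \int[mu]_(y in Q) (G y * (w y)%:E).
  apply: ae_eq_integral => //.
  - by apply: measurable_funTS; apply: measurable_efin; exact: measurable_rmul pz.1 pw.1.
  - exact: measurable_funTS.
  - by apply: filterS Gz => x -> _; rewrite EFinM.
apply: filterS Gz => x Gx Qx; rewrite sE -[X in _ <= X]muleC EFinM -Gx.
pose t k y := (dyadic k)%:E * (`|b k y| * (w y)%:E).
have mt k : measurable_fun setT (t k).
  by apply: measurable_scale; apply: measurable_mul mw; exact: measurable_abs.
have tt0 k y : 0 <= t k y.
  by rewrite mule_ge0 ?lee_fin ?(ltW (dyadic_gt0 _))// mule_ge0.
apply: (@le_trans _ _ (\int[mu]_(y in Q) \sum_(k <oo) t k y)).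
  apply: nn_le_integral => //.
  - by apply: ge0_emeasurable_sum => // k y _ _.
  - by move=> y; rewrite mule_ge0.
  move=> y _; rewrite muleC -nneseriesZl//; apply: lee_nneseries => k.
    by move=> _ _; rewrite mule_ge0.
  by move=> _; rewrite /t gee0_abs// muleC muleA.
rewrite integral_nneseries//; last by move=> k; exact: measurable_funTS.
have step k : \int[mu]_(y in Q) t k y <= s%:E * ((2 / th)%:E * ((dyadic k.+1)%:E * b k.+1 x)).
  rewrite ge0_integralZl ?lee_fin ?(ltW (dyadic_gt0 _))//; last 2 first.
  - by apply: measurable_funTS; apply: measurable_mul mw; exact: measurable_abs.
  - by move=> y _; rewrite mule_ge0.
  have := basis_maximal_ge mu (EFin \o w) (b k) BQ Qx.
  rewrite sE inver gt_eqF// lee_pdivrMl// => h.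
  apply: (@le_trans _ _ ((dyadic k)%:E * (s%:E * M (b k) x))).
    by rewrite lee_pmul2l ?lte_fin ?dyadic_gt0.
  rewrite /= le_eqVlt; apply/orP; left; apply/eqP.
  rewrite !muleA -!EFinM; congr (_%:E * _).
  by rewrite (dyadicS k); field; rewrite gt_eqF.
apply: (@le_trans _ _ (\sum_(k <oo) s%:E * ((2 / th)%:E * ((dyadic k.+1)%:E * b k.+1 x)))).
  by apply: lee_nneseries => // k _ _; exact: integral_ge0.
have th2 : (0 < 2 / th)%R by rewrite divr_gt0.
rewrite nneseriesZl; last by move=> k _; rewrite mule_ge0// lee_fin ltW.
rewrite lee_pmul2l ?lte_fin// nneseriesZl//.
by rewrite lee_pmul2l ?lte_fin//; apply: (series_shift_le (t0 x)).
Qed.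

End rubio_de_francia.

(** * Muckenhoupt weights *)

Section positive_powers.
Context {R : realType}.
Implicit Types (x y s t : R).

(** With all positive numbers written as exponentials, identities between real powers
    become linear identities between exponents. *)
Lemma pos_expR x : (0 < x)%R -> exists u : R, x = expR u.
Proof. by move=> x0; exists (ln x); rewrite lnK. Qed.

Lemma expR_powR (u a : R) : ((expR u) `^ a = expR (a * u))%R.
Proof. by rewrite /powR gt_eqF ?expR_gt0// expRK. Qed.

(** The left-hand side is a weighted geometric mean, so it lies between x and y. This
    crude form of the weighted inequality of means costs a factor 2 in
    [integral_product_le]. *)
Lemma weighted_product_le x y (a b : R) : (0 < x)%R -> (0 < y)%R -> (0 < a)%R ->
  (0 < b)%R -> (a + b = 1)%R -> (x `^ a * y `^ b <= x + y)%R.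
Proof.
move=> x0 y0 a0 b0 ab; have [u ->] := pos_expR x0; have [v ->] := pos_expR y0.
rewrite !expR_powR -expRD; have [uv|vu] := leP u v.
  apply: (@le_trans _ _ (expR v)); last by rewrite lerDr expR_ge0.
  by rewrite ler_expR -[leRHS]mul1r -ab mulrDl lerD2r ler_pM2l.
apply: (@le_trans _ _ (expR u)); last by rewrite lerDl expR_ge0.
by rewrite ler_expR -[leRHS]mul1r -ab mulrDl lerD2l ler_pM2l// ltW.
Qed.

Lemma powR_anti x y (a : R) : (0 < x)%R -> (x <= y)%R -> (0 < a)%R ->
  (y `^ (- a) <= x `^ (- a))%R.
Proof.
move=> x0 xy a0; have y0 := lt_le_trans x0 xy.
move: xy; have [u ->] := pos_expR x0; have [v ->] := pos_expR y0.
by rewrite ler_expR => uv; rewrite !expR_powR ler_expR !mulNr lerN2 ler_pM2l.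
Qed.

Lemma powR_mono x y (a : R) : (0 <= x)%R -> (x <= y)%R -> (0 <= a)%R ->
  (x `^ a <= y `^ a)%R.
Proof.
by move=> x0 xy a0; apply: ge0_ler_powR; rewrite ?nnegrE// (le_trans x0).
Qed.

End positive_powers.

Section Ap_algebra.
Context d (E : measurableType d) (R : realType) (mu : {measure set E -> \bar R}).
Variables (B : set (set E)) (dil : set E -> set E) (c : R).
Hypothesis hB : cube_basis mu B dil c.
Implicit Types (w z : E -> R) (r K k : R).

(** The A_r condition with constant K; the exponent -(r - 1)^-1 is 1 - r'. The
    averages are exhibited as positive real numbers, so that the computations with
    powers below meet neither 0 nor infinity. *)
Definition Ap_over r K w := forall Q, B Q -> exists m s t : R,
  [/\ (0 < m)%R, (0 < s)%R, (0 < t)%R, mu Q = m%:E &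
  [/\ \int[mu]_(x in Q) (w x)%:E = s%:E,
      \int[mu]_(x in Q) (w x `^ (- (r - 1)^-1))%:E = t%:E &
      ((s / m) * (t / m) `^ (r - 1) <= K)%R]].

Lemma ae_witness Q (P : E -> Prop) : measurable Q -> 0 < mu Q ->
  {ae mu, forall x, Q x -> P x} -> exists x, Q x /\ P x.
Proof.
move=> mQ Q0 [N [mN N0 sub]]; apply: contrapT => /forallNP h.
suff: mu Q <= mu N by rewrite N0 leNgt Q0.
apply: le_measure; rewrite ?inE// => x Qx; apply: sub => /= H; by apply: (h x); split => //; exact: H.
Qed.

Lemma pos_weight_powR w (a : R) : pos_weight w -> pos_weight (fun x => w x `^ a)%R.
Proof.
move=> [mw w0]; split; first exact: measurable_rpow.
by move=> x; exact: powR_gt0.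
Qed.

Lemma pos_weight_mul w z : pos_weight w -> pos_weight z -> pos_weight (fun x => w x * z x)%R.
Proof.
move=> [mw w0] [mz z0]; split; first exact: measurable_rmul.
by move=> x; exact: mulr_gt0.
Qed.

Lemma integral_pos_weight w Q : pos_weight w -> B Q -> 0 < \int[mu]_(x in Q) (w x)%:E.
Proof.
move=> pw BQ; apply: integral_gt0.
- exact: (basis_measurable hB).
- exact: pos_weightE.
- by move=> x; rewrite lte_fin pw.2.
- by have [m m0 ->] := basis_measure hB BQ; rewrite lte_fin.
Qed.

Lemma integral_le_fin w Q (b : R) : pos_weight w -> B Q ->
  \int[mu]_(x in Q) (w x)%:E <= b%:E ->
  exists s : R, [/\ (0 < s)%R, \int[mu]_(x in Q) (w x)%:E = s%:E & (s <= b)%R].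
Proof.
move=> pw BQ; have := integral_pos_weight pw BQ.
by case: integral => // s; rewrite lte_fin lee_fin => s0 sb; exists s.
Qed.

Lemma integral_scale_real w Q (b s : R) : measurable Q -> pos_weight w -> (0 <= b)%R ->
  \int[mu]_(x in Q) (w x)%:E = s%:E ->
  \int[mu]_(x in Q) (b * w x)%:E = (b * s)%:E.
Proof.
move=> mQ pw b0 ws; rewrite EFinM -ws -ge0_integralZl//.
- by apply: measurable_funTS; exact: pos_weightE.
- by move=> x _; rewrite lee_fin ltW// pw.2.
Qed.

(** Hoelder's inequality with exponents 1 / a and 1 / b, up to a factor 2: the
    pointwise inequality [weighted_product_le] for w / s and z / t is integrated. *)
Lemma integral_product_le w z Q (a b s t : R) : pos_weight w -> pos_weight z -> B Q ->
  (0 < a)%R -> (0 < b)%R -> (a + b = 1)%R -> (0 < s)%R -> (0 < t)%R ->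
  \int[mu]_(x in Q) (w x)%:E = s%:E -> \int[mu]_(x in Q) (z x)%:E = t%:E ->
  \int[mu]_(x in Q) (w x `^ a * z x `^ b)%:E <= (2 * (s `^ a * t `^ b))%:E.
Proof.
move=> pw pz BQ a0 b0 ab s0 t0 ws zt; have mQ := basis_measurable hB BQ.
pose C := (s `^ a * t `^ b)%R.
have C0 : (0 < C)%R by rewrite mulr_gt0 ?powR_gt0.
have pointwise x : (w x `^ a * z x `^ b <= (C / s) * w x + (C / t) * z x)%R.
  have [[_ /(_ x) w0] [_ /(_ x) z0]] := (pw, pz).
  have := weighted_product_le (divr_gt0 w0 s0) (divr_gt0 z0 t0) a0 b0 ab.
  rewrite -(ler_pM2l C0) => /le_trans; move/(_ (C / s * w x + C / t * z x)%R).
  have -> : (C * ((w x / s) `^ a * (z x / t) `^ b) = w x `^ a * z x `^ b)%R.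
    rewrite /C; have [wu ->] := pos_expR w0; have [zu ->] := pos_expR z0.
    have [su ->] := pos_expR s0; have [tu ->] := pos_expR t0.
    rewrite -!expRN -!expRD !expR_powR -!expRD; congr expR; ring.
  apply; rewrite le_eqVlt; apply/orP; left; apply/eqP.
  by field; rewrite !gt_eqF.
have Cs : (0 < C / s)%R by rewrite divr_gt0.
have Ct : (0 < C / t)%R by rewrite divr_gt0.
have -> : (2 * (s `^ a * t `^ b))%:E =
    \int[mu]_(x in Q) ((C / s * w x)%:E + (C / t * z x)%:E).
  rewrite ge0_integralD//.
  - rewrite (integral_scale_real mQ pw (ltW Cs) ws) (integral_scale_real mQ pz (ltW Ct) zt).
    rewrite -EFinD !divfK ?gt_eqF// /C; congr EFin; ring.
  - by move=> x _; rewrite lee_fin mulr_ge0// ltW// pw.2.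
  - apply: measurable_funTS; apply: measurable_efin; apply: measurable_rmul pw.1.
    exact: measurable_cst.
  - by move=> x _; rewrite lee_fin mulr_ge0// ltW// pz.2.
  - apply: measurable_funTS; apply: measurable_efin; apply: measurable_rmul pz.1.
    exact: measurable_cst.
apply: nn_le_integral => //.
- by apply: measurable_efin; apply: measurable_rmul; apply: measurable_rpow; [exact: pw.1|exact: pz.1].
- apply: measurable_add; apply: measurable_efin; apply: measurable_rmul;
    by [exact: measurable_cst|exact: pw.1|exact: pz.1].
- by move=> x; rewrite lee_fin mulr_ge0// powR_ge0.
by move=> x _; rewrite -EFinD lee_fin.
Qed.

End Ap_algebra.

Section Ap_lemmas.
Context d (E : measurableType d) (R : realType) (mu : {measure set E -> \bar R}).
Variables (B : set (set E)) (dil : set E -> set E) (c : R).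
Hypothesis hB : cube_basis mu B dil c.
Implicit Types (w z : E -> R) (r K k : R).

Lemma Ap_over_locally_finite r K w : Ap_over mu B r K w -> locally_finite mu B w.
Proof. by move=> A Q /A[m [s [t [_ _ _ _ [-> _ _]]]]]; rewrite ltry. Qed.

(** The A_1 condition bounds z from below on Q by its weighted average divided by k;
    the right-hand side of the condition is finite at some point of Q, so that this
    average is a real number. *)
Lemma A1_over_average w z k Q (s : R) : pos_weight w -> A1_over mu B w z k ->
  (0 < k)%R -> B Q -> (0 < s)%R -> \int[mu]_(x in Q) (w x)%:E = s%:E ->
  exists rho : R, [/\ (0 < rho)%R, \int[mu]_(x in Q) (z x * w x)%:E = rho%:E &
    {ae mu, forall x, Q x -> (rho / (k * s) <= z x)%R}].
Proof.
move=> pw [pz A1] k0 BQ s0 ws.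
have [m m0 mE] := basis_measure hB BQ.
have Q0 : 0 < mu Q by rewrite mE lte_fin.
have aeQ := A1 _ BQ; rewrite ws in aeQ.
have [x [Qx xP]] := ae_witness (basis_measurable hB BQ) Q0 aeQ.
have [rho [rho0 rhoE _]] := integral_le_fin hB (pos_weight_mul pz pw) BQ xP.
exists rho; split => //; apply: filterS aeQ => y yP /yP.
rewrite rhoE -EFinM lee_fin => h; rewrite ler_pdivrMr ?mulr_gt0//.
by rewrite mulrA [(z y * k)%R]mulrC.
Qed.

(** On Q, the lower bound rho / (k s) for z is an upper bound for its negative power
    in the dual average, and the average of z w is rho / m: rho cancels in the product
    of the two, and K is multiplied by k. *)
Lemma Ap_over_A1_mul r K k w z : (1 < r)%R -> (0 < k)%R -> pos_weight w ->
  Ap_over mu B r K w -> A1_over mu B w z k -> Ap_over mu B r (k * K) (fun x => z x * w x)%R.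
Proof.
move=> r1 k0 pw A A1 Q BQ; have [m [s [t [m0 s0 t0 mE [ws wt hK]]]]] := A _ BQ.
have [rho [rho0 rhoE rhoP]] := A1_over_average pw A1 k0 BQ s0 ws.
have pz := A1.1; have mQ := basis_measurable hB BQ.
have r10 : (0 < r - 1)%R by rewrite subr_gt0.
pose si := ((r - 1)^-1)%R; have si0 : (0 < si)%R by rewrite invr_gt0.
pose C := ((rho / (k * s)) `^ (- si))%R.
have q0 : (0 < rho / (k * s))%R by rewrite divr_gt0// mulr_gt0.
have C0 : (0 < C)%R by rewrite powR_gt0.
have pws := pos_weight_powR (- si) pw.
have pzs := pos_weight_powR (- si) (pos_weight_mul pz pw).
have [t' [t'0 t'E t'le]] : exists t' : R, [/\ (0 < t')%R,
    \int[mu]_(x in Q) ((z x * w x) `^ (- si))%:E = t'%:E & (t' <= C * t)%R].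
  apply: (integral_le_fin hB pzs BQ).
  rewrite -(integral_scale_real mQ pws (ltW C0) wt).
  apply: nn_le_integral_ae => //.
  - exact: pos_weightE.
  - by apply: measurable_efin; apply: measurable_rmul; [exact: measurable_cst|exact: pws.1].
  - by move=> x; rewrite lee_fin powR_ge0.
  - by move=> x; rewrite lee_fin mulr_ge0 ?powR_ge0// ltW.
  apply: filterS rhoP => x xP Qx; rewrite lee_fin powRM ?(ltW (pz.2 x)) ?(ltW (pw.2 x))//.
  by rewrite ler_pM2r ?powR_gt0 ?pw.2//; apply: powR_anti => //; exact: xP.
exists m, rho, t'; split => //; split => //.
apply: (@le_trans _ _ (rho / m * (C * t / m) `^ (r - 1))%R).
  rewrite ler_pM2l ?divr_gt0//; apply: powR_mono; last exact: ltW.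
    by rewrite divr_ge0// ltW.
  by rewrite ler_pM2r ?invr_gt0.
have -> : (rho / m * (C * t / m) `^ (r - 1) = k * (s / m * (t / m) `^ (r - 1)))%R.
  rewrite /C /si.
  have [mm ->] := pos_expR m0; have [ss ->] := pos_expR s0; have [tt ->] := pos_expR t0.
  have [kk ->] := pos_expR k0; have [rr ->] := pos_expR rho0.
  do 4 rewrite ?expR_powR -?(expRN, expRD).
  by congr expR; field; rewrite gt_eqF.
by rewrite ler_pM2l.
Qed.

(** On Q, z^(-N) is at most (rho / (k s))^(-N) in the average of w z^(-N). In the dual
    average, (w z^(-N))^(-tau) = (z w)^a (w^(-1/(r-1)))^b is estimated by Hoelder's
    inequality; the exponent (N + 1) r is the one for which a + b = 1. Again rho
    cancels. *)
Lemma Ap_over_A1_pow r K k w z (N : R) : (1 < r)%R -> (0 < k)%R -> (0 < N)%R -> pos_weight w ->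
  Ap_over mu B r K w -> A1_over mu B w z k ->
  Ap_over mu B ((N + 1) * r) (2 `^ ((N + 1) * r - 1) * k `^ N * K `^ (N + 1))
    (fun x => w x * z x `^ (- N))%R.
Proof.
move=> r1 k0 N0 pw A A1 Q BQ; have [m [s [t [m0 s0 t0 mE [ws wt hK]]]]] := A _ BQ.
have [rho [rho0 rhoE rhoP]] := A1_over_average pw A1 k0 BQ s0 ws.
have pz := A1.1; have mQ := basis_measurable hB BQ.
have r10 : (0 < r - 1)%R by rewrite subr_gt0.
set R' := ((N + 1) * r)%R.
have R'0 : (0 < R' - 1)%R.
  by rewrite /R' mulrDl mul1r -addrA addr_gt0// mulr_gt0// (lt_trans ltr01).
pose tau := ((R' - 1)^-1)%R; have tau0 : (0 < tau)%R by rewrite invr_gt0.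
pose a := (N * tau)%R; pose b := ((N + 1) * (r - 1) * tau)%R.
have a0 : (0 < a)%R by rewrite mulr_gt0.
have b0 : (0 < b)%R by rewrite !mulr_gt0// addr_gt0.
have ab : (a + b = 1)%R.
  by rewrite /a /b /tau /R'; field; rewrite gt_eqF.
have q0 : (0 < rho / (k * s))%R by rewrite divr_gt0// mulr_gt0.
pose C := ((rho / (k * s)) `^ (- N))%R.
have C0 : (0 < C)%R by rewrite powR_gt0.
have pzN := pos_weight_powR (- N) pz.
have pwz := pos_weight_mul pw pzN.
have pws := pos_weight_powR (- (r - 1)^-1) pw.
have pwt := pos_weight_powR (- tau) pwz.
have pzw := pos_weight_mul pz pw.
have [s' [s'0 s'E s'le]] : exists s' : R, [/\ (0 < s')%R,
    \int[mu]_(x in Q) (w x * z x `^ (- N))%:E = s'%:E & (s' <= C * s)%R].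
  apply: (integral_le_fin hB pwz BQ).
  rewrite -(integral_scale_real mQ pw (ltW C0) ws).
  apply: nn_le_integral_ae => //.
  - exact: pos_weightE.
  - by apply: measurable_efin; apply: measurable_rmul; [exact: measurable_cst|exact: pw.1].
  - by move=> x; rewrite lee_fin ltW// pwz.2.
  - by move=> x; rewrite lee_fin mulr_ge0 ?(ltW C0)// ltW// pw.2.
  apply: filterS rhoP => x xP Qx; rewrite lee_fin mulrC.
  by rewrite ler_pM2r ?pw.2//; apply: powR_anti => //; exact: xP.
have [t' [t'0 t'E t'le]] : exists t' : R, [/\ (0 < t')%R,
    \int[mu]_(x in Q) ((w x * z x `^ (- N)) `^ (- tau))%:E = t'%:E &
    (t' <= 2 * (rho `^ a * t `^ b))%R].
  apply: (integral_le_fin hB pwt BQ).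
  apply: le_trans (integral_product_le hB pzw pws BQ a0 b0 ab rho0 t0 rhoE wt).
  rewrite le_eqVlt; apply/orP; left; apply/eqP; apply: eq_integral => x _; congr EFin.
  have [zz ->] := pos_expR (pz.2 x); have [ww ->] := pos_expR (pw.2 x).
  do 4 rewrite ?expR_powR -?(expRN, expRD).
  by congr expR; rewrite /a /b /tau /R'; field; rewrite !gt_eqF.
have tE : (- (R' - 1)^-1 = - tau)%R by [].
exists m, s', t'; split => //; split => //.
apply: (@le_trans _ _ (C * s / m * ((2 * (rho `^ a * t `^ b)) / m) `^ (R' - 1))%R).
  apply: ler_pM; rewrite ?powR_ge0 ?divr_ge0 ?(ltW s'0) ?(ltW m0)//.
    by rewrite ler_pM2r ?invr_gt0.
  apply: powR_mono; [by rewrite divr_ge0// ltW| |exact: ltW].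
  by rewrite ler_pM2r ?invr_gt0.
have -> : (C * s / m * ((2 * (rho `^ a * t `^ b)) / m) `^ (R' - 1) =
   2 `^ (R' - 1) * k `^ N * (s / m * (t / m) `^ (r - 1)) `^ (N + 1))%R.
  have two0 : (0 < 2 :> R)%R by [].
  have [u2 ->] := pos_expR two0.
  rewrite /C.
  have [mm ->] := pos_expR m0; have [ss ->] := pos_expR s0; have [tt ->] := pos_expR t0.
  have [kk ->] := pos_expR k0; have [rr ->] := pos_expR rho0.
  do 4 rewrite ?expR_powR -?(expRN, expRD).
  by congr expR; rewrite /a /b /tau /R'; field; rewrite gt_eqF.
rewrite ler_pM2l ?mulr_gt0 ?powR_gt0//; apply: powR_mono => //.
  by rewrite mulr_ge0 ?powR_ge0// divr_ge0// ltW.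
by rewrite addr_ge0// ltW.
Qed.

(** Hoelder's inequality for 1 = w^(1/r) w^(-1/r) on Q bounds mu(Q)^r by w(Q) times a
    power of the integral of w^(-1/(r-1)) on dil Q. The A_r condition on dil Q bounds
    the product of w(dil Q) with the same power by K mu(dil Q)^r <= K c^r mu(Q)^r. *)
Lemma Ap_over_doubling r K w : (1 < r)%R -> (0 < c)%R -> pos_weight w -> Ap_over mu B r K w ->
  doubling mu B dil (2 `^ r * K * c `^ r) w.
Proof.
move=> r1 c0 pw A Q BQ; have [m [s [t [m0 s0 t0 mE [ws wt hK]]]]] := A _ BQ.
have [BD QD mD] := basis_dil hB BQ.
have [m' [s' [t' [m'0 s'0 t'0 m'E [ws' wt' hK']]]]] := A _ BD.
have mQ := basis_measurable hB BQ; have mQ' := basis_measurable hB BD.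
have r0 : (0 < r)%R := lt_trans ltr01 r1.
have r10 : (0 < r - 1)%R by rewrite subr_gt0.
have pws := pos_weight_powR (- (r - 1)^-1) pw.
pose a := (r^-1)%R; pose b := ((r - 1) / r)%R.
have a0 : (0 < a)%R by rewrite invr_gt0.
have b0 : (0 < b)%R by rewrite divr_gt0.
have ab : (a + b = 1)%R by rewrite /a /b; field; rewrite gt_eqF.
have tt' : (t <= t')%R.
  rewrite -lee_fin -wt -wt'; apply: nn_le_integral_set => //.
  - exact: pos_weightE.
  - by move=> x; rewrite lee_fin powR_ge0.
have mm' : (m' <= c * m)%R by rewrite -lee_fin -m'E EFinM -mE.
have m_le : (m <= 2 * (s `^ a * t `^ b))%R.
  rewrite -lee_fin -mE.
  apply: le_trans (integral_product_le hB pw pws BQ a0 b0 ab s0 t0 ws wt).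
  rewrite -[leLHS]mul1e -integral_cst// le_eqVlt; apply/orP; left; apply/eqP.
  apply: eq_integral => x _; rewrite /cst; congr EFin.
  have [ww ->] := pos_expR (pw.2 x); rewrite !expR_powR -expRD -[LHS]expR0; congr expR.
  by rewrite /a /b; field; rewrite !gt_eqF.
have K0 : (0 < K)%R.
  by apply: lt_le_trans hK; rewrite mulr_gt0 ?powR_gt0 ?divr_gt0.
have h1 : (m `^ r <= 2 `^ r * s * t' `^ (r - 1))%R.
  apply: (@le_trans _ _ ((2 * (s `^ a * t' `^ b)) `^ r)%R).
    apply: powR_mono; rewrite ?(ltW m0) ?(ltW r0)//; apply: (le_trans m_le).
    rewrite ler_pM2l// ler_pM2l ?powR_gt0//; apply: powR_mono; rewrite ?(ltW t0)//.
    exact: ltW.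
  have two0 : (0 < 2 :> R)%R by [].
  have [u2 ->] := pos_expR two0.
  have [ss ->] := pos_expR s0; have [tt ->] := pos_expR t'0.
  rewrite !expR_powR -!expRD !expR_powR ler_expR le_eqVlt; apply/orP; left; apply/eqP.
  by rewrite /a /b; field; rewrite gt_eqF.
have h2 : (s' * t' `^ (r - 1) <= K * m' `^ r)%R.
  have -> : (s' * t' `^ (r - 1) = (s' / m' * (t' / m') `^ (r - 1)) * m' `^ r)%R.
    have [ss ->] := pos_expR s'0; have [tt ->] := pos_expR t'0; have [mm ->] := pos_expR m'0.
    rewrite -!(expRN, expRD) !expR_powR -!(expRN, expRD); congr expR; ring.
  by rewrite ler_pM2r ?powR_gt0.
rewrite ws ws' -EFinM lee_fin.
have h3 : (m' `^ r <= c `^ r * m `^ r)%R.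
  rewrite -powRM ?(ltW c0) ?(ltW m0)//; apply: powR_mono; rewrite ?(ltW m'0) ?(ltW r0)//.
rewrite -(ler_pM2r (powR_gt0 (r - 1) t'0)); apply: (le_trans h2).
apply: (@le_trans _ _ (K * (c `^ r * (2 `^ r * s * t' `^ (r - 1))))%R).
  rewrite ler_pM2l//; apply: (le_trans h3); rewrite ler_pM2l ?powR_gt0//.
by rewrite le_eqVlt; apply/orP; left; apply/eqP; ring.
Qed.

End Ap_lemmas.

(** * Majorants in L^2 satisfying the A_1 condition *)

Section dyadic_jensen.
Context {R : realType}.

(** Convexity of the square, as the weights 2^-(k+1) have sum 1. It makes the unit
    ball of L^2(w) stable under the series of the algorithm. *)
Lemma dyadic_jensen (b : nat -> \bar R) : (forall k, 0 <= b k) ->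
  (\sum_(k <oo) (dyadic k)%:E * b k) ^+ 2 <= \sum_(k <oo) (dyadic k)%:E * b k ^+ 2.
Proof.
move=> b0.
have t0 k : 0 <= (dyadic k : R)%:E * b k ^+ 2.
  by rewrite mule_ge0 ?expe_ge0// lee_fin ltW// dyadic_gt0.
have t1 k : 0 <= (dyadic k : R)%:E * b k.
  by rewrite mule_ge0// lee_fin ltW// dyadic_gt0.
have [[k bk]|bfin] := pselect (exists k, b k = +oo).
  rewrite [leRHS](_ : _ = +oo) ?leey//; apply/eqP; rewrite -leye_eq.
  apply: le_trans (series_term_le k t0).
  by rewrite bk expe2 mulyy gt0_muley// lte_fin dyadic_gt0.
have {}bfin k : b k = (fine (b k))%:E.
  rewrite fineK// ge0_fin_numE// ltey; apply/eqP => h; apply: bfin; by exists k.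
set S := leRHS; have S0 : 0 <= S by exact: nneseries_ge0.
have partial N : (\sum_(0 <= k < N) (dyadic k)%:E * b k) ^+ 2 <= S.
  apply: le_trans (nneseries_lim_ge N _) => //.
  pose y k := fine (b k).
  pose m := (\sum_(0 <= k < N) dyadic k * y k)%R.
  have -> : \sum_(0 <= k < N) (dyadic k)%:E * b k = m%:E.
    by rewrite /m -sumEFin; apply: eq_bigr => k _; rewrite bfin EFinM.
  have -> : \sum_(0 <= k < N) (dyadic k)%:E * b k ^+ 2 =
      (\sum_(0 <= k < N) dyadic k * y k ^+ 2)%:E.
    by rewrite -sumEFin; apply: eq_bigr => k _; rewrite bfin -EFin_expe -EFinM.
  rewrite -EFin_expe lee_fin.
  have d1 : (\sum_(0 <= k < N) dyadic k <= 1 :> R)%R.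
    rewrite -lee_fin -sumEFin; apply: le_trans sum_dyadic.
    by apply: nneseries_lim_ge => k _ _; rewrite lee_fin ltW// dyadic_gt0.
  (* The tangent at the mean m lies below the square: y^2 >= 2 m y - m^2. *)
  apply: (@le_trans _ _ (\sum_(0 <= k < N) (2 * m * (dyadic k * y k) - m ^+ 2 * dyadic k))%R).
    rewrite sumrB -!mulr_sumr -/m.
    have : (m ^+ 2 * \sum_(0 <= k < N) dyadic k <= m ^+ 2)%R.
      by rewrite ler_piMr// sqr_ge0.
    set u := (m ^+ 2 * _)%R; lra.
  apply: ler_sum => k _; have dk := dyadic_gt0 (R := R) k.
  rewrite -subr_ge0 [leRHS](_ : _ = dyadic k * (y k - m) ^+ 2)%R; last by ring.
  by rewrite mulr_ge0 ?sqr_ge0// ltW.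
have [Sfin|] := boolP (S \is a fin_num); last first.
  by rewrite ge0_fin_numE// -leNgt leye_eq => /eqP ->; rewrite leey.
have sqS : (Num.sqrt (fine S))%:E ^+ 2 = S.
  by rewrite -EFin_expe sqr_sqrtr ?fineK// fine_ge0.
rewrite -sqS; set sS := (Num.sqrt _).
have sS0 : (0 <= sS)%R by exact: sqrtr_ge0.
suff le : \sum_(k <oo) (dyadic k)%:E * b k <= sS%:E.
  by rewrite !expe2; apply: lee_pmul => //; exact: nneseries_ge0.
apply: lime_le; first exact: is_cvg_nneseries.
apply: nearW => N; have := partial N; rewrite -sqS.
have : 0 <= \sum_(0 <= k < N) (dyadic k)%:E * b k by rewrite sume_ge0.
case: (\sum_(0 <= k < N) (dyadic k)%:E * b k) => [a| |//].
  by rewrite -!EFin_expe !lee_fin => a0; rewrite ler_sqr.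
by move=> _; rewrite expe2 mulyy -EFin_expe leye_eq.
Qed.

End dyadic_jensen.

Section majorant.
Context d (E : measurableType d) (R : realType) (mu : {measure set E -> \bar R}).
Variables (B : set (set E)) (dil : set E -> set E) (c : R).
Hypothesis hB : cube_basis mu B dil c.
Hypothesis c0 : (0 < c)%R.

Lemma ae_lty_integral (f : E -> \bar R) : measurable_fun setT f -> (forall x, 0 <= f x) ->
  \int[mu]_x f x < +oo -> {ae mu, forall x, f x < +oo}.
Proof.
move=> mf f0 fi.
have : mu.-integrable setT f.
  by apply/integrableP; split => //; under eq_integral do rewrite gee0_abs//.
move=> /(integrable_ae measurableT); apply: filterS => x /(_ I).
by rewrite ge0_fin_numE.
Qed.

(** This is 2 / th for th = (32 D + 1)^-1, where D is the doubling constant of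
    [Ap_over_doubling] and 32 D is the bound of [maximal_strong_type]. *)
Definition majorant_const (r K : R) : R := (2 * (32 * (2 `^ r * K * c `^ r) + 1))%R.

(** The algorithm in a ball of L^2(w): as th^2 (32 D) <= 1 for th = (32 D + 1)^-1, the
    operator th M_w maps the ball to itself. *)
Lemma L2_majorant (r K A : R) (w : E -> R) (f : E -> \bar R) : (1 < r)%R -> (0 < K)%R ->
  pos_weight w -> Ap_over mu B r K w ->
  measurable_fun setT f -> (forall x, 0 <= f x) -> ~ {ae mu, forall x, f x = 0} ->
  \int[mu]_x (f x ^+ 2 * (w x)%:E) <= A%:E ->
  exists z : E -> R, [/\ A1_over mu B w z (majorant_const r K),
    {ae mu, forall x, f x <= (2 * z x)%:E} &
    \int[mu]_x (z x ^+ 2 * w x)%:E <= A%:E].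
Proof.
move=> r1 K0 pw Ap mf f0 fN0 fA.
have mw := pos_weightE pw.
have w0 x : 0 <= (w x)%:E by rewrite lee_fin ltW// pw.2.
have lw := Ap_over_locally_finite Ap.
pose D := (2 `^ r * K * c `^ r)%R.
have D0 : (0 < D)%R by rewrite !mulr_gt0// powR_gt0.
have dw : doubling mu B dil D w := Ap_over_doubling hB r1 c0 pw Ap.
pose th := ((32 * D + 1)^-1)%R.
have D1 : (0 < 32 * D + 1)%R by rewrite addr_gt0// mulr_gt0.
have th0 : (0 < th)%R by rewrite invr_gt0.
pose S := [set b : E -> \bar R | [/\ measurable_fun setT b, forall x, 0 <= b x &
  \int[mu]_x (b x ^+ 2 * (w x)%:E) <= A%:E]].
have m2 b : measurable_fun setT b -> measurable_fun setT (fun x => b x ^+ 2 * (w x)%:E).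
  by move=> mb; apply: measurable_mul mw; exact: measurable_expe.
have p2 b x : 0 <= b x -> 0 <= b x ^+ 2 * (w x)%:E by move=> bx; rewrite mule_ge0 ?expe_ge0.
have Smax b : S b -> S (fun x => th%:E * basis_maximal mu B (EFin \o w) b x).
  move=> [mb b0 bA]; split.
  - by apply: measurable_scale; exact: measurable_basis_maximal hB _ _.
  - by move=> x; rewrite mule_ge0 ?lee_fin ?(ltW th0)//; exact: (basis_maximal_ge0 hB).
  have -> : \int[mu]_x ((th%:E * basis_maximal mu B (EFin \o w) b x) ^+ 2 * (w x)%:E) =
      (th ^+ 2)%:E * \int[mu]_x (basis_maximal mu B (EFin \o w) b x ^+ 2 * (w x)%:E).
    rewrite -ge0_integralZl//.
    - by apply: eq_integral => x _; rewrite EFin_expe !expe2 -!muleA; congr (_ * _); rewrite muleCA.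
    - by apply: m2; exact: measurable_basis_maximal hB _ _.
    - by move=> x _; apply: p2; exact: (basis_maximal_ge0 hB).
    - by rewrite lee_fin sqr_ge0.
  apply: (@le_trans _ _ ((th ^+ 2)%:E * ((32 * D)%:E * \int[mu]_x (b x ^+ 2 * (w x)%:E)))).
    rewrite lee_pmul2l ?lte_fin ?exprn_gt0//; exact: (maximal_strong_type hB).
  apply: le_trans bA; rewrite muleA -EFinM -[leRHS]mul1e; apply: lee_wpmul2r.
    by apply: integral_ge0 => x _; exact: p2.
  rewrite lee_fin /th exprVn ler_pdivrMl ?exprn_gt0// mulr1.
  rewrite expr2 (le_trans (_ : _ <= 32 * D + 1)%R)//; first by rewrite lerDl.
  by rewrite ler_peMl ?(ltW D1)// lerDr mulr_ge0// ltW.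
have Sser (b : nat -> E -> \bar R) : (forall k, S (b k)) ->
    S (fun x => \sum_(k <oo) (dyadic k)%:E * b k x).
  move=> Sb.
  have b0 k x : 0 <= b k x by case: (Sb k).
  have mb k : measurable_fun setT (b k) by case: (Sb k).
  have d0 k : 0 <= (dyadic k : R)%:E by rewrite lee_fin ltW// dyadic_gt0.
  split.
  - apply: ge0_emeasurable_sum => [k x _ _|k _]; first exact: mule_ge0.
    exact: measurable_scale.
  - by move=> x; apply: nneseries_ge0 => k _ _; exact: mule_ge0.
  have mt k : measurable_fun setT (fun x => (dyadic k : R)%:E * (b k x ^+ 2 * (w x)%:E)).
    by apply: measurable_scale; exact: m2.
  have t0 k x : 0 <= (dyadic k : R)%:E * (b k x ^+ 2 * (w x)%:E) by rewrite mule_ge0// p2.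
  apply: (@le_trans _ _ (\int[mu]_x \sum_(k <oo) ((dyadic k)%:E * (b k x ^+ 2 * (w x)%:E)))).
    apply: nn_le_integral => //.
    - apply: m2; apply: ge0_emeasurable_sum => [k x _ _|k _]; first exact: mule_ge0.
      exact: measurable_scale.
    - by apply: ge0_emeasurable_sum => // k x _ _.
    - by move=> x; rewrite mule_ge0// expe_ge0// nneseries_ge0// => k _ _; exact: mule_ge0.
    move=> x _; apply: (@le_trans _ _ ((\sum_(k <oo) (dyadic k)%:E * b k x ^+ 2) * (w x)%:E)).
      by rewrite lee_wpmul2r// dyadic_jensen.
    rewrite muleC -nneseriesZl; last by move=> k _; rewrite mule_ge0// expe_ge0.
    apply: lee_nneseries => [k _ _|k _]; first by rewrite mule_ge0// mule_ge0// expe_ge0.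
    by rewrite muleC -muleA.
  rewrite integral_nneseries//.
  have A0 : (0 <= A)%R.
    have [_ _] := Sb 0%N; rewrite -lee_fin; apply: le_trans.
    by apply: integral_ge0 => x _; exact: p2.
  apply: (@le_trans _ _ (\sum_(k <oo) (A%:E * (dyadic k)%:E))).
    apply: lee_nneseries => [k _ _|k _]; first by apply: integral_ge0 => x _; exact: t0.
    rewrite ge0_integralZl//; last 2 first.
    - exact: m2.
    - by move=> x _; exact: p2.
    by rewrite muleC lee_wpmul2r//; case: (Sb k).
  rewrite nneseriesZl// -[leRHS]mule1 lee_wpmul2l ?lee_fin//; exact: sum_dyadic.
have Sfin b : S b -> {ae mu, forall x, b x < +oo}.
  move=> [mb b0 bA].
  have : \int[mu]_x (b x ^+ 2 * (w x)%:E) < +oo by rewrite (le_lt_trans bA)// ltry.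
  move=> /ae_lty_integral h; apply: filterS (h _ _) => [x||].
  - rewrite !ltey; apply: contra => /eqP ->.
    by rewrite expe2 mulyy gt0_mulye// lte_fin pw.2.
  - exact: m2.
  - by move=> x; exact: p2.
have Smeas b : S b -> measurable_fun setT b /\ forall x, 0 <= b x by move=> [].
have [|G [z [[mG G0 GA] Gz A1 fG]]] :=
    rubio_de_francia hB pw lw th0 Smeas Smax Sser Sfin _ fN0.
  by split.
exists z; split.
- move: A1; suff -> : (2 / th = majorant_const r K)%R by [].
  by rewrite /th invrK.
- by apply: filterS Gz => x Gx; rewrite EFinM -Gx.
apply: le_trans GA; apply: nn_le_integral_ae => //.
- apply: measurable_efin; apply: measurable_rmul pw.1; apply: measurable_funX; exact: A1.1.1.
- exact: m2.
- by move=> x; rewrite lee_fin mulr_ge0 ?sqr_ge0// ltW// pw.2.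
- by move=> x; exact: p2.
by apply: filterS Gz => x -> _; rewrite -EFin_expe -EFinM.
Qed.

End majorant.

(** * Extrapolation to all exponents for Muckenhoupt weights *)

Section truncation.
Context d (E : measurableType d) (R : realType) (mu : {measure set E -> \bar R}).
Variable F : nat -> set E.
Hypotheses (mF : forall k, measurable (F k)) (ndF : nondecreasing_seq F)
  (FT : \bigcup_k F k = setT).
Implicit Types (Y : E -> \bar R).

(** The truncations are bounded and supported on the sets F j of an exhaustion, so
    that their integrals are finite for locally finite weights, and they increase to
    Y. *)
Definition trunc j Y x : \bar R := mine (Y x) j%:R%:E * (\1_(F j) x)%:E.

Lemma trunc_ge0 j Y x : 0 <= Y x -> 0 <= trunc j Y x.
Proof. by move=> Y0; rewrite mule_ge0// ?lee_fin// le_min Y0/= lee_fin. Qed.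

Lemma trunc_le j Y x : 0 <= Y x -> trunc j Y x <= Y x.
Proof.
move=> Y0; rewrite /trunc indicE; case: (x \in F j); last by rewrite mule0.
by rewrite mule1 ge_min lexx.
Qed.

Lemma trunc_bound j Y x : 0 <= Y x -> trunc j Y x <= j%:R%:E * (\1_(F j) x)%:E.
Proof. by move=> Y0; rewrite lee_wpmul2r ?lee_fin// ge_min lexx orbT. Qed.

Lemma measurable_trunc j Y : measurable_fun setT Y -> measurable_fun setT (trunc j Y).
Proof.
move=> mY; apply: measurable_mul; last exact: measurable_eindic.
exact: measurable_mine.
Qed.

Lemma trunc_nd Y x : 0 <= Y x -> nondecreasing_seq (fun j => trunc j Y x).
Proof.
move=> Y0 i j ij; rewrite /trunc; apply: lee_pmul.
- by rewrite le_min Y0/= lee_fin.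
- by rewrite lee_fin.
- by rewrite le_min !ge_min lexx/= lee_fin ler_nat ij orbT.
rewrite lee_fin !indicE; case: (boolP (x \in F i)) => [|_]; last exact: ler0n.
by rewrite inE => /(subsetPset _ _ (ndF ij)) Fjx; rewrite mem_set.
Qed.

Lemma trunc_cvg Y x : 0 <= Y x -> trunc j Y x @[j --> \oo] --> Y x.
Proof.
move=> Y0; have [k _ kx] : (\bigcup_k F k) x by rewrite FT.
have FE j : (k <= j)%N -> trunc j Y x = mine (Y x) j%:R%:E.
  move=> kj; rewrite /trunc indicE mem_set ?mule1//.
  exact: (subsetPset _ _ (ndF kj)).
case Yx : (Y x) Y0 => [a| |//] Y0.
  apply: cvg_near_cst; exists (maxn k (Num.truncn a).+1) => // j /=.
  rewrite geq_max => /andP[kj aj]; rewrite FE// Yx min_l// lee_fin.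
  by apply: le_trans (ltW (truncnS_gt a)) _; rewrite ler_nat.
apply/cvgeyPge => A; exists (maxn k (Num.truncn A).+1) => // j /=.
rewrite geq_max => /andP[kj aj]; rewrite FE// Yx min_r ?leey// lee_fin.
by apply: le_trans (ltW (truncnS_gt A)) _; rewrite ler_nat.
Qed.

Lemma integral_le_trunc Y (w : E -> R) (b : \bar R) : measurable_fun setT Y ->
  (forall x, 0 <= Y x) -> measurable_fun setT w -> (forall x, (0 <= w x)%R) ->
  (forall j, \int[mu]_x (trunc j Y x * (w x)%:E) <= b) ->
  \int[mu]_x (Y x * (w x)%:E) <= b.
Proof.
move=> mY Y0 mw w0 h.
have mt j : measurable_fun setT (fun x => trunc j Y x * (w x)%:E).
  apply: measurable_mul (measurable_efin mw); exact: measurable_trunc.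
have t0 j x : 0 <= trunc j Y x * (w x)%:E.
  by rewrite mule_ge0 ?trunc_ge0// lee_fin.
apply: (@cvge_to_le _ \oo _ R (fun j => \int[mu]_x (trunc j Y x * (w x)%:E))); last first.
  by apply: nearW => j; exact: h.
rewrite [X in _ --> X](_ : _ =
    \int[mu]_x limn (fun j => trunc j Y x * (w x)%:E)); last first.
  apply: eq_integral => x _; apply/esym/cvg_lim => //.
  apply: cvgeZr => //; exact: trunc_cvg.
apply: cvg_monotone_convergence => //.
move=> x _ i j ij; apply: lee_wpmul2r; first by rewrite lee_fin.
exact: trunc_nd.
Qed.

End truncation.

Section extrapolation.
Context d (E : measurableType d) (R : realType) (mu : {measure set E -> \bar R}).
Variables (B : set (set E)) (dil : set E -> set E) (c : R).
Hypothesis hB : cube_basis mu B dil c.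
Hypothesis c0 : (0 < c)%R.
Implicit Types (f g : E -> \bar R) (w z : E -> R).

Definition nonneg_pairs (F : set ((E -> \bar R) * (E -> \bar R))) :=
  forall f g, F (f, g) -> [/\ measurable_fun setT f, measurable_fun setT g,
        (forall x, 0 <= f x) & (forall x, 0 <= g x)].

(** The weighted inequality for all weights of A_infty and the exponent p. The constant
    depends on the weight only through q and K, which is essential: the
    weights to which it is applied depend on the pair of functions. *)
Definition weighted_bound (F : set ((E -> \bar R) * (E -> \bar R))) (p : R) :=
  forall q K : R, (1 < q)%R -> (0 < K)%R -> exists2 C : R, (0 < C)%R &
    forall w, pos_weight w -> Ap_over mu B q K w -> forall f g, F (f, g) ->
    \int[mu]_x (f x `^ p * (w x)%:E) <= C%:E * \int[mu]_x (g x `^ p * (w x)%:E).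

Variable F : set ((E -> \bar R) * (E -> \bar R)).
Hypothesis F_pairs : nonneg_pairs F.

Lemma measurable_weighted_power f w p : measurable_fun setT f -> pos_weight w ->
  measurable_fun setT (fun x => f x `^ p * (w x)%:E).
Proof.
by move=> mf pw; apply: measurable_mul (pos_weightE pw); exact: measurable_poweRr.
Qed.

Lemma weighted_power_ge0 f w p x : pos_weight w -> 0 <= f x `^ p * (w x)%:E.
Proof. by move=> pw; rewrite mule_ge0 ?poweR_ge0// lee_fin ltW// pw.2. Qed.

Lemma integral_power_eq0 f w p : (0 < p)%R -> measurable_fun setT f -> (forall x, 0 <= f x) ->
  pos_weight w -> \int[mu]_x (f x `^ p * (w x)%:E) = 0 -> {ae mu, forall x, f x = 0}.
Proof.
move=> p0 mf f0 pw /integral_eq0_ae h.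
apply: filterS (h _ _ _) => [x /(_ I)||| ] //.
- move/eqP; rewrite mule_eq0 eqe (gt_eqF (pw.2 x)) orbF poweR_eq0//.
  by move=> /andP[/eqP].
- exact: measurable_weighted_power.
- by move=> x; exact: weighted_power_ge0.
Qed.

Lemma ae0_integral_power f w p : (0 < p)%R -> measurable_fun setT f -> pos_weight w ->
  {ae mu, forall x, f x = 0} -> \int[mu]_x (f x `^ p * (w x)%:E) = 0.
Proof.
move=> p0 mf pw f0; rewrite -(integral0 mu setT).
apply: ae_eq_integral => //; first exact: measurable_weighted_power.
by apply: filterS f0 => x -> _; rewrite poweR0r ?mul0e// gt_eqF.
Qed.

(** If y^p <= z^2, the second term is enough. Otherwise the first one is: it equals
    y^p (y^p / z^2)^(p0/p - 1). *)
Lemma power_split_le (y : \bar R) (z p p0 : R) : 0 <= y -> (0 < z)%R -> (0 < p)%R -> (p < p0)%R ->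
  y `^ p <= y `^ p0 * (z `^ (- (2 * (p0 / p - 1))))%:E + (z ^+ 2)%:E.
Proof.
move=> y0 z0 p_gt0 pp0; have p0_gt0 := lt_trans p_gt0 pp0.
case: y y0 => [y| |//]; last first.
  by move=> _; rewrite !poweRyr ?gt_eqF// gt0_mulye ?lte_fin ?powR_gt0// addye.
rewrite lee_fin le_eqVlt => /predU1P[<-|y0].
  by rewrite !poweR0r ?gt_eqF// mul0e add0e lee_fin sqr_ge0.
rewrite !poweR_EFin -EFinM -EFinD lee_fin.
have [u ->] := pos_expR y0; have [v ->] := pos_expR z0.
rewrite -powR_mulrn ?expR_ge0// !expR_powR -expRD.
have [h|h] := leP (p * u)%R (2 * v)%R.
  by apply: (@le_trans _ _ (expR (2%:R * v))); rewrite ?lerDr ?expR_ge0// ler_expR.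
apply: (@le_trans _ _ (expR (p0 * u + - (2 * (p0 / p - 1)) * v))); last by rewrite lerDl expR_ge0.
rewrite ler_expR -subr_ge0.
rewrite [leRHS](_ : _ = (p0 / p - 1) * (p * u - 2 * v))%R; last by field; rewrite gt_eqF.
by rewrite mulr_ge0 ?subr_ge0 ?ler_pdivlMr ?mul1r// ltW.
Qed.

(** Let z be an A_1(w) majorant of g^(p/2), so that the integral of z^2 w is at most
    that of g^p w. With N = 2 (p0 / p - 1), [power_split_le] bounds f^p by
    f^p0 z^(-N) + z^2. The weight w z^(-N) is in some A_r, with constants depending
    only on those of w, so f^p0 can be replaced by g^p0, and
    g^p0 = (g^(p/2))^(N + 2) <= (2 z)^(N + 2) brings back a multiple of z^2. *)
Lemma weighted_bound_down (p0 p : R) : (0 < p)%R -> (p < p0)%R ->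
  weighted_bound F p0 -> weighted_bound F p.
Proof.
move=> p_gt0 pp0 H q K q1 K0; have p0_gt0 := lt_trans p_gt0 pp0.
pose N := (2 * (p0 / p - 1))%R.
have N0 : (0 < N)%R by rewrite mulr_gt0// subr_gt0 ltr_pdivlMr// mul1r.
pose k := majorant_const c q K.
have k0 : (0 < k)%R.
  by rewrite mulr_gt0// addr_gt0// mulr_gt0// !mulr_gt0// powR_gt0.
pose K' := (2 `^ ((N + 1) * q - 1) * k `^ N * K `^ (N + 1))%R.
have K'0 : (0 < K')%R by rewrite !mulr_gt0// powR_gt0.
have q'1 : (1 < (N + 1) * q)%R.
  by rewrite (lt_le_trans q1)// ler_peMl ?(ltW (lt_trans ltr01 q1))// lerDr ltW.
have [C1 C10 H1] := H _ _ q'1 K'0.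
have [C2 C20 H2] := H _ _ q1 K0.
pose C := (C1 * 2 `^ (N + 2) + 1)%R.
have C0 : (0 < C)%R by rewrite addr_gt0// mulr_gt0// powR_gt0.
exists C => // w pw Ap f g Ffg; have [mf mg f0 g0] := F_pairs Ffg.
set A := \int[mu]_x (g x `^ p * (w x)%:E).
have A0 : 0 <= A by apply: integral_ge0 => x _; exact: weighted_power_ge0.
(* Without a nonzero g there is no majorant; then f = 0 by the hypothesis for w
   itself. *)
have [gN0|gN0] := pselect {ae mu, forall x, g x = 0}.
  rewrite (ae0_integral_power p_gt0 mf pw) ?mule_ge0 ?lee_fin ?(ltW C0)//.
  apply: (integral_power_eq0 p0_gt0 mf f0 pw).
  apply/eqP; rewrite eq_le integral_ge0 ?andbT; last first.
    by move=> x _; exact: weighted_power_ge0.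
  by apply: le_trans (H2 _ pw Ap _ _ Ffg) _; rewrite (ae0_integral_power p0_gt0 mg pw) ?mule0.
have [Afin|] := boolP (A \is a fin_num); last first.
  rewrite ge0_fin_numE// -leNgt leye_eq => /eqP ->.
  by rewrite gt0_muley ?leey// lte_fin.
pose G x := g x `^ (p / 2).
have p2 : (0 < p / 2)%R by rewrite divr_gt0.
have G2 x : G x ^+ 2 = g x `^ p.
  rewrite /G expe2; have := g0 x; case: (g x) => [a|_|//].
    by rewrite lee_fin !poweR_EFin -EFinM => a0; congr EFin; rewrite -expr2 -powR_mulrn ?powR_ge0// -powRrM divfK.
  by rewrite !poweRyr ?gt_eqF// mulyy.
have mG : measurable_fun setT G by exact: measurable_poweRr.
have [|||z [A1 Gz zA]] := @L2_majorant _ _ _ _ _ _ _ hB c0 q K (fine A) w G q1 K0 pw Ap mG.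
- by move=> x; exact: poweR_ge0.
- apply: contra_not gN0; apply: filterS => x /eqP; rewrite poweR_eq0//.
  by move=> /andP[/eqP].
- by rewrite fineK// le_eqVlt; apply/orP; left; apply/eqP; apply: eq_integral => x _; rewrite G2.
have pz := A1.1.
have pwz : pos_weight (fun x => w x * z x `^ (- N))%R.
  by apply: pos_weight_mul => //; exact: pos_weight_powR.
have ApN := Ap_over_A1_pow hB q1 k0 N0 pw Ap A1.
have mz2 : measurable_fun setT (fun x => (z x ^+ 2 * w x)%:E).
  by apply: measurable_efin; apply: measurable_rmul pw.1; apply: measurable_funX; exact: pz.1.
have z20 x : 0 <= (z x ^+ 2 * w x)%:E by rewrite lee_fin mulr_ge0 ?sqr_ge0// ltW// pw.2.
apply: (@le_trans _ _ (\int[mu]_x (f x `^ p0 * (w x * z x `^ (- N))%:E) +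
    \int[mu]_x (z x ^+ 2 * w x)%:E)).
  rewrite -ge0_integralD//; last 2 first.
  - by move=> x _; exact: (weighted_power_ge0 f p0 x pwz).
  - exact: (measurable_weighted_power p0 mf pwz).
  apply: nn_le_integral => //.
  - exact: measurable_weighted_power.
  - by apply: measurable_add => //; exact: (measurable_weighted_power p0 mf pwz).
  - by move=> x; exact: weighted_power_ge0.
  move=> x _; apply: (@le_trans _ _
     ((f x `^ p0 * (z x `^ (- N))%:E + (z x ^+ 2)%:E) * (w x)%:E)).
    rewrite lee_wpmul2r ?lee_fin ?(ltW (pw.2 x))//; apply: power_split_le => //; exact: pz.2.
  rewrite ge0_muleDl ?lee_fin ?sqr_ge0//; last by rewrite mule_ge0 ?poweR_ge0// lee_fin powR_ge0.
  by rewrite -muleA -!EFinM [(_ `^ _ * w x)%R]mulrC.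
have step : \int[mu]_x (g x `^ p0 * (w x * z x `^ (- N))%:E) <=
    (2 `^ (N + 2))%:E * \int[mu]_x (z x ^+ 2 * w x)%:E.
  rewrite -ge0_integralZl ?lee_fin ?powR_ge0//.
  apply: nn_le_integral_ae => //.
  - exact: (measurable_weighted_power p0 mg pwz).
  - exact: measurable_scale.
  - by move=> x; exact: (weighted_power_ge0 g p0 x pwz).
  - by move=> x; rewrite mule_ge0// lee_fin powR_ge0.
  apply: filterS Gz => x Gzx _.
  have z0 := pz.2 x; have w0 := pw.2 x.
  have gE : g x `^ p0 = G x `^ (N + 2).
    rewrite /G -poweRrM; congr (_ `^ _); rewrite /N; field; by rewrite gt_eqF.
  have N2 : (0 <= N + 2)%R by rewrite addr_ge0// ltW.
  rewrite gE; apply: (@le_trans _ _ ((2 * z x)%:E `^ (N + 2) * (w x * z x `^ (- N))%:E)).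
    rewrite lee_wpmul2r ?lee_fin ?mulr_ge0 ?powR_ge0 ?(ltW w0)//.
    by apply: gt0_ler_poweR; rewrite ?in_itv/= ?leey ?andbT ?poweR_ge0// lee_fin mulr_ge0// ltW.
  rewrite poweR_EFin -!EFinM lee_fin le_eqVlt; apply/orP; left; apply/eqP.
  have two0 : (0 < 2 :> R)%R by [].
  rewrite -powR_mulrn ?(ltW z0)//.
  have [u2 ->] := pos_expR two0; have [zz ->] := pos_expR z0; have [ww ->] := pos_expR w0.
  do 4 rewrite ?expR_powR -?(expRN, expRD).
  congr expR; ring.
have Hz := H1 _ pwz ApN _ _ Ffg.
apply: (@le_trans _ _ (C%:E * \int[mu]_x (z x ^+ 2 * w x)%:E)); last first.
  by rewrite lee_wpmul2l ?lee_fin ?(ltW C0)// -(fineK Afin).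
rewrite /C EFinD ge0_muleDl ?lee_fin ?ler01// ?mulr_ge0 ?powR_ge0 ?(ltW C10)// mul1e leeD2r//.
apply: (le_trans Hz); rewrite EFinM -muleA lee_wpmul2l// lee_fin ltW//.
Qed.

End extrapolation.

Section extrapolation_up.
Context d (E : measurableType d) (R : realType) (mu : {measure set E -> \bar R}).
Variables (B : set (set E)) (dil : set E -> set E) (c : R).
Hypothesis hB : cube_basis mu B dil c.
Hypothesis c0 : (0 < c)%R.
Implicit Types (f g : E -> \bar R) (w z : E -> R).
Variable F : set ((E -> \bar R) * (E -> \bar R)).
Hypothesis F_pairs : nonneg_pairs F.

Lemma young_le (y : \bar R) (z C : R) : 0 <= y -> (0 < C)%R ->
  (2 * C * z)%:E * y <= (2^-1 * z ^+ 2)%:E + (2 * C ^+ 2)%:E * y ^+ 2.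
Proof.
case: y => [y _|_|//] C0; last first.
  by rewrite expe2 mulyy (@gt0_muley _ (2 * C ^+ 2)%:E) ?lte_fin ?mulr_gt0 ?exprn_gt0// addey// leey.
rewrite -EFin_expe -!EFinM -EFinD lee_fin -subr_ge0.
rewrite [leRHS](_ : _ = 2^-1 * (z - 2 * C * y) ^+ 2)%R; last by field.
by rewrite mulr_ge0 ?sqr_ge0// invr_ge0.
Qed.

Lemma poweR_half_sqr (y : \bar R) : 0 <= y -> (y `^ 2^-1) ^+ 2 = y.
Proof.
case: y => [a|_|//]; last by rewrite poweRyr ?gt_eqF// expe2 mulyy.
rewrite lee_fin => a0; rewrite poweR_EFin -EFin_expe -powR_mulrn ?powR_ge0//.
by rewrite -powRrM mulVf// powRr1.
Qed.

Lemma poweR_sqr_half (y : \bar R) (p : R) : (0 < p)%R -> 0 <= y ->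
  (y `^ (2 * p)) `^ 2^-1 = y `^ p.
Proof. by move=> p0 y0; rewrite -poweRrM mulrC mulrA mulVf// mul1r. Qed.

(** Let h be the p-th power of f, truncated so that the integral I of h^2 w is finite,
    and let z be an A_1(w) majorant of h. Then
    I <= 2 int f^p z w <= 2 C int g^p z w by the hypothesis for the weight z w, and
    Young's inequality bounds this by I / 2 + 2 C^2 int g^(2p) w. As I is finite, I / 2
    can be subtracted. *)
Lemma weighted_bound_double (p : R) : (0 < p)%R ->
  weighted_bound mu B F p -> weighted_bound mu B F (2 * p).
Proof.
move=> p0 H q K q1 K0.
pose k := majorant_const c q K.
have k0 : (0 < k)%R.
  by rewrite mulr_gt0// addr_gt0// mulr_gt0// !mulr_gt0// powR_gt0.
have kK : (0 < k * K)%R by rewrite mulr_gt0.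
have [C C0 H1] := H _ _ q1 kK.
have C20 : (0 < 4 * C ^+ 2)%R by rewrite mulr_gt0// exprn_gt0.
exists (4 * C ^+ 2)%R => // w pw Ap f g Ffg; have [mf mg f0 g0] := F_pairs Ffg.
have mw := pos_weightE pw.
have w0 x : 0 <= (w x)%:E by rewrite lee_fin ltW// pw.2.
have p2 : (0 < 2 * p)%R by rewrite mulr_gt0.
set A := \int[mu]_x (g x `^ (2 * p) * (w x)%:E).
have A0 : 0 <= A by apply: integral_ge0 => x _; exact: weighted_power_ge0.
have [Afin|] := boolP (A \is a fin_num); last first.
  rewrite ge0_fin_numE// -leNgt leye_eq => /eqP ->.
  by rewrite gt0_muley ?leey// lte_fin.
have [Fn [BF ndF FT]] := basis_exhaust hB.
have mF j : measurable (Fn j) by exact: (basis_measurable hB).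
pose Y x := f x `^ (2 * p).
have mY : measurable_fun setT Y by exact: measurable_poweRr.
have Y0 x : 0 <= Y x by exact: poweR_ge0.
apply: (integral_le_trunc mF ndF FT mY Y0 pw.1 (fun x => ltW (pw.2 x))) => j.
pose h x := (trunc Fn j Y x) `^ 2^-1.
have h0 x : 0 <= h x by exact: poweR_ge0.
have mh : measurable_fun setT h by apply: measurable_poweRr; exact: measurable_trunc.
have h2 x : h x ^+ 2 = trunc Fn j Y x by rewrite poweR_half_sqr// trunc_ge0.
have hf x : h x <= f x `^ p.
  rewrite -(poweR_sqr_half p0 (f0 x)); apply: gt0_ler_poweR.
  - by rewrite invr_ge0.
  - by rewrite in_itv/= trunc_ge0//= leey.
  - by rewrite in_itv/= Y0/= leey.
  - exact: trunc_le.
have -> : \int[mu]_x (trunc Fn j Y x * (w x)%:E) = \int[mu]_x (h x ^+ 2 * (w x)%:E).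
  by apply: eq_integral => x _; rewrite h2.
set I := \int[mu]_x (h x ^+ 2 * (w x)%:E).
have m2 (b : E -> \bar R) : measurable_fun setT b -> measurable_fun setT (fun x => b x ^+ 2 * (w x)%:E).
  by move=> mb; apply: measurable_mul mw; exact: measurable_expe.
have I0 : 0 <= I by apply: integral_ge0 => x _; rewrite mule_ge0 ?expe_ge0.
have [hN0|hN0] := pselect {ae mu, forall x, h x = 0}.
  rewrite (_ : I = 0); first by rewrite mule_ge0// lee_fin ltW.
  rewrite -(integral0 mu setT); apply: ae_eq_integral => //; first exact: m2.
  by apply: filterS hN0 => x -> _; rewrite expe2 !mul0e.
have Ifin : I \is a fin_num.
  rewrite ge0_fin_numE//.
  have [s s0 sE] := basis_weight hB pw (Ap_over_locally_finite Ap) (BF j).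
  apply: (@le_lt_trans _ _ (j%:R%:E * s%:E)); last by rewrite -EFinM ltry.
  have mind : measurable_fun setT (fun x => (w x)%:E * (\1_(Fn j) x)%:E).
    by apply: measurable_mul mw _; exact: measurable_eindic.
  have -> : j%:R%:E * s%:E = \int[mu]_x (j%:R%:E * ((w x)%:E * (\1_(Fn j) x)%:E)).
    rewrite ge0_integralZl ?lee_fin//; last by move=> x _; rewrite mule_ge0// lee_fin.
    by rewrite (@integral_indic_mul _ _ _ mu (Fn j) (EFin \o w)) ?sE.
  apply: nn_le_integral => //.
  - exact: m2.
  - exact: measurable_scale.
  - by move=> x; rewrite mule_ge0 ?expe_ge0.
  move=> x _; rewrite h2 [leRHS]muleCA [leRHS]muleC lee_wpmul2r//.
  exact: trunc_bound.
have [|z [A1 hz zI]] := @L2_majorant _ _ _ _ _ _ _ hB c0 q K (fine I) w h q1 K0 pw Ap mh h0 hN0.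
  by rewrite fineK.
have pz := A1.1.
have pzw := pos_weight_mul pz pw.
have ApzW := Ap_over_A1_mul hB q1 k0 pw Ap A1.
have Hz := H1 _ pzw ApzW _ _ Ffg.
have mp b : measurable_fun setT b -> measurable_fun setT (fun x => b x `^ p * (z x * w x)%:E).
  by move=> mb; exact: (measurable_weighted_power p mb pzw).
have q0 b x : 0 <= b x `^ p * (z x * w x)%:E by exact: (weighted_power_ge0 b p x pzw).
have mz2 : measurable_fun setT (fun x => (z x ^+ 2 * w x)%:E).
  by apply: measurable_efin; apply: measurable_rmul pw.1; apply: measurable_funX; exact: pz.1.
have z20 x : 0 <= (z x ^+ 2 * w x)%:E by rewrite lee_fin mulr_ge0 ?sqr_ge0// ltW// pw.2.
have le1 : I <= 2%:E * \int[mu]_x (f x `^ p * (z x * w x)%:E).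
  rewrite -ge0_integralZl//; last exact: mp.
  apply: nn_le_integral_ae => //.
  - exact: m2.
  - by apply: measurable_scale; exact: mp.
  - by move=> x; rewrite mule_ge0 ?expe_ge0.
  - by move=> x; rewrite mule_ge0.
  apply: filterS hz => x hzx _; rewrite expe2.
  apply: (@le_trans _ _ (f x `^ p * (2 * z x)%:E * (w x)%:E)).
    by rewrite lee_wpmul2r// lee_pmul.
  by rewrite !EFinM muleCA !muleA lexx.
have le2 : (2 * C)%:E * \int[mu]_x (g x `^ p * (z x * w x)%:E) <=
    2^-1%:E * \int[mu]_x (z x ^+ 2 * w x)%:E + (2 * C ^+ 2)%:E * A.
  have CC0 : (0 <= 2 * C)%R by rewrite mulr_ge0// ltW.
  have CC2 : (0 <= 2 * C ^+ 2)%R by rewrite mulr_ge0// sqr_ge0.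
  have mg2 : measurable_fun setT (fun x => g x `^ (2 * p) * (w x)%:E) by exact: measurable_weighted_power.
  have g20 x : 0 <= g x `^ (2 * p) * (w x)%:E by exact: weighted_power_ge0.
  rewrite -!ge0_integralZl ?lee_fin//; [|exact: mp].
  rewrite -ge0_integralD//; last 4 first.
  - by move=> x _; rewrite mule_ge0// lee_fin invr_ge0.
  - exact: measurable_scale.
  - by move=> x _; rewrite mule_ge0// lee_fin.
  - exact: measurable_scale.
  apply: nn_le_integral => //.
  - by apply: measurable_scale; exact: mp.
  - by apply: measurable_add; exact: measurable_scale.
  - by move=> x; rewrite mule_ge0// lee_fin.
  move=> x _.
  have -> : g x `^ (2 * p) = (g x `^ p) ^+ 2.
    by rewrite -(poweR_sqr_half p0 (g0 x)) poweR_half_sqr// poweR_ge0.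
  have := young_le (z x) (poweR_ge0 (g x) p) C0.
  move=> /(lee_wpmul2r (w0 x)); rewrite ge0_muleDl; last 2 first.
  - by rewrite lee_fin mulr_ge0 ?invr_ge0 ?sqr_ge0.
  - by rewrite mule_ge0 ?lee_fin ?expe_ge0 ?poweR_ge0.
  move=> hy; apply: (le_trans (le_trans _ hy)).
    rewrite le_eqVlt; apply/orP; left; apply/eqP.
    rewrite [(2 * C * z x)%:E]EFinM -!muleA; congr (_ * _).
    by rewrite EFinM muleCA.
  by rewrite -!muleA !EFinM !muleA lexx.
have : I <= 2^-1%:E * I + (2 * C ^+ 2)%:E * A.
  apply: (le_trans le1); apply: (@le_trans _ _ (2%:E * (C%:E * \int[mu]_x (g x `^ p * (z x * w x)%:E)))).
    by rewrite lee_pmul2l ?lte_fin.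
  rewrite muleA -EFinM; apply: (le_trans le2).
  rewrite leeD2r// lee_pmul2l ?lte_fin ?invr_gt0//.
  by rewrite -(fineK Ifin).
rewrite -(fineK Ifin) -(fineK Afin) -!EFinM -EFinD !lee_fin => h'.
set a := fine I in h' *; set b := fine A in h' *; set e := (C ^+ 2)%R in h' *.
have : (a <= 2^-1 * a + 2 * (e * b))%R by rewrite [leRHS](_ : _ = 2^-1 * a + 2 * e * b)%R//; ring.
rewrite -[X in (_ -> _ <= X)%R]mulrA; lra.
Qed.

(** Doubling p0 often enough exceeds p, and the exponent then decreases to p. *)
Lemma weighted_bound_all (p0 p : R) : (0 < p0)%R -> (0 < p)%R ->
  weighted_bound mu B F p0 -> weighted_bound mu B F p.
Proof.
move=> p00 p_gt0 H.
have up m : weighted_bound mu B F (2 ^+ m * p0)%R.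
  elim: m => [|m IH]; first by rewrite expr0 mul1r.
  by rewrite exprS -mulrA; apply: weighted_bound_double => //; rewrite mulr_gt0// exprn_gt0.
pose m := (Num.truncn (p / p0)).+1.
apply: (weighted_bound_down hB c0 F_pairs p_gt0 _ (up m)).
rewrite -ltr_pdivrMr//; apply: lt_le_trans (truncnS_gt _) _.
by rewrite -natrX ler_nat ltnW// ltn_expl.
Qed.

End extrapolation_up.

(** * Duality for function norms *)

Section real_integrals.
Context d (E : measurableType d) (R : realType) (mu : {measure set E -> \bar R}).
Variable w : E -> R.
Hypothesis pw : pos_weight w.
Implicit Types (y : E -> R).

Definition wint y := \int[mu]_x (y x * w x)%:E.

Let mw : measurable_fun setT w := pw.1.
Let w0 x : (0 <= w x)%R := ltW (pw.2 x).

Lemma wint_ge0 y : (forall x, (0 <= y x)%R) -> 0 <= wint y.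
Proof. by move=> y0; apply: integral_ge0 => x _; rewrite lee_fin mulr_ge0. Qed.

Lemma measurable_wint y : measurable_fun setT y ->
  measurable_fun setT (fun x => (y x * w x)%:E).
Proof. by move=> my; apply: measurable_efin; exact: measurable_rmul. Qed.

Lemma wint_le y1 y2 : measurable_fun setT y1 -> measurable_fun setT y2 ->
  (forall x, (0 <= y1 x)%R) -> (forall x, (y1 x <= y2 x)%R) -> wint y1 <= wint y2.
Proof.
move=> m1 m2 y0 y12; apply: nn_le_integral => //; try exact: measurable_wint.
- by move=> x; rewrite lee_fin mulr_ge0.
- by move=> x _; rewrite lee_fin ler_wpM2r.
Qed.

Lemma wintD y1 y2 : measurable_fun setT y1 -> measurable_fun setT y2 ->
  (forall x, (0 <= y1 x)%R) -> (forall x, (0 <= y2 x)%R) ->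
  wint (fun x => y1 x + y2 x)%R = wint y1 + wint y2.
Proof.
move=> m1 m2 y10 y20; rewrite /wint -ge0_integralD//.
- by apply: eq_integral => x _; rewrite mulrDl EFinD.
- by move=> x _; rewrite lee_fin mulr_ge0.
- exact: measurable_wint.
- by move=> x _; rewrite lee_fin mulr_ge0.
- exact: measurable_wint.
Qed.

Lemma wintZ (a : R) y : measurable_fun setT y -> (forall x, (0 <= y x)%R) -> (0 <= a)%R ->
  wint (fun x => a * y x)%R = a%:E * wint y.
Proof.
move=> my y0 a0; rewrite /wint -ge0_integralZl//.
- by apply: eq_integral => x _; rewrite -mulrA EFinM.
- exact: measurable_wint.
- by move=> x _; rewrite lee_fin mulr_ge0.
Qed.

Lemma wint_indic A : measurable A -> wint \1_A = \int[mu]_(x in A) (w x)%:E.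
Proof.
move=> mA; rewrite -(@integral_indic_mul _ _ _ mu A (EFin \o w))//.
by apply: eq_integral => x _; rewrite /= -EFinM mulrC.
Qed.

Lemma wint_eq0 y : measurable_fun setT y -> (forall x, (0 <= y x)%R) -> wint y = 0 ->
  {ae mu, forall x, y x = 0%R}.
Proof.
move=> my y0 /integral_eq0_ae h.
apply: filterS (h _ _ _) => [x /(_ I)||| ] //.
- by move=> [/eqP]; rewrite mulf_eq0 (gt_eqF (pw.2 x)) orbF => /eqP.
- exact: measurable_wint.
- by move=> x; rewrite lee_fin mulr_ge0.
Qed.

End real_integrals.

(** The axioms of a Banach function norm on which the duality rests, for an arbitrary
    measure space. *)
Record function_norm d (E : measurableType d) (R : realType)
    (mu : {measure set E -> \bar R}) (N : (E -> \bar R) -> \bar R) := FunctionNorm {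
  fn_eq0 : forall f, measurable_fun setT f -> N f = 0 <-> {ae mu, forall x, f x = 0} ;
  fn_triangle : forall f g, measurable_fun setT f -> measurable_fun setT g ->
    N (f \+ g) <= N f + N g ;
  fn_homogeneous : forall (a : R) f, measurable_fun setT f ->
    N (fun x => a%:E * f x) = `|a%:E| * N f ;
  fn_monotone : forall f g, measurable_fun setT f -> measurable_fun setT g ->
    {ae mu, forall x, `|f x| <= `|g x|} -> N f <= N g ;
  fn_fatou : forall (fs : nat -> E -> \bar R) f,
    (forall j, measurable_fun setT (fs j)) -> measurable_fun setT f ->
    {ae mu, forall x, nondecreasing_seq (fun j => `|fs j x|) /\
      `|fs j x| @[j --> \oo] --> `|f x|} -> N (fs j) @[j --> \oo] --> N f }.

Section minimiser.
Context d (E : measurableType d) (R : realType) (mu : {measure set E -> \bar R}).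
Variable w : E -> R.
Hypothesis pw : pos_weight w.
Variable N : (E -> \bar R) -> \bar R.
Hypothesis HN : function_norm mu N.
Variables (A : set E) (f : E -> R) (L s : R).
Hypotheses (mA : measurable A) (mf : measurable_fun setT f) (L0 : (0 < L)%R)
  (f0 : forall x, (0 <= f x)%R) (fL : forall x, (f x <= L * \1_A x)%R)
  (sE : \int[mu]_(x in A) (w x)%:E = s%:E).

Implicit Types (b y : E -> R).

(** The elements of the unit ball of N between 0 and f. They are bounded and vanish
    outside A, like f, so all the integrals below are finite. *)
Definition competitor b :=
  [/\ measurable_fun setT b, forall x, (0 <= b x <= f x)%R & N (EFin \o b) <= 1].

Definition distance2 b := wint mu w (fun x => (f x - b x) ^+ 2)%R.

Let s0 : (0 <= s)%R.
Proof.
by rewrite -lee_fin -sE; apply: integral_ge0 => x _; rewrite lee_fin ltW// pw.2.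
Qed.

Let mind : measurable_fun setT (\1_A : E -> R).
Proof. exact: measurable_indic. Qed.

Lemma measurable_dist2 b : measurable_fun setT b ->
  measurable_fun setT (fun x => (f x - b x) ^+ 2)%R.
Proof. by move=> mb; apply: measurable_funX; exact: measurable_funB. Qed.

Lemma wint_bounded y (C : R) : measurable_fun setT y -> (forall x, (0 <= y x)%R) -> (0 <= C)%R ->
  (forall x, (y x <= C * \1_A x)%R) -> wint mu w y <= (C * s)%:E.
Proof.
move=> my y0 C0 yC.
rewrite EFinM -sE -(wint_indic mu w mA) -(wintZ mu pw)//.
by apply: wint_le => //; exact: measurable_rmul.
Qed.

Lemma competitor_out b x : competitor b -> ~ A x -> f x = 0%R /\ b x = 0%R.
Proof.
move=> [_ /(_ x)/andP[b0 bf] _] Ax.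
have fx0 : f x = 0%R.
  by apply/eqP; rewrite eq_le f0 andbT; have := fL x; rewrite indicE memNset// mulr0.
by split => //; apply/eqP; rewrite eq_le b0 andbT -fx0.
Qed.

Lemma distance2_bound b : competitor b -> distance2 b <= (L ^+ 2 * s)%:E.
Proof.
move=> Kb; have [mb bf Nb] := Kb; apply: wint_bounded.
- exact: measurable_dist2.
- by move=> x; exact: sqr_ge0.
- exact: sqr_ge0.
move=> x; have /andP[bx0 bfx] := bf x; have := fL x.
rewrite indicE; case: (boolP (x \in A)) => xA; rewrite ?mulr1 ?mulr0.
  by move=> fxL; rewrite lerXn2r ?nnegrE ?subr_ge0// ?(ltW L0)//; lra.
move=> fx0; have -> : (f x - b x = 0)%R by have := f0 x; lra.
by rewrite expr0n.
Qed.

Lemma competitor0 : competitor (fun=> 0%R).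
Proof.
split => //; first by move=> x; rewrite lexx f0.
rewrite (_ : N _ = 0) ?lee01//; apply/(fn_eq0 HN); first exact: measurable_cst.
exact: nearW.
Qed.

(** The minimum with f keeps a convex combination below f and can only decrease its
    norm. *)
Lemma competitor_mix (b b' : E -> R) (t : R) : (0 <= t <= 1)%R ->
  measurable_fun setT b -> measurable_fun setT b' ->
  (forall x, (0 <= b x)%R) -> (forall x, (0 <= b' x)%R) ->
  N (EFin \o b) <= 1 -> N (EFin \o b') <= 1 ->
  competitor (fun x => Num.min (f x) ((1 - t) * b x + t * b' x))%R.
Proof.
move=> /andP[t0 t1] mb mb' b0 b'0 Nb Nb'.
have m1 : measurable_fun setT (fun x => (1 - t) * b x)%R by exact: measurable_rmul.
have m2 : measurable_fun setT (fun x => t * b' x)%R by exact: measurable_rmul.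
have mm : measurable_fun setT (fun x => (1 - t) * b x + t * b' x)%R by exact: measurable_funD.
have mmin : measurable_fun setT (fun x => Num.min (f x) ((1 - t) * b x + t * b' x))%R.
  exact: measurable_minr.
have mix0 x : (0 <= (1 - t) * b x + t * b' x)%R.
  by rewrite addr_ge0// mulr_ge0// subr_ge0.
split => //.
  by move=> x; rewrite le_min f0 mix0/= ge_min lexx.
have -> : 1 = `|(1 - t)%:E| * 1 + `|t%:E| * 1 :> \bar R.
  by rewrite !mule1 !abse_EFin !ger0_norm ?subr_ge0// -EFinD subrK.
apply: (@le_trans _ _ (N ((fun x => (1 - t)%:E * (EFin \o b) x) \+
    (fun x => t%:E * (EFin \o b') x)))).
  apply: (fn_monotone HN); [exact: measurable_efin| |].
    by apply: emeasurable_funD; apply: measurable_scale; exact: measurable_efin.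
  apply: nearW => x /=; rewrite lee_fin !ger0_norm//.
    by rewrite ge_min lexx orbT.
  by rewrite le_min f0 mix0.
apply: (le_trans (fn_triangle HN _ _)); try by apply: measurable_scale; exact: measurable_efin.
rewrite !(fn_homogeneous HN); try exact: measurable_efin.
by apply: leeD; exact: lee_wpmul2l.
Qed.

Lemma dyadic_small (e : R) : (0 < e)%R -> exists k, (dyadic k <= e)%R.
Proof.
move=> e0; exists (Num.truncn e^-1); rewrite /dyadic -[leRHS]invrK lef_pV2 ?posrE ?invr_gt0 ?exprn_gt0//.
apply: le_trans (ltW (truncnS_gt _)) _.
by rewrite -natrX ler_nat ltnW// ltn_expl.
Qed.

Lemma dyadicD k i : (dyadic (k + i) = 2 * dyadic k * dyadic i :> R)%R.
Proof.
rewrite /dyadic -addnS exprD [in RHS]exprS invfM.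
have h : (2 ^+ k != 0 :> R)%R by rewrite expf_neq0.
have h' : (2 ^+ i.+1 != 0 :> R)%R by rewrite expf_neq0.
by field; rewrite h h'.
Qed.

(** As the bound on the increments does not involve m, it also compares a k with the
    lower limit of the sequence. *)
Lemma telescope_le (a : nat -> R) k m :
  ((a k)%:E <= (a (k + m)%N)%:E + \sum_(i <oo) `|a (k + i).+1 - a (k + i)%N|%:E)%E.
Proof.
have h : (a k <= a (k + m)%N + \sum_(0 <= i < m) `|a (k + i).+1 - a (k + i)%N|)%R.
  elim: m => [|m IH]; first by rewrite addn0 big_geq// addr0.
  rewrite big_nat_recr//= addnS; apply: (le_trans IH).
  set S := (\sum_(0 <= i < m) _)%R.
  have := ler_norm (a (k + m)%N - a (k + m).+1); rewrite distrC; lra.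
apply: (@le_trans _ _ ((a (k + m)%N)%:E + \sum_(0 <= i < m) (`|a (k + i).+1 - a (k + i)%N|%:E))).
  by rewrite sumEFin -EFinD lee_fin.
by apply: leeD2l; exact: nneseries_lim_ge.
Qed.

(** The parallelogram identity: the midpoint of two almost minimisers is itself a
    competitor, so it is not much closer to f, and the two are close to one another. *)
Lemma increment_bound b b' (D e : R) : competitor b -> competitor b' -> (0 <= D)%R ->
  (forall b, competitor b -> D%:E <= distance2 b) ->
  distance2 b <= (D + e)%:E -> distance2 b' <= (D + e)%:E ->
  wint mu w (fun x => (b' x - b x) ^+ 2)%R <= (4 * e)%:E.
Proof.
move=> Kb Kb' D0 DK be b'e; have [mb bf Nb] := Kb; have [mb' b'f Nb'] := Kb'.
have half : (0 <= (2^-1 : R) <= 1)%R by apply/andP; split; lra.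
have b0 x : (0 <= b x)%R by case/andP: (bf x).
have b'0 x : (0 <= b' x)%R by case/andP: (b'f x).
have Km := @competitor_mix b b' _ half mb mb' b0 b'0 Nb Nb'.
have mdd : measurable_fun setT (fun x => (b' x - b x) ^+ 2)%R.
  by apply: measurable_funX; exact: measurable_funB.
have m1 := measurable_dist2 mb; have m2 := measurable_dist2 mb'.
set m := (fun x => Num.min _ _)%R in Km.
have mm : measurable_fun setT (fun x => (f x - m x) ^+ 2)%R.
  by apply: measurable_dist2; case: Km.
have mE x : (m x = 2^-1 * b x + 2^-1 * b' x)%R.
  rewrite /m min_r; first by congr (_ * _ + _)%R; lra.
  by have /andP[? ?] := bf x; have /andP[? ?] := b'f x; lra.
have par : wint mu w (fun x => (b' x - b x) ^+ 2)%R + 4%:E * distance2 m =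
    2%:E * distance2 b + 2%:E * distance2 b'.
  have mc (c : R) y : measurable_fun setT y -> measurable_fun setT (fun x => c * y x)%R.
    by move=> my; exact: measurable_rmul.
  have pc (c : R) y x : (0 <= c)%R -> (0 <= c * y x ^+ 2)%R.
    by move=> c0; rewrite mulr_ge0// sqr_ge0.
  have sq y x : (0 <= y x ^+ 2)%R by exact: sqr_ge0.
  have p4 : (0 <= 4 :> R)%R by [].
  have p2 : (0 <= 2 :> R)%R by [].
  rewrite /distance2 -(wintZ mu pw mm (sq _) p4) -(wintZ mu pw m1 (sq _) p2) -(wintZ mu pw m2 (sq _) p2).
  have M4 : measurable_fun setT (fun x => 4 * (f x - m x) ^+ 2)%R := mc _ _ mm.
  have M1 : measurable_fun setT (fun x => 2 * (f x - b x) ^+ 2)%R := mc _ _ m1.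
  have M2 : measurable_fun setT (fun x => 2 * (f x - b' x) ^+ 2)%R := mc _ _ m2.
  have P4 x : (0 <= 4 * (f x - m x) ^+ 2)%R := pc _ (fun x => f x - m x)%R x p4.
  have P1 x : (0 <= 2 * (f x - b x) ^+ 2)%R := pc _ (fun x => f x - b x)%R x p2.
  have P2 x : (0 <= 2 * (f x - b' x) ^+ 2)%R := pc _ (fun x => f x - b' x)%R x p2.
  rewrite -(wintD mu pw mdd M4 (sq _) P4) -(wintD mu pw M1 M2 P1 P2).
  by congr (wint _ _); apply/funext => x; rewrite mE; field.
have := DK _ Km; move: par be b'e.
have := wint_ge0 mu pw (fun x => sqr_ge0 (b' x - b x)).
have := wint_ge0 mu pw (fun x => sqr_ge0 (f x - b x)).
have := wint_ge0 mu pw (fun x => sqr_ge0 (f x - b' x)).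
have := distance2_bound Km; rewrite -!/(distance2 _).
case: (wint _ _ _) => [x| |]//; case: (distance2 m) => [y| |]//;
case: (distance2 b) => [z| |]//; case: (distance2 b') => [t| |]//.
rewrite -!EFinM -!EFinD !lee_fin => _ _ _ _ [] *; lra.
Qed.

(** On A, |a| <= e + a^2 / e; outside A both functions vanish. The fourth power of e
    leaves enough for the quotient by e to be at most 4 e. *)
Lemma increment_abs_bound b b' (e : R) : competitor b -> competitor b' -> (0 < e)%R ->
  wint mu w (fun x => (b' x - b x) ^+ 2)%R <= (4 * e ^+ 4)%:E -> (e <= 1)%R ->
  wint mu w (fun x => `|b' x - b x|)%R <= (e * (s + 4))%:E.
Proof.
move=> Kb Kb' e0 h e1; have [mb bf Nb] := Kb; have [mb' b'f Nb'] := Kb'.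
have mdd : measurable_fun setT (fun x => (b' x - b x) ^+ 2)%R.
  by apply: measurable_funX; exact: measurable_funB.
have mabs : measurable_fun setT (fun x => `|b' x - b x|)%R.
  by apply: measurableT_comp => //; exact: measurable_funB.
apply: (@le_trans _ _ (wint mu w (fun x => e * \1_A x + e^-1 * (b' x - b x) ^+ 2)%R)).
  apply: wint_le => //.
    by apply: measurable_funD; exact: measurable_rmul.
  move=> x; rewrite indicE; case: (boolP (x \in A)) => xA.
    rewrite mulr1; set a := (b' x - b x)%R.
    rewrite -(ler_pM2l e0) mulrDr mulrA divff ?gt_eqF// mul1r.
    have : (0 <= (e - `|a|) ^+ 2)%R by exact: sqr_ge0.
    have : (0 <= e * `|a|)%R by rewrite mulr_ge0// ltW.
    rewrite -(real_normK (num_real a)); set y := `|a|%R; nra.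
  have Ax : ~ A x by move=> Ax; move/negP: xA; apply; rewrite inE.
  have [_ ->] := competitor_out Kb Ax; have [_ ->] := competitor_out Kb' Ax.
  by rewrite subrr normr0 mulr0 add0r expr0n mulr0.
rewrite (wintD mu pw); first last.
- by move=> x; rewrite mulr_ge0 ?sqr_ge0// invr_ge0 ltW.
- by move=> x; rewrite mulr_ge0 ?(ltW e0).
- exact: measurable_rmul.
- exact: measurable_rmul.
have ei0 : (0 <= e^-1)%R by rewrite invr_ge0 ltW.
have ind0 x : (0 <= \1_A x :> R)%R by [].
have dd0 x : (0 <= (b' x - b x) ^+ 2)%R by exact: sqr_ge0.
rewrite (wintZ mu pw mind ind0 (ltW e0)) (wintZ mu pw mdd dd0 ei0) wint_indic// sE mulrDr EFinD leeD//.
apply: (@le_trans _ _ (e^-1%:E * (4 * e ^+ 4)%:E)).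
  by apply: lee_wpmul2l => //; rewrite lee_fin invr_ge0 ltW.
rewrite -EFinM lee_fin.
rewrite [leLHS](_ : _ = e * 4 * e ^+ 2)%R; last by field; rewrite gt_eqF.
by rewrite -[leRHS]mulr1 ler_pM2l ?mulr_gt0// expr_le1// ltW.
Qed.

(** A minimising sequence converges rapidly: its increments have summable integrals.
    Its lower limit is a competitor by the Fatou property of N, and it falls below the
    k-th function by at most the tail T k, whose integral tends to 0; so it is no
    farther from f than the infimum. *)
Lemma exists_minimiser : exists b, competitor b /\
  forall b', competitor b' -> distance2 b <= distance2 b'.
Proof.
pose d0 := ereal_inf [set distance2 b | b in competitor].
have dist0 b : 0 <= distance2 b by apply: wint_ge0 => // x; exact: sqr_ge0.
have d00 : 0 <= d0 by apply: le_ereal_inf_tmp => _ [b _ <-].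
have dle b : competitor b -> d0 <= distance2 b.
  by move=> Kb; apply: ereal_inf_lbound; exists b.
have d0fin : d0 \is a fin_num.
  rewrite ge0_fin_numE//; apply: le_lt_trans (dle _ competitor0) _.
  by apply: le_lt_trans (distance2_bound competitor0) _; rewrite ltry.
pose D := fine d0; have DE : D%:E = d0 by rewrite fineK.
have D0 : (0 <= D)%R by exact: fine_ge0.
have DK b : competitor b -> D%:E <= distance2 b by rewrite DE; exact: dle.
have dk0 k := dyadic_gt0 (R := R) k.
have dk1 k : (dyadic k <= 1 :> R)%R.
  by rewrite /dyadic invf_le1 ?exprn_gt0// exprn_ege1// ler1n.
(* The fourth power is the one in the hypothesis of [increment_abs_bound]. *)
have ex k : exists b, competitor b /\ distance2 b <= (D + dyadic k ^+ 4)%:E.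
  have : d0 < (D + dyadic k ^+ 4)%:E by rewrite -DE lte_fin ltrDl exprn_gt0.
  by move=> /ereal_inf_lt[_ [b Kb <-] /ltW h]; exists b.
have [bs bsP] := choice ex.
have Kb k : competitor (bs k) by case: (bsP k).
have mb k : measurable_fun setT (bs k) by case: (Kb k).
have bs0 k x : (0 <= bs k x)%R by case: (Kb k) => _ /(_ x)/andP[].
have bsf k x : (bs k x <= f x)%R by case: (Kb k) => _ /(_ x)/andP[].
have incr k : wint mu w (fun x => `|bs k.+1 x - bs k x|)%R <= (dyadic k * (s + 4))%:E.
  apply: (increment_abs_bound (Kb k) (Kb k.+1)) => //.
  apply: (increment_bound (Kb k) (Kb k.+1) D0 DK); first by case: (bsP k).
  case: (bsP k.+1) => _ /le_trans; apply.
  rewrite lee_fin lerD2l lerXn2r ?nnegrE ?(ltW (dk0 _))//.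
  by rewrite (dyadicS k) ler_peMl ?(ltW (dk0 _))// ler1n.
pose u x j : \bar R := (bs j x)%:E.
pose b x := ereal_sup (range (einfs (u x))).
have einfs_cvg x : einfs (u x) @ \oo --> b x by exact: cvg_einfs_sup.
have einfs0 x k : 0 <= einfs (u x) k.
  by apply: le_ereal_inf_tmp => _ [j _ <-]; rewrite lee_fin.
have einfs_le x k : einfs (u x) k <= (bs k x)%:E.
  by apply: ereal_inf_lbound; exists k => //=.
have einfs_b x k : einfs (u x) k <= b x.
  by apply: ereal_sup_ubound; exists k.
have bf x : b x <= (f x)%:E.
  apply: (@cvge_to_le _ \oo _ R (einfs (u x))) => //.
  by apply: nearW => k; apply: le_trans (einfs_le x k) _; rewrite lee_fin.
have b0 x : 0 <= b x by exact: le_trans (einfs0 x 0%N) (einfs_b x 0%N).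
have bfin x : b x = (fine (b x))%:E.
  by rewrite fineK// ge0_fin_numE// (le_lt_trans (bf x))// ltry.
have meinfs k : measurable_fun setT (fun x => einfs (u x) k).
  apply: (@measurable_fun_einfs _ _ _ setT (fun j x => (bs j x)%:E)) => j.
  exact: measurable_efin.
have mbe : measurable_fun setT b.
  apply: (emeasurable_fun_cvg (fun k x => einfs (u x) k)) => [k|x _].
    exact: meinfs.
  exact: einfs_cvg.
pose br x := fine (b x).
have mbr : measurable_fun setT br.
  exact: (measurableT_comp (@fine_measurable R setT measurableT) mbe).
have Nle k : N (fun x => einfs (u x) k) <= 1.
  case: (Kb k) => _ _; apply: le_trans; apply: (fn_monotone HN) => //.
    exact: measurable_efin.
  apply: nearW => x /=; rewrite gee0_abs// ger0_norm//.
have Kbr : competitor br.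
  split => //.
    by move=> x; rewrite fine_ge0//= -lee_fin -bfin.
  rewrite (_ : EFin \o br = b); last by apply/funext => x /=; rewrite -bfin.
  apply: (@cvge_to_le _ \oo _ R (fun k => N (fun x => einfs (u x) k))); last first.
    by apply: nearW => k; exact: Nle.
  apply: (fn_fatou HN) => //; apply: nearW => x; split.
    move=> i j ij; rewrite !gee0_abs//; exact: nondecreasing_einfs.
  rewrite gee0_abs//; under eq_fun do rewrite gee0_abs//.
  exact: einfs_cvg.
pose dlt i x := (`|bs i.+1 x - bs i x|)%R.
have mdlt i : measurable_fun setT (dlt i).
  by apply: measurableT_comp => //; exact: measurable_funB.
pose T k x : \bar R := \sum_(i <oo) (dlt (k + i)%N x)%:E.
have dlt0 i x : (0 <= dlt i x)%R by exact: normr_ge0.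
have T0 k x : 0 <= T k x by apply: nneseries_ge0 => i _ _; rewrite lee_fin.
have mT k : measurable_fun setT (T k).
  apply: ge0_emeasurable_sum => [i x _ _|i _]; first by rewrite lee_fin.
  exact: measurable_efin.
have b_lower k x : (bs k x)%:E <= b x + T k x.
  apply: (@le_trans _ _ (einfs (u x) k + T k x)); last exact: leeD2r.
  have [Tfin|] := boolP (T k x \is a fin_num); last first.
    rewrite ge0_fin_numE// -leNgt leye_eq => /eqP ->.
    by rewrite addey ?leey// gt_eqF// (lt_le_trans _ (einfs0 x k))// ltNye.
  rewrite -leeBlDr//; apply: le_ereal_inf_tmp => _ [j /= kj <-].
  by rewrite leeBlDr// /u; have := telescope_le (fun i => bs i x) k (j - k); rewrite subnKC.
have fle x : (f x <= L)%R.
  apply: le_trans (fL x) _; rewrite indicE; case: (x \in A); rewrite ?mulr1// mulr0 ltW//.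
have pt k x : ((f x - br x) ^+ 2)%:E <= ((f x - bs k x) ^+ 2)%:E + (2 * L)%:E * T k x.
  have := b_lower k x; rewrite bfin -/(br x); have := T0 k x.
  case: (T k x) => [tau| |//]; last first.
    by move=> _ _; rewrite gt0_muley ?lte_fin ?mulr_gt0// addey// leey.
  rewrite -EFinM -!EFinD !lee_fin => tau0 h.
  have brf : (br x <= f x)%R by rewrite -lee_fin -bfin.
  have br0 : (0 <= br x)%R by exact: fine_ge0.
  have := bsf k x; have := bs0 k x; have := fle x => fl bk0 bkf.
  set X := (f x - br x)%R; set Y := (f x - bs k x)%R.
  have XY : (X <= Y + tau)%R by rewrite /X /Y; lra.
  have X0 : (0 <= X <= L)%R by rewrite /X; apply/andP; split; lra.
  have Y0 : (0 <= Y <= L)%R by rewrite /Y; apply/andP; split; lra.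
  case/andP: X0 => X0 XL; case/andP: Y0 => Y0 YL.
  have [h1|h1] := leP X Y.
    apply: (@le_trans _ _ (Y ^+ 2)%R); first by rewrite lerXn2r ?nnegrE.
    by rewrite lerDl !mulr_ge0// ltW.
  have : ((X - Y) * (X + Y) <= tau * (2 * L))%R.
    by apply: ler_pM; lra.
  by rewrite (_ : (X - Y) * (X + Y) = X ^+ 2 - Y ^+ 2)%R; [lra|ring].
have tail k : \int[mu]_x (T k x * (w x)%:E) <= (2 * dyadic k * (s + 4))%:E.
  have mTw i : measurable_fun setT (fun x => (dlt (k + i)%N x * w x)%:E).
    exact: measurable_wint.
  have Tw0 i x : 0 <= (dlt (k + i)%N x * w x)%:E by rewrite lee_fin mulr_ge0// ltW// pw.2.
  have -> : \int[mu]_x (T k x * (w x)%:E) = \int[mu]_x \sum_(i <oo) (dlt (k + i)%N x * w x)%:E.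
    apply: eq_integral => x _; rewrite muleC -nneseriesZl; last by move=> i _; rewrite lee_fin.
    by apply: eq_eseriesr => i _; rewrite muleC EFinM.
  rewrite integral_nneseries//.
  have s4 : (0 <= s + 4)%R by rewrite addr_ge0.
  apply: (@le_trans _ _ (\sum_(i <oo) (2 * dyadic k * (s + 4))%:E * (dyadic i)%:E)).
    apply: lee_nneseries => [i _ _|i _]; first by apply: integral_ge0 => x _; exact: Tw0.
    apply: le_trans (incr _) _; rewrite dyadicD -EFinM lee_fin le_eqVlt.
    by apply/orP; left; apply/eqP; ring.
  rewrite nneseriesZl; last by move=> i _; rewrite lee_fin ltW.
  rewrite -[leRHS]mule1 lee_wpmul2l ?sum_dyadic// lee_fin !mulr_ge0// ltW//.
have bound k : distance2 br <= (D + dyadic k * (1 + 4 * L * (s + 4)))%:E.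
  have mY := measurable_wint pw (measurable_dist2 (mb k)).
  have Y0 x : 0 <= ((f x - bs k x) ^+ 2 * w x)%:E by rewrite lee_fin mulr_ge0 ?sqr_ge0// ltW// pw.2.
  have mTw : measurable_fun setT (fun x => (2 * L)%:E * (T k x * (w x)%:E)).
    by apply: measurable_scale; apply: measurable_mul => //; exact: pos_weightE.
  have Tw0 x : 0 <= T k x * (w x)%:E by rewrite mule_ge0// lee_fin ltW// pw.2.
  have L2 : (0 <= 2 * L)%R by rewrite mulr_ge0// ltW.
  apply: (@le_trans _ _ (distance2 (bs k) + (2 * L)%:E * \int[mu]_x (T k x * (w x)%:E))).
    rewrite -ge0_integralZl//; last first.
      by apply: measurable_mul => //; exact: pos_weightE.
    rewrite /distance2 /wint -ge0_integralD//; last by move=> x _; rewrite mule_ge0// lee_fin.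
    apply: nn_le_integral => //.
    - by apply: measurable_wint => //; exact: measurable_dist2.
    - exact: measurable_add.
    - by move=> x; rewrite lee_fin mulr_ge0 ?sqr_ge0// ltW// pw.2.
    move=> x _; have w0 : 0 <= (w x)%:E by rewrite lee_fin ltW// pw.2.
    have := lee_wpmul2r w0 (pt k x); rewrite -EFinM => /le_trans; apply.
    rewrite ge0_muleDl ?lee_fin ?sqr_ge0// ?mule_ge0 ?lee_fin//.
    by rewrite -EFinM muleA.
  apply: (@le_trans _ _ ((D + dyadic k ^+ 4)%:E + (2 * L)%:E * (2 * dyadic k * (s + 4))%:E)).
    by apply: leeD; [case: (bsP k)|apply: lee_wpmul2l => //; rewrite lee_fin].
  rewrite -EFinM -EFinD lee_fin -addrA lerD2l.
  have : (dyadic k ^+ 4 <= dyadic k :> R)%R.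
    by rewrite exprS -[leRHS]mulr1 ler_pM2l// exprn_ile1// ltW.
  rewrite [X in (_ -> _ <= X)%R](_ : _ = dyadic k + 2 * L * (2 * dyadic k * (s + 4)))%R; last by ring.
  by rewrite lerD2r.
exists br; split => // b' Kb'; apply: le_trans (DK _ Kb').
pose C := (1 + 4 * L * (s + 4))%R.
have C0 : (0 < C)%R by rewrite ltr_pwDl// !mulr_ge0 ?addr_ge0// ltW.
apply/lee_addgt0Pr => e e0.
have [k ke] := dyadic_small (divr_gt0 e0 C0).
apply: le_trans (bound k) _; rewrite -EFinD lee_fin lerD2l -/C.
by rewrite -ler_pdivlMr.
Qed.

End minimiser.

Section duality.
Context d (E : measurableType d) (R : realType) (mu : {measure set E -> \bar R}).
Variable w : E -> R.
Hypothesis pw : pos_weight w.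
Variable N : (E -> \bar R) -> \bar R.
Hypothesis HN : function_norm mu N.
Variable F : nat -> set E.
Hypotheses (mF : forall k, measurable (F k)) (ndF : nondecreasing_seq F)
  (FT : \bigcup_k F k = setT) (wF : forall k, \int[mu]_(x in F k) (w x)%:E < +oo).

Let w0 x : (0 <= w x)%R := ltW (pw.2 x).

Lemma fn_eq f g : measurable_fun setT f -> measurable_fun setT g ->
  {ae mu, forall x, f x = g x} -> N f = N g.
Proof.
move=> mf mg fg; apply/eqP; rewrite eq_le; apply/andP; split; apply: (fn_monotone HN) => //;
  by apply: filterS fg => x ->.
Qed.

Lemma wF_fin k : exists2 s : R, (0 <= s)%R & \int[mu]_(x in F k) (w x)%:E = s%:E.
Proof.
have := wF k; have : 0 <= \int[mu]_(x in F k) (w x)%:E.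
  by apply: integral_ge0 => x _; rewrite lee_fin.
by case: integral => // s; rewrite lee_fin => s0 _; exists s.
Qed.

Section optimality.
Variables (j0 : nat) (f : E -> R) (L s : R).
Hypotheses (mf : measurable_fun setT f) (L0 : (0 < L)%R)
  (f0 : forall x, (0 <= f x)%R) (fL : forall x, (f x <= L * \1_(F j0) x)%R)
  (sE : \int[mu]_(x in F j0) (w x)%:E = s%:E).
Variable b : E -> R.
Hypotheses (Kb : competitor N f b)
  (bmin : forall b', competitor N f b' -> distance2 mu w f b <= distance2 mu w f b').

Let mb : measurable_fun setT b. Proof. by case: Kb. Qed.
Let b0 x : (0 <= b x)%R. Proof. by case: Kb => _ /(_ x)/andP[]. Qed.
Let bf x : (b x <= f x)%R. Proof. by case: Kb => _ /(_ x)/andP[]. Qed.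
Let g x := (f x - b x)%R.
Let g0 x : (0 <= g x)%R. Proof. by rewrite subr_ge0. Qed.
Let mg : measurable_fun setT g. Proof. exact: measurable_funB. Qed.

Lemma wint_fin (y : E -> R) (C : R) k : measurable_fun setT y -> (forall x, (0 <= y x)%R) ->
  (0 <= C)%R -> (forall x, (y x <= C * \1_(F k) x)%R) ->
  exists2 a : R, (0 <= a)%R & wint mu w y = a%:E.
Proof.
move=> my y0 C0 yC; have [t t0 tE] := wF_fin k.
have := wint_bounded pw (mF k) tE my y0 C0 yC.
have := wint_ge0 mu pw y0.
by case: wint => // a; rewrite lee_fin => a0 _; exists a.
Qed.

(** With g = f - b, moving b towards z by the fraction t increases the squared
    distance to f by at most 2 t (int g b - int g z) + O(t^2). The increase is
    nonnegative at a minimiser, and t tends to 0. *)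
Lemma minimiser_variation_bounded (z : E -> R) (C : R) k : measurable_fun setT z ->
  (forall x, (0 <= z x)%R) -> (0 <= C)%R -> (forall x, (z x <= C * \1_(F k) x)%R) ->
  N (EFin \o z) <= 1 ->
  wint mu w (fun x => g x * z x)%R <= wint mu w (fun x => g x * b x)%R.
Proof.
move=> mz z0 C0 zC Nz.
have fLc x : (f x <= L)%R.
  apply: le_trans (fL x) _; rewrite indicE; case: (_ \in _); rewrite ?mulr1// mulr0 ltW//.
have fN x : ~ F j0 x -> f x = 0%R.
  move=> Fx; apply/eqP; rewrite eq_le f0 andbT; apply: le_trans (fL x) _.
  by rewrite indicE memNset// mulr0.
have gL x : (g x <= L)%R by have := b0 x; have := fLc x; rewrite /g; lra.
have bL x : (b x <= L)%R by have := bf x; have := fLc x; lra.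
have L20 : (0 <= L * L)%R by rewrite mulr_ge0// ltW.
have gN x : ~ F j0 x -> g x = 0%R.
  by move=> /fN fx; have := bf x; have := b0 x; rewrite /g fx; lra.
have bN x : ~ F j0 x -> b x = 0%R.
  by move=> /fN fx; have := bf x; have := b0 x; rewrite fx; lra.
have bnd (y1 y2 : E -> R) : (forall x, (0 <= y1 x <= L)%R) -> (forall x, (0 <= y2 x <= L)%R) ->
    (forall x, ~ F j0 x -> y1 x = 0%R) ->
    forall x, (y1 x * y2 x <= L * L * \1_(F j0) x)%R.
  move=> h1 h2 h3 x; rewrite indicE; case: (boolP (x \in F j0)) => xF.
    by rewrite mulr1; have /andP[? ?] := h1 x; have /andP[? ?] := h2 x; apply: ler_pM.
  by rewrite h3 ?mul0r ?mulr0// => Fx; move/negP : xF; apply; rewrite inE.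
have gb1 x : (0 <= g x <= L)%R by rewrite g0 gL.
have bb1 x : (0 <= b x <= L)%R by rewrite b0 bL.
have mgb : measurable_fun setT (fun x => g x * b x)%R by exact: measurable_rmul.
have mgz : measurable_fun setT (fun x => g x * z x)%R by exact: measurable_rmul.
have mbb : measurable_fun setT (fun x => b x * b x)%R by exact: measurable_rmul.
have mzz : measurable_fun setT (fun x => z x * z x)%R by exact: measurable_rmul.
have mgg : measurable_fun setT (fun x => g x * g x)%R by exact: measurable_rmul.
have p2 (y1 y2 : E -> R) : (forall x, (0 <= y1 x)%R) -> (forall x, (0 <= y2 x)%R) ->
    forall x, (0 <= y1 x * y2 x)%R by move=> h1 h2 x; rewrite mulr_ge0.
have mc (a : R) (y : E -> R) : measurable_fun setT y -> measurable_fun setT (fun x => a * y x)%R.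
  by move=> my; apply: measurable_rmul => //; exact: measurable_cst.
have [G G0 GE] := wint_fin mgg (p2 _ _ g0 g0) L20 (bnd _ _ gb1 gb1 gN).
have [H H0 HE] := wint_fin mgb (p2 _ _ g0 b0) L20 (bnd _ _ gb1 bb1 gN).
have [I I0 IE] := wint_fin mbb (p2 _ _ b0 b0) L20 (bnd _ _ bb1 bb1 bN).
have [J J0 JE] : exists2 a : R, (0 <= a)%R & wint mu w (fun x => z x * z x)%R = a%:E.
  apply: (@wint_fin _ (C * C) k) => //; [exact: p2|by rewrite mulr_ge0|].
  move=> x; have := zC x; rewrite indicE; case: (x \in F k); rewrite ?mulr1 ?mulr0 => zx.
    exact: ler_pM.
  have -> : z x = 0%R by apply/eqP; rewrite eq_le zx z0.
  by rewrite mul0r.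
set X := wint mu w _; rewrite HE.
apply/lee_addgt0Pr => e e0.
(* I + J bounds the coefficient of t^2, so this t makes that term at most t e. *)
pose t := Num.min 1%R (e / (I + J + 1))%R.
have IJ : (0 < I + J + 1)%R by rewrite ltr_wpDl// addr_ge0.
have t0 : (0 < t)%R by rewrite lt_min ltr01 divr_gt0.
have t1 : (t <= 1)%R by rewrite ge_min lexx.
have te : (t * (I + J) <= e)%R.
  apply: (@le_trans _ _ (t * (I + J + 1))%R); first by rewrite ler_pM2l// lerDl.
  by rewrite -ler_pdivlMr// ge_min lexx orbT.
have t01 : (0 <= t <= 1)%R by rewrite (ltW t0).
have Nb : N (EFin \o b) <= 1 by case: Kb.
have := bmin (competitor_mix HN mf f0 t01 mb mz b0 z0 Nb Nz).
set bt := (fun x => Num.min _ _)%R.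
have mbt : measurable_fun setT bt.
  apply: measurable_minr => //; apply: measurable_funD; exact: mc.
rewrite {1}/distance2 (_ : wint mu w (fun x => (f x - b x) ^+ 2)%R = G%:E); last first.
  by rewrite -GE; congr wint; apply/funext => x; rewrite expr2.
move=> Gle.
have mdt := measurable_dist2 mf mbt.
have tz0 : (0 <= 2 * t)%R by rewrite mulr_ge0// ltW.
have tt0 : (0 <= t * t)%R by rewrite mulr_ge0// ltW.
have pc (a : R) (y : E -> R) : (0 <= a)%R -> (forall x, (0 <= y x)%R) -> forall x, (0 <= a * y x)%R.
  by move=> a0 y0 x; rewrite mulr_ge0.
have key : distance2 mu w f bt + (2 * t)%:E * X <=
    G%:E + (2 * t)%:E * H%:E + ((t * t)%:E * I%:E + (t * t)%:E * J%:E).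
  rewrite /X -GE -HE -IE -JE /distance2.
  rewrite -(wintZ mu pw mgz (p2 _ _ g0 z0) tz0) -(wintZ mu pw mgb (p2 _ _ g0 b0) tz0).
  rewrite -(wintZ mu pw mbb (p2 _ _ b0 b0) tt0) -(wintZ mu pw mzz (p2 _ _ z0 z0) tt0).
  have M1 := mc (2 * t)%R _ mgz; have P1 := pc (2 * t)%R _ tz0 (p2 _ _ g0 z0).
  have M2 := mc (2 * t)%R _ mgb; have P2 := pc (2 * t)%R _ tz0 (p2 _ _ g0 b0).
  have M3 := mc (t * t)%R _ mbb; have P3 := pc (t * t)%R _ tt0 (p2 _ _ b0 b0).
  have M4 := mc (t * t)%R _ mzz; have P4 := pc (t * t)%R _ tt0 (p2 _ _ z0 z0).
  rewrite -(wintD mu pw mdt M1 (fun x => sqr_ge0 _) P1).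
  rewrite -(wintD mu pw mgg M2 (p2 _ _ g0 g0) P2) -(wintD mu pw M3 M4 P3 P4).
  rewrite -(wintD mu pw); first last.
  - by move=> x; rewrite addr_ge0.
  - by move=> x; rewrite addr_ge0// p2.
  - exact: measurable_funD.
  - exact: measurable_funD.
  apply: wint_le => //.
  - exact: measurable_funD.
  - by apply: measurable_funD; exact: measurable_funD.
  - by move=> x; rewrite addr_ge0// sqr_ge0.
  move=> x; rewrite /bt /g.
  have bz : (0 <= t * t * (b x * z x))%R by rewrite mulr_ge0 ?p2.
  (* The minimum with f in the competitor only brings it closer to f. *)
  have [h|h] := leP (f x) ((1 - t) * b x + t * z x)%R.
    rewrite subrr expr0n/= add0r -subr_ge0.
    rewrite [leRHS](_ : _ = (f x - b x + t * b x - t * z x) ^+ 2 + 2 * (t * t * (b x * z x)))%R; last by ring.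
    by rewrite addr_ge0 ?sqr_ge0// mulr_ge0.
  rewrite -subr_ge0 [leRHS](_ : _ = 2 * (t * t * (b x * z x)))%R; last by ring.
  by rewrite mulr_ge0.
have : G%:E + (2 * t)%:E * X <= G%:E + (2 * t)%:E * H%:E + ((t * t)%:E * I%:E + (t * t)%:E * J%:E).
  by apply: le_trans key; exact: leeD2r.
have X0 : 0 <= X by apply: wint_ge0 => //; exact: p2.
move: {key} X X0 => [X| |//] X0; last first.
  by rewrite gt0_muley ?lte_fin ?mulr_gt0// addey.
rewrite -!EFinM -!EFinD !lee_fin => h.
have : (2 * t * X <= t * (2 * H + t * (I + J)))%R by lra.
rewrite mulrAC mulrC ler_pM2l// => h2; lra.
Qed.

Lemma minimiser_variation (z : E -> \bar R) : measurable_fun setT z -> N z <= 1 ->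
  \int[mu]_x (`|z x| * (g x * w x)%:E) <= wint mu w (fun x => g x * b x)%R.
Proof.
move=> mz Nz.
have mabs : measurable_fun setT (fun x => `|z x|) by exact: measurable_abs.
apply: (integral_le_trunc mF ndF FT mabs) => //.
- exact: measurable_rmul mg pw.1.
- by move=> x; rewrite mulr_ge0.
move=> j; pose y x := fine (trunc F j (fun x => `|z x|) x).
have tE x : trunc F j (fun x => `|z x|) x = (y x)%:E.
  rewrite fineK// ge0_fin_numE; last exact: trunc_ge0.
  by apply: le_lt_trans (trunc_bound F j (abse_ge0 (z x))) _; rewrite -EFinM ltry.
have y0 x : (0 <= y x)%R by apply: fine_ge0; exact: trunc_ge0.
have my : measurable_fun setT y.
  apply: (measurableT_comp (@fine_measurable R setT measurableT)).
  exact: measurable_trunc.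
have yb x : (y x <= j%:R * \1_(F j) x)%R.
  by rewrite -lee_fin -tE EFinM; exact: trunc_bound.
apply: le_trans (minimiser_variation_bounded my y0 (ler0n _ j) yb _).
  rewrite /wint le_eqVlt; apply/orP; left; apply/eqP; apply: eq_integral => x _.
  by rewrite tE -EFinM mulrCA mulrA.
apply: le_trans Nz; apply: (fn_monotone HN) => //; first exact: measurable_efin.
apply: nearW => x; rewrite /= ger0_norm// -tE.
exact: trunc_le.
Qed.

End optimality.

(** Lorentz-Luxemburg duality. With y a truncation of f of norm greater than 1 and b
    its projection onto the unit ball, g = y - b does not vanish, since b has norm at
    most 1. Write H and G for the integrals of g b w and g^2 w. The pairing of g with
    the unit ball is at most H by the first variation, and its pairing with y is
    H + G > H. So g divided by c = H + G / 2, which is positive even if H = 0, separates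
    f from the unit ball. *)
Lemma associate_witness (f : E -> \bar R) : measurable_fun setT f -> (forall x, 0 <= f x) ->
  1 < N f -> exists h : E -> R, [/\ measurable_fun setT h, forall x, (0 <= h x)%R,
    forall z, measurable_fun setT z -> N z <= 1 -> \int[mu]_x (`|z x| * (h x * w x)%:E) <= 1 &
    1 < \int[mu]_x (f x * (h x * w x)%:E)].
Proof.
move=> mf f0 Nf.
have [j Nj] : exists j, 1 < N (trunc F j f).
  apply: contrapT => /forallNP h; move: Nf; rewrite ltNge => /negP; apply.
  apply: (@cvge_to_le _ \oo _ R (fun j => N (trunc F j f))); last first.
    by apply: nearW => j; rewrite leNgt; exact/negP/h.
  apply: (fn_fatou HN) => //; first by move=> j; exact: measurable_trunc.
  apply: nearW => x; split.
    by move=> i k ik; rewrite !gee0_abs ?trunc_ge0//; exact: trunc_nd.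
  rewrite gee0_abs//; under eq_fun do rewrite gee0_abs ?trunc_ge0//.
  exact: trunc_cvg.
pose y x := fine (trunc F j f x).
have tE x : trunc F j f x = (y x)%:E.
  rewrite fineK// ge0_fin_numE; last exact: trunc_ge0.
  by apply: le_lt_trans (trunc_bound F j (f0 x)) _; rewrite -EFinM ltry.
have y0 x : (0 <= y x)%R by apply: fine_ge0; exact: trunc_ge0.
have my : measurable_fun setT y.
  apply: (measurableT_comp (@fine_measurable R setT measurableT)).
  exact: measurable_trunc.
have yb x : (y x <= (j%:R + 1) * \1_(F j) x)%R.
  apply: (@le_trans _ _ (j%:R * \1_(F j) x)%R).
    by rewrite -lee_fin -tE EFinM; exact: trunc_bound.
  by rewrite ler_wpM2r// lerDl.
have L0 : (0 < j%:R + 1 :> R)%R by rewrite ltr_wpDl.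
have [s s0 sE] := wF_fin j.
have [b [Kb bmin]] := exists_minimiser pw HN (mF j) my L0 y0 yb sE.
have [mb bb Nb] := Kb.
pose g x := (y x - b x)%R.
have g0 x : (0 <= g x)%R by rewrite subr_ge0; case/andP: (bb x).
have b0 x : (0 <= b x)%R by case/andP: (bb x).
have mg : measurable_fun setT g by exact: measurable_funB.
have var := minimiser_variation my L0 y0 yb Kb bmin.
have mgb : measurable_fun setT (fun x => g x * b x)%R by exact: measurable_rmul.
have mgg : measurable_fun setT (fun x => g x * g x)%R by exact: measurable_rmul.
have gb0 x : (0 <= g x * b x)%R by rewrite mulr_ge0.
have gg0 x : (0 <= g x * g x)%R by rewrite mulr_ge0.
have bnd (z : E -> R) x : (0 <= z x)%R -> (z x <= y x)%R ->
    (g x * z x <= (j%:R + 1) * (j%:R + 1) * \1_(F j) x)%R.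
  move=> z0 zy; have gy : (g x <= y x)%R by have := b0 x; rewrite /g; lra.
  have := yb x; rewrite indicE; case: (x \in F j); rewrite ?mulr1 ?mulr0 => h.
    by apply: ler_pM => //; [exact: le_trans gy h|exact: le_trans zy h].
  have -> : z x = 0%R by apply/eqP; rewrite eq_le z0 andbT (le_trans zy).
  by rewrite mulr0.
have LL : (0 <= (j%:R + 1) * (j%:R + 1) :> R)%R by rewrite mulr_ge0// ltW.
have [H H0 HE] : exists2 a : R, (0 <= a)%R & wint mu w (fun x => g x * b x)%R = a%:E.
  by apply: (wint_fin mgb gb0 LL) => x; apply: bnd => //; case/andP: (bb x).
have [G G0 GE] : exists2 a : R, (0 <= a)%R & wint mu w (fun x => g x * g x)%R = a%:E.
  apply: (wint_fin mgg gg0 LL) => x; apply: bnd => //.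
  by have := b0 x; rewrite /g; lra.
have Gpos : (0 < G)%R.
  rewrite lt_neqAle G0 andbT eq_sym; apply/eqP => GZ.
  have aeg : {ae mu, forall x, (g x * g x = 0)%R}.
    by apply: wint_eq0 pw _ mgg gg0 _; rewrite GE GZ.
  move: Nj; rewrite ltNge => /negP; apply; rewrite (_ : N _ = N (EFin \o b))//.
  apply: fn_eq; [exact: measurable_trunc|exact: measurable_efin|].
  apply: filterS aeg => x /eqP; rewrite mulf_eq0 orbb tE /= => /eqP gx.
  by congr EFin; move: gx; rewrite /g; lra.
pose c := (H + G / 2)%R.
have c0 : (0 < c)%R by rewrite ltr_wpDl// divr_gt0.
have ci0 : (0 <= c^-1)%R by rewrite invr_ge0 ltW.
exists (fun x => c^-1 * g x)%R; split.
- by apply: measurable_rmul => //; exact: measurable_cst.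
- by move=> x; rewrite mulr_ge0.
- move=> z mz Nz.
  have mzg : measurable_fun setT (fun x => `|z x| * (g x * w x)%:E).
    apply: measurable_mul; first exact: measurable_abs.
    by apply: measurable_efin; exact: measurable_rmul mg pw.1.
  rewrite (_ : \int[mu]_x _ = (c^-1)%:E * \int[mu]_x (`|z x| * (g x * w x)%:E)); last first.
    rewrite -ge0_integralZl//.
    - by apply: eq_integral => x _; rewrite muleCA -EFinM mulrA.
    - by move=> x _; rewrite mule_ge0// lee_fin mulr_ge0.
  rewrite lee_pdivrMl// mule1; apply: le_trans (var _ mz Nz) _.
  by rewrite HE lee_fin /c lerDl divr_ge0// ltW.
apply: (@lt_le_trans _ _ (wint mu w (fun x => c^-1 * (g x * b x + g x * g x))%R)).
  have mS : measurable_fun setT (fun x => g x * b x + g x * g x)%R by exact: measurable_funD.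
  rewrite (wintZ mu pw mS) ?(wintD mu pw)//; last by move=> x; rewrite addr_ge0.
  rewrite HE GE -EFinD -EFinM lte_fin mulrC ltr_pdivlMr// mul1r /c ltrD2l.
  by rewrite ltr_pdivrMr// ltr_pMr// ltr1n.
rewrite /wint; apply: nn_le_integral => //.
- apply: measurable_wint => //; apply: measurable_rmul; first exact: measurable_cst.
  exact: measurable_funD.
- apply: measurable_mul => //; apply: measurable_efin; apply: measurable_rmul pw.1.
  by apply: measurable_rmul => //; exact: measurable_cst.
- by move=> x; rewrite lee_fin !mulr_ge0// addr_ge0.
move=> x _; apply: (@le_trans _ _ ((y x)%:E * (c^-1 * g x * w x)%:E)).
  by rewrite -EFinM lee_fin /g le_eqVlt; apply/orP; left; apply/eqP; ring.
apply: lee_wpmul2r; first by rewrite lee_fin !mulr_ge0.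
by rewrite -tE; exact: trunc_le.
Qed.

End duality.

(** * Extrapolation to function norms *)

Section function_norm_extrapolation.
Context d (E : measurableType d) (R : realType) (mu : {measure set E -> \bar R}).
Variables (B : set (set E)) (dil : set E -> set E) (c : R).
Hypothesis hB : cube_basis mu B dil c.
Hypothesis c0 : (0 < c)%R.
Variables (N : (E -> \bar R) -> \bar R) (u v : E -> R) (r K th : R).
Hypotheses (HN : function_norm mu N) (pu : pos_weight u) (pv : pos_weight v)
  (r1 : (1 < r)%R) (K0 : (0 < K)%R) (Apv : Ap_over mu B r K v)
  (N_indic : forall Q, B Q -> N (fun x => (\1_Q x)%:E) < +oo) (th0 : (0 < th)%R).

(** The unit ball of b |-> ||b / u|| in the associate space of N over v dmu. *)
Definition associate_ball : set (E -> \bar R) := [set b |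
  [/\ measurable_fun setT b, forall x, 0 <= b x &
   forall z, measurable_fun setT z -> N z <= 1 ->
     \int[mu]_x (`|z x| * (b x * (v x / u x)%:E)) <= 1]].

Hypothesis ball_max : forall b, associate_ball b ->
  associate_ball (fun x => th%:E * basis_maximal mu B (EFin \o v) b x).

Let q x := (v x / u x)%R.
Let q0 x : (0 < q x)%R. Proof. by rewrite divr_gt0 ?pu.2 ?pv.2. Qed.
Let mq : measurable_fun setT (fun x => (q x)%:E).
Proof. exact: pos_weightE (pos_weight_div pv pu). Qed.

Let mzb (z b : E -> \bar R) : measurable_fun setT z -> measurable_fun setT b ->
  measurable_fun setT (fun x => `|z x| * (b x * (q x)%:E)).
Proof.
move=> mz mb; apply: measurable_mul; first exact: measurable_abs.
by apply: measurable_mul => //; exact: mq.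
Qed.

Let pzb (z b : E -> \bar R) x : 0 <= b x -> 0 <= `|z x| * (b x * (q x)%:E).
Proof. by move=> b0; rewrite !mule_ge0// lee_fin ltW. Qed.

Lemma associate_ball_series (b : nat -> E -> \bar R) : (forall k, associate_ball (b k)) ->
  associate_ball (fun x => \sum_(k <oo) (dyadic k)%:E * b k x).
Proof.
move=> Sb.
have b0 k x : 0 <= b k x by case: (Sb k).
have mb k : measurable_fun setT (b k) by case: (Sb k).
have d0 k : 0 <= (dyadic k : R)%:E by rewrite lee_fin ltW// dyadic_gt0.
split.
- apply: ge0_emeasurable_sum => [k x _ _|k _]; first exact: mule_ge0.
  exact: measurable_scale.
- by move=> x; apply: nneseries_ge0 => k _ _; exact: mule_ge0.
move=> z mz Nz.
have mt k : measurable_fun setT (fun x => (dyadic k : R)%:E * (`|z x| * (b k x * (q x)%:E))).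
  by apply: measurable_scale; exact: mzb.
have t0 k x : 0 <= (dyadic k : R)%:E * (`|z x| * (b k x * (q x)%:E)).
  by rewrite mule_ge0// pzb.
apply: (@le_trans _ _ (\int[mu]_x \sum_(k <oo) ((dyadic k)%:E * (`|z x| * (b k x * (q x)%:E))))).
  apply: nn_le_integral => //.
  - apply: mzb => //; apply: ge0_emeasurable_sum => [k x _ _|k _]; first exact: mule_ge0.
    exact: measurable_scale.
  - by apply: ge0_emeasurable_sum => // k x _ _.
  - move=> x; apply: (@pzb z (fun y => \sum_(k <oo) (dyadic k)%:E * b k y) x).
    by apply: nneseries_ge0 => k _ _; exact: mule_ge0.
  move=> x _; case zx : (`|z x|) => [a| |].
  - have a0 : (0 <= a)%R by have := abse_ge0 (z x); rewrite zx lee_fin.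
    rewrite muleCA -EFinM muleC -nneseriesZl; last by move=> k _; rewrite mule_ge0.
    apply: lee_nneseries => [k _ _|k _].
      by apply: mule_ge0; [rewrite lee_fin mulr_ge0// (ltW (q0 x))|exact: mule_ge0].
    by rewrite muleCA EFinM -muleA [X in _ * (_ * X) <= _]muleC.
  - set S := \sum_(k <oo) _ * b k x.
    have [->|Sn0] := eqVneq S 0.
      by rewrite mul0e mule0; apply: nneseries_ge0 => k _ _; rewrite -zx; exact: t0.
    have [k bk0] : exists k, 0 < b k x.
      apply: contrapT => /forallNP h; move/eqP : Sn0; apply.
      apply: eseries0 => k _ _.
      by have := h k; rewrite lt_neqAle b0 andbT => /negP/negPn/eqP <-; rewrite mule0.
    rewrite [leRHS](_ : _ = +oo) ?leey//; apply/eqP; rewrite -leye_eq -zx.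
    apply: le_trans (series_term_le k (t0^~ x)); rewrite zx.
    by rewrite gt0_mulye ?mule_gt0 ?lte_fin// gt0_muley// lte_fin dyadic_gt0.
  - by have := abse_ge0 (z x); rewrite zx.
rewrite integral_nneseries//.
apply: (@le_trans _ _ (\sum_(k <oo) (dyadic k)%:E)); last exact: sum_dyadic.
apply: lee_nneseries => [k _ _|k _]; first by apply: integral_ge0 => x _; exact: t0.
rewrite ge0_integralZl//; [|exact: mzb|by move=> x _; exact: pzb].
by rewrite -[leRHS]mule1 lee_wpmul2l//; case: (Sb k) => _ _; apply.
Qed.

Lemma N_scale_le1 (z : E -> \bar R) (a : R) : measurable_fun setT z -> (0 < a)%R -> N z <= a%:E ->
  N (fun x => (a^-1)%:E * z x) <= 1.
Proof.
move=> mz a0 Nz; rewrite (fn_homogeneous HN)// gee0_abs ?lee_fin ?invr_ge0 ?(ltW a0)//.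
by rewrite lee_pdivrMl// mule1.
Qed.

(** An element of the associate space is integrable on each basis set, being paired
    with a multiple of its indicator function. *)
Lemma associate_ball_finite b : associate_ball b -> {ae mu, forall x, b x < +oo}.
Proof.
move=> [mb b0 hb]; apply: (basis_ae hB) => Q BQ; have mQ := basis_measurable hB BQ.
have mi : measurable_fun setT (fun x => (\1_Q x)%:E : \bar R) by exact: measurable_eindic.
have [a a0 Na] : exists2 a : R, (0 < a)%R & N (fun x => (\1_Q x)%:E) <= a%:E.
  have := N_indic BQ; case: (N _) => [a _| //|_]; last by exists 1%R => //; rewrite leNye.
  exists (Num.max a 1)%R; first by rewrite lt_max ltr01 orbT.
  by rewrite lee_fin le_max lexx.
have mz : measurable_fun setT (fun x => (a^-1)%:E * (\1_Q x)%:E) by exact: measurable_scale.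
have := hb _ mz (N_scale_le1 mi a0 Na) => h.
have /ae_lty_integral : \int[mu]_x (`|(a^-1)%:E * (\1_Q x)%:E| * (b x * (q x)%:E)) < +oo.
  by apply: le_lt_trans h _; rewrite ltry.
move=> h'; apply: filterS (h' _ _) => [x hx Qx||]; last 2 first.
- exact: (mzb mz mb).
- by move=> x; exact: (@pzb (fun x => (a^-1)%:E * (\1_Q x)%:E) b x).
move: hx; rewrite indicE mem_set// mule1 !ltey; apply: contra => /eqP ->.
rewrite gt0_mulye ?lte_fin// gt0_muley// gee0_abs ?lee_fin ?invr_ge0 ?(ltW a0)//.
by rewrite lte_fin invr_gt0.
Qed.

(** Let a > 0 be at least the norm of g^p u. If the norm of f^p u exceeded 2 C1 a,
    then some h of the associate unit ball would pair to more than 1 with the quotient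
    T' of f^p u by 2 C1 a. The algorithm replaces h u by an A_1(v) weight z, and the
    weighted inequality for the weight z v bounds that pairing by 1. *)
Lemma function_norm_extrapolation (F : set ((E -> \bar R) * (E -> \bar R))) (p0 p : R) :
  nonneg_pairs F -> (0 < p0)%R -> (0 < p)%R -> weighted_bound mu B F p0 ->
  exists2 C : R, (0 < C)%R & forall f g, F (f, g) ->
    N (fun x => f x `^ p * (u x)%:E) <= C%:E * N (fun x => g x `^ p * (u x)%:E).
Proof.
move=> F_pairs p00 p_gt0 H0.
have H := weighted_bound_all hB c0 F_pairs p00 p_gt0 H0.
pose k := (2 / th)%R; have k0 : (0 < k)%R by rewrite divr_gt0.
have kK : (0 < k * K)%R by rewrite mulr_gt0.
have [C1 C10 H1] := H _ _ r1 kK.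
have C20 : (0 < 2 * C1)%R by rewrite mulr_gt0.
exists (2 * C1)%R => // f g Ffg; have [mf mg f0 g0] := F_pairs _ _ Ffg.
set NS := N (fun x => g x `^ p * (u x)%:E).
have mT (y : E -> \bar R) : measurable_fun setT y -> measurable_fun setT (fun x => y x `^ p * (u x)%:E).
  by move=> my; exact: measurable_weighted_power.
have T0 (y : E -> \bar R) x : 0 <= y x `^ p * (u x)%:E by exact: weighted_power_ge0.
have main (a : R) : (0 < a)%R -> NS <= a%:E ->
    N (fun x => f x `^ p * (u x)%:E) <= (2 * C1 * a)%:E.
  move=> a0 NSa; rewrite leNgt; apply/negP => Nbig.
  have ca0 : (0 < 2 * C1 * a)%R by rewrite mulr_gt0.
  pose T' x := ((2 * C1 * a)^-1)%:E * (f x `^ p * (u x)%:E).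
  have mT' : measurable_fun setT T' by apply: measurable_scale; exact: mT.
  have T'0 x : 0 <= T' x by rewrite mule_ge0// lee_fin invr_ge0 ltW.
  have NT' : 1 < N T'.
    rewrite (fn_homogeneous HN); last exact: mT.
    rewrite gee0_abs ?lee_fin ?invr_ge0 ?(ltW ca0)//.
    by rewrite lte_pdivlMl// mule1.
  have [Fn [BF ndF FT]] := basis_exhaust hB.
  have lv := Ap_over_locally_finite Apv.
  have [h [mh h0 hz hT]] := associate_witness pv HN
    (fun k => basis_measurable hB (BF k)) ndF FT (fun k => lv _ (BF k)) mT' T'0 NT'.
  pose b x : \bar R := (h x * u x)%:E.
  have mb : measurable_fun setT b by apply: measurable_efin; exact: measurable_rmul mh pu.1.
  have Sb : associate_ball b.
    split => //.
      by move=> x; rewrite lee_fin mulr_ge0// ltW// pu.2.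
    move=> z mz Nz; apply: le_trans (hz z mz Nz).
    rewrite le_eqVlt; apply/orP; left; apply/eqP; apply: eq_integral => x _.
    rewrite /b -EFinM; congr (_ * _%:E); rewrite mulrACA [(u x * _)%R]mulrC.
    by have := pu.2 x => ux; field; rewrite gt_eqF.
  have bN0 : ~ {ae mu, forall x, b x = 0}.
    move=> bae; move: hT; rewrite (_ : \int[mu]_x _ = 0) ?ltNge ?lee01//.
    rewrite -(integral0 mu setT); apply: ae_eq_integral => //.
      apply: measurable_mul => //; apply: measurable_efin; exact: measurable_rmul mh pv.1.
    apply: filterS bae => x [/eqP]; rewrite mulf_eq0 (gt_eqF (pu.2 x)) orbF => /eqP ->.
    by rewrite mul0r mule0.
  have Smeas b' : associate_ball b' -> measurable_fun setT b' /\ forall x, 0 <= b' x by move=> [].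
  have [G [z [[mG G0 SG] Gz A1 bG]]] := rubio_de_francia hB pv lv th0 Smeas
    ball_max associate_ball_series associate_ball_finite Sb bN0.
  have pz := A1.1; have pzv := pos_weight_mul pz pv.
  have Apz := Ap_over_A1_mul hB r1 k0 pv Apv A1.
  have Hz := H1 _ pzv Apz _ _ Ffg.
  have mpz (y : E -> \bar R) : measurable_fun setT y -> measurable_fun setT (fun x => y x `^ p * (z x * v x)%:E).
    by move=> my; exact: (measurable_weighted_power p my pzv).
  have ppz (y : E -> \bar R) x : 0 <= y x `^ p * (z x * v x)%:E.
    exact: (weighted_power_ge0 y p x pzv).
  have le1 : \int[mu]_x (T' x * (h x * v x)%:E) <=
     (C1 * a)^-1%:E * \int[mu]_x (f x `^ p * (z x * v x)%:E).
    rewrite -ge0_integralZl//; last 2 first.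
    - exact: mpz.
    - by rewrite lee_fin invr_ge0 mulr_ge0// ltW.
    have Ca : (0 <= (C1 * a)^-1)%R by rewrite invr_ge0 mulr_ge0// ltW.
    apply: nn_le_integral_ae => //.
    - apply: measurable_mul => //; apply: measurable_efin; exact: measurable_rmul mh pv.1.
    - by apply: measurable_scale; exact: mpz.
    - by move=> x; rewrite mule_ge0// lee_fin mulr_ge0// ltW// pv.2.
    - by move=> x; rewrite mule_ge0.
    apply: filterS Gz => x Gx _.
    have hz2 : (h x * u x <= 2 * z x)%R.
      by have := bG x; rewrite /b Gx -EFinM lee_fin.
    rewrite /T'; apply: (@le_trans _ _ (f x `^ p * ((2 * C1 * a)^-1 * (h x * u x) * v x)%:E)).
      rewrite -muleA muleCA -!muleA; apply: lee_wpmul2l; first exact: poweR_ge0.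
      rewrite -!EFinM lee_fin le_eqVlt; apply/orP; left; apply/eqP; ring.
    rewrite [leRHS]muleCA; apply: lee_wpmul2l; first exact: poweR_ge0.
    rewrite -EFinM lee_fin [leRHS]mulrA ler_pM2r ?pv.2//.
    rewrite (_ : (C1 * a)^-1 * z x = (2 * C1 * a)^-1 * (2 * z x))%R.
      by rewrite ler_pM2l ?invr_gt0.
    by field; rewrite !gt_eqF.
  have le2 : \int[mu]_x (g x `^ p * (z x * v x)%:E) <= a%:E.
    pose S' x := (a^-1)%:E * (g x `^ p * (u x)%:E).
    have mS' : measurable_fun setT S' by apply: measurable_scale; exact: mT.
    have := SG _ mS' (N_scale_le1 (mT _ mg) a0 NSa).
    have -> : \int[mu]_x (`|S' x| * (G x * (q x)%:E)) =
       (a^-1)%:E * \int[mu]_x (g x `^ p * (z x * v x)%:E).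
      rewrite -ge0_integralZl//; last 2 first.
      - exact: mpz.
      - by rewrite lee_fin invr_ge0 ltW.
      apply: ae_eq_integral => //.
      - exact: mzb.
      - by apply: measurable_scale; exact: mpz.
      apply: filterS Gz => x Gx _; rewrite /S' gee0_abs; last first.
        by rewrite mule_ge0// lee_fin invr_ge0 ltW.
      rewrite Gx -!muleA; congr (_ * (_ * _)); rewrite -!EFinM; congr EFin.
      by rewrite /q; field; rewrite gt_eqF// pu.2.
    by rewrite lee_pdivrMl// mule1.
  have : \int[mu]_x (T' x * (h x * v x)%:E) <= 1.
    apply: (le_trans le1); rewrite lee_pdivrMl ?mulr_gt0// mule1.
    by apply: (le_trans Hz); rewrite EFinM lee_wpmul2l// lee_fin ltW.
  by rewrite leNgt hT.
have NS0 : 0 <= NS.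
  have -> : 0 = N (fun=> 0).
    by apply/esym/(fn_eq0 HN); [exact: measurable_cst|exact: nearW].
  apply: (fn_monotone HN); [exact: measurable_cst|exact: mT|].
  by apply: nearW => x; rewrite abse0.
have [NSfin|] := boolP (NS \is a fin_num); last first.
  by rewrite ge0_fin_numE// -leNgt leye_eq => /eqP ->; rewrite gt0_muley ?leey// lte_fin.
apply/lee_addgt0Pr => e e0.
pose a := (fine NS + e / (2 * C1))%R.
have a0 : (0 < a)%R by rewrite ltr_wpDl ?fine_ge0// divr_gt0.
have := main a a0; rewrite -{1}(fineK NSfin) lee_fin => /(_ _)/le_trans; apply.
  by rewrite lerDl divr_ge0// ltW.
rewrite -(fineK NSfin) -EFinM -EFinD lee_fin /a mulrDr lerD2l mulrCA divff ?mulr1//.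
by rewrite gt_eqF.
Qed.

End function_norm_extrapolation.

(** * Comparison with the Muckenhoupt characteristics *)

Section muckenhoupt_constants.
Context d (E : measurableType d) (R : realType) (mu : {measure set E -> \bar R}).
Variables (B : set (set E)) (dil : set E -> set E) (c : R).
Hypothesis hB : cube_basis mu B dil c.
Implicit Types (v : E -> \bar R) (w : E -> R).

Definition basis_average v Q : \bar R := (mu Q)^-1 * \int[mu]_(y in Q) v y.

Definition basis_Ap p v : \bar R :=
  let p' := fine (hoelder_conjugate p%:E) in
  ereal_sup [set basis_average v Q *
                 basis_average (fun x => v x `^ (1 - p')) Q `^ (p - 1) | Q in B].

Definition basis_A1 v : \bar R := Lnorm mu +oo (fun x =>
  ereal_sup [set basis_average (fun y => `|v y|) Q | Q in B `&` [set Q | Q x]] / v x).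

Lemma one_minus_conjugate (p : R) : (1 < p)%R ->
  (1 - fine (hoelder_conjugate p%:E) = - (p - 1)^-1)%R.
Proof.
move=> p1; have p0 := lt_trans ltr01 p1.
have pn0 : p != 0%R by rewrite gt_eqF.
have p10 : (p - 1 != 0)%R by rewrite subr_eq0 gt_eqF.
rewrite /hoelder_conjugate/= eqe (negbTE pn0) /=.
rewrite -EFinB inver (negbTE p10) -EFinM /=.
by field.
Qed.

Lemma inver_pos (m : R) : (0 < m)%R -> (m%:E)^-1 = (m^-1)%:E :> \bar R.
Proof. by move=> m0; rewrite inver gt_eqF. Qed.

Lemma Ap_over_le_const p K w : (1 < p)%R -> Ap_over mu B p K w -> basis_Ap p (EFin \o w) <= K%:E.
Proof.
move=> p1 A; apply: ge_ereal_sup => _ [Q BQ <-].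
have [m [s [t [m0 s0 t0 mE [sE tE h]]]]] := A _ BQ.
rewrite /basis_average mE inver_pos// one_minus_conjugate//.
rewrite (_ : \int[mu]_(y in Q) (EFin \o w) y = s%:E)//.
rewrite (_ : \int[mu]_(y in Q) _ = t%:E)//.
by rewrite -(EFinM _ s) -(EFinM _ t) poweR_EFin -EFinM lee_fin [(m^-1 * t)%R]mulrC [(m^-1 * s)%R]mulrC.
Qed.

(** A finite characteristic forces both averages to be finite: they are positive, so an
    infinite one would make the product infinite. *)
Lemma const_le_Ap_over p K v w : (1 < p)%R -> measurable_fun setT v -> pos_weight w ->
  {ae mu, forall x, v x = (w x)%:E} -> basis_Ap p v <= K%:E -> Ap_over mu B p K w.
Proof.
move=> p1 mv pw vw ApK Q BQ; have mQ := basis_measurable hB BQ.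
have [m m0 mE] := basis_measure hB BQ.
have p10 : (0 < p - 1)%R by rewrite subr_gt0.
have pws := pos_weight_powR (- (p - 1)^-1) pw.
have : basis_average v Q * basis_average (fun x => v x `^ (1 - fine (hoelder_conjugate p%:E))) Q `^ (p - 1) <= K%:E.
  by apply: le_trans ApK; apply: ereal_sup_ubound; exists Q.
rewrite /basis_average one_minus_conjugate// mE inver_pos//.
have -> : \int[mu]_(y in Q) v y = \int[mu]_(y in Q) (w y)%:E.
  apply: ae_eq_integral => //; [exact: measurable_funTS| |].
    by apply: measurable_funTS; exact: pos_weightE.
  by apply: filterS vw => x -> _.
have -> : \int[mu]_(y in Q) (v y `^ (- (p - 1)^-1)) = \int[mu]_(y in Q) (w y `^ (- (p - 1)^-1))%:E.
  apply: ae_eq_integral => //.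
  - by apply: measurable_funTS; exact: measurable_poweRr.
  - by apply: measurable_funTS; exact: pos_weightE.
  by apply: filterS vw => x -> _.
have := integral_pos_weight hB pw BQ; have := integral_pos_weight hB pws BQ.
have mi0 : (0 < m^-1)%R by rewrite invr_gt0.
have p1n : (p - 1 != 0)%R by rewrite gt_eqF.
case: (\int[mu]_(y in Q) (w y)%:E) => [s| |//]; case: (\int[mu]_(y in Q) _) => [t| |//].
- rewrite !lte_fin -(EFinM _ s) -(EFinM _ t) poweR_EFin -EFinM lee_fin => t0 s0 h.
  exists m, s, t; split => //; split => //.
  by rewrite [(t / m)%R]mulrC [(s / m)%R]mulrC.
- move=> _ s0; rewrite gt0_muley ?lte_fin// poweRyr// gt0_muley ?leye_eq//.
  by rewrite -EFinM lte_fin mulr_gt0.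
- rewrite lte_fin => t0 _; rewrite gt0_muley ?lte_fin// gt0_mulye ?leye_eq//.
  by rewrite -EFinM poweR_EFin lte_fin powR_gt0// mulr_gt0.
- by move=> _ _; rewrite gt0_muley ?lte_fin// poweRyr// mulyy leye_eq.
Qed.

(** A_1 is contained in A_2: on Q, 1 / w is at most the A_1 characteristic divided by
    the average of w. *)
Lemma A1_le_Ap_over v w : measurable_fun setT v -> pos_weight w ->
  {ae mu, forall x, v x = (w x)%:E} -> basis_A1 v < +oo ->
  exists2 K : R, (0 < K)%R & Ap_over mu B 2 K w.
Proof.
move=> mv pw vw; rewrite /basis_A1 unlock.
(* The norm of L^oo is 0 by convention on a space of measure 0, which has no basis
   sets. *)
have [T0|T0] := boolP (0 < mu setT); last first.
  move=> _; exists 1%R => // Q BQ; exfalso; move/negP : T0; apply.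
  have [m m0 mE] := basis_measure hB BQ.
  apply: (@lt_le_trans _ _ (mu Q)); first by rewrite mE lte_fin.
  by apply: le_measure; rewrite ?inE//; exact: basis_measurable hB _ BQ.
set S := ess_sup _ _ => Slt.
have [K K0 SK] : exists2 K : R, (0 < K)%R & S <= K%:E.
  move: Slt; case: S => [a _| //|_]; last by exists 1%R => //; rewrite leNye.
  exists (Num.max a 1)%R; first by rewrite lt_max ltr01 orbT.
  by rewrite lee_fin le_max lexx.
have aeS := ess_sup_ge mu (abse \o (fun x => ereal_sup [set basis_average (fun y => `|v y|) Q |
   Q in B `&` [set Q | Q x]] / v x)).
exists K => // Q BQ; have mQ := basis_measurable hB BQ.
have [m m0 mE] := basis_measure hB BQ.
have avE : basis_average (fun y => `|v y|) Q = (m^-1)%:E * \int[mu]_(y in Q) (w y)%:E.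
  rewrite /basis_average mE inver_pos//; congr (_ * _).
  apply: ae_eq_integral => //.
  - by apply: measurable_funTS; exact: measurable_abs.
  - by apply: measurable_funTS; exact: pos_weightE.
  by apply: filterS vw => x -> _; rewrite gee0_abs// lee_fin ltW// pw.2.
have ptw : {ae mu, forall x, Q x -> (m^-1)%:E * \int[mu]_(y in Q) (w y)%:E <= (K * w x)%:E}.
  apply: filterS2 vw aeS => x vx /le_trans/(_ SK) h Qx.
  move: h; rewrite /= vx inver_pos ?pw.2// abseM [`|(_^-1)%:E|]gee0_abs ?lee_fin ?invr_ge0 ?(ltW (pw.2 x))//.
  rewrite lee_pdivrMr ?pw.2// => h; apply: le_trans h.
  rewrite -avE; apply: le_trans (lee_abs _).
  by apply: ereal_sup_ubound; exists Q.
have Q0 : 0 < mu Q by rewrite mE lte_fin.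
have [x [Qx xP]] := ae_witness mQ Q0 ptw.
have [s [s0 sE _]] : exists s : R, [/\ (0 < s)%R, \int[mu]_(y in Q) (w y)%:E = s%:E & (s <= m * (K * w x))%R].
  apply: (integral_le_fin hB pw BQ).
  by move: xP; rewrite lee_pdivrMl// -EFinM.
rewrite sE in ptw.
have pwi := pos_weight_powR (- (2 - 1)^-1) pw.
have mind : \int[mu]_(x in Q) (K * m / s)%:E = (K * m / s * m)%:E.
  by rewrite integral_cst// mE.
have C0 : (0 < K * m / s)%R by rewrite divr_gt0// mulr_gt0.
have [t [t0 tE th]] : exists t : R, [/\ (0 < t)%R,
    \int[mu]_(y in Q) (w y `^ (- (2 - 1)^-1))%:E = t%:E & (t <= K * m / s * m)%R].
  apply: (integral_le_fin hB pwi BQ); rewrite -mind.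
  apply: nn_le_integral_ae => //.
  - exact: pos_weightE.
  - by move=> y; rewrite lee_fin powR_ge0.
  - by move=> y; rewrite lee_fin ltW.
  apply: filterS ptw => y h Qy; have := h Qy.
  have -> : (2 - 1 = 1 :> R)%R by ring.
  rewrite invr1 powRN powRr1 ?(ltW (pw.2 y))// -EFinM !lee_fin => h'.
  have wy := pw.2 y; rewrite -[leRHS]invrK lef_pV2 ?posrE ?invr_gt0//.
  rewrite (_ : (K * m / s)^-1 = m^-1 * s / K)%R; last by field; rewrite !gt_eqF.
  by rewrite ler_pdivrMr// [leRHS]mulrC.
exists m, s, t; split => //; split => //.
have -> : (2 - 1 = 1 :> R)%R by ring.
rewrite powRr1 ?divr_ge0 ?(ltW t0) ?(ltW m0)//.
apply: (@le_trans _ _ (s / m * (K * m / s * m / m))%R).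
  by rewrite ler_pM2l ?divr_gt0// ler_pM2r ?invr_gt0.
by rewrite le_eqVlt; apply/orP; left; apply/eqP; field; rewrite !gt_eqF.
Qed.

End muckenhoupt_constants.

(** * The extrapolation theorem for a basis of sets *)

Section basis_extrapolation.
Context d (E : measurableType d) (R : realType) (mu : {measure set E -> \bar R}).
Variables (B : set (set E)) (dil : set E -> set E) (c : R).
Hypothesis hB : cube_basis mu B dil c.
Hypothesis c0 : (0 < c)%R.
Hypothesis cmu : measure_is_complete mu.

Definition basis_const p (v : E -> \bar R) : \bar R :=
  if p == 1%R then basis_A1 mu B v else basis_Ap mu B p v.

Definition basis_weight_fun (w : E -> \bar R) : Prop :=
  measurable_fun setT w /\ {ae mu, forall x, 0 < w x < +oo}.

Definition basis_Lnorm p (w f : E -> \bar R) : \bar R :=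
  (\int[mu]_x (`|f x| `^ p * w x)) `^ p^-1.

Definition basis_associate (N : (E -> \bar R) -> \bar R) (v f : E -> \bar R) : \bar R :=
  ereal_sup [set \int[mu]_x (`|f x * g x| * v x)
            | g in [set g | measurable_fun setT g /\ N g <= 1]].

(** The hypothesis in terms of L^p norms and characteristics, as opposed to
    [weighted_bound]. *)
Definition Lnorm_bound (F : set ((E -> \bar R) * (E -> \bar R))) p :=
  forall q K : R, (1 <= q)%R -> (1 <= K)%R -> exists2 C : R, (0 < C)%R &
    forall w : E -> \bar R, basis_weight_fun w -> basis_const q w <= K%:E ->
    forall f g : E -> \bar R, F (f, g) ->
      basis_Lnorm p w f <= C%:E * basis_Lnorm p w g.

Lemma pos_weight_fun (w : E -> R) : pos_weight w -> basis_weight_fun (EFin \o w).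
Proof.
move=> pw; split; first exact: pos_weightE.
by apply: nearW => x /=; rewrite lte_fin pw.2 ltry.
Qed.

Lemma poweR_invK (y : \bar R) (p : R) : (0 < p)%R -> 0 <= y -> (y `^ p^-1) `^ p = y.
Proof. by move=> p0 y0; rewrite -poweRrM mulVf ?gt_eqF// poweRe1. Qed.

Lemma weighted_bound_of_Lnorm F p : (0 < p)%R -> nonneg_pairs F ->
  Lnorm_bound F p -> weighted_bound mu B F p.
Proof.
move=> p0 F_pairs H q K q1 K0.
have K1 : (1 <= Num.max K 1)%R by rewrite le_max lexx orbT.
have [C C0 HC] := H _ _ (ltW q1) K1.
exists (C `^ p)%R; first exact: powR_gt0.
move=> w pw Ap f g Ffg; have [mf mg f0 g0] := F_pairs _ _ Ffg.
have /(_ (EFin \o w) (pos_weight_fun pw)) Hw := HC.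
have wK : basis_const q (EFin \o w) <= (Num.max K 1)%:E.
  rewrite /basis_const gt_eqF//; apply: (le_trans (Ap_over_le_const q1 Ap)).
  by rewrite lee_fin le_max lexx.
have := Hw wK _ _ Ffg; rewrite /basis_Lnorm.
have absE (y : E -> \bar R) : (forall x, 0 <= y x) ->
    \int[mu]_x (`|y x| `^ p * (EFin \o w) x) = \int[mu]_x (y x `^ p * (w x)%:E).
  by move=> y0; apply: eq_integral => x _; rewrite gee0_abs.
rewrite !absE//.
have I0 (y : E -> \bar R) : 0 <= \int[mu]_x (y x `^ p * (w x)%:E).
  by apply: integral_ge0 => x _; exact: weighted_power_ge0.
move=> h; rewrite -[leLHS](poweR_invK p0 (I0 f)) -[X in _ <= _ * X](poweR_invK p0 (I0 g)).
rewrite -poweR_EFin -poweRM ?lee_fin ?(ltW C0) ?poweR_ge0//.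
apply: gt0_ler_poweR => //.
- exact: ltW.
- by rewrite in_itv/= poweR_ge0 leey.
- by rewrite in_itv/= leey andbT mule_ge0 ?poweR_ge0// lee_fin ltW.
Qed.

Section vector_valued.
Variable F : set ((E -> \bar R) * (E -> \bar R)).
Hypothesis F_pairs : nonneg_pairs F.
Variable q : R.
Hypothesis q_gt0 : (0 < q)%R.

Definition lq_sum (J : pred nat) (f : nat -> E -> \bar R) x : \bar R :=
  \sum_(j <oo | J j) f j x `^ q.

Definition lq_pairs : set ((E -> \bar R) * (E -> \bar R)) := [set fg |
  exists (J : pred nat) (f g : nat -> E -> \bar R),
   (forall j, J j -> F (f j, g j)) /\
   fg = ((fun x => lq_sum J f x `^ q^-1), (fun x => lq_sum J g x `^ q^-1))].

Lemma lq_sumE J f x : lq_sum J f x = \sum_(j <oo) (if J j then f j x `^ q else 0).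
Proof. by rewrite /lq_sum eseries_mkcond. Qed.

Lemma lq_sum_ge0 J f x : 0 <= lq_sum J f x.
Proof. by apply: nneseries_ge0 => j _ _; exact: poweR_ge0. Qed.

Lemma measurable_lq_term (J : pred nat) (f : nat -> E -> \bar R) j :
  (J j -> measurable_fun setT (f j)) ->
  measurable_fun setT (fun x => if J j then f j x `^ q else 0).
Proof.
case: (J j) => [h|_]; last exact: measurable_cst.
by apply: measurable_poweRr; exact: h.
Qed.

Lemma measurable_lq_sum (J : pred nat) (f : nat -> E -> \bar R) :
  (forall j, J j -> measurable_fun setT (f j)) -> measurable_fun setT (lq_sum J f).
Proof.
move=> mf; rewrite (_ : lq_sum J f = fun x => \sum_(j <oo) (if J j then f j x `^ q else 0)); last first.
  by apply/funext => x; rewrite lq_sumE.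
apply: ge0_emeasurable_sum => [j x _ _|j _].
  by case: (J j) => //; exact: poweR_ge0.
by apply: measurable_lq_term; exact: mf.
Qed.

Lemma lq_pairs_nonneg : nonneg_pairs lq_pairs.
Proof.
move=> f g [J [fs [gs [Fj [-> ->]]]]]; split.
- by apply/measurable_poweRr/measurable_lq_sum => j /Fj/F_pairs[].
- by apply/measurable_poweRr/measurable_lq_sum => j /Fj/F_pairs[].
- by move=> x; exact: poweR_ge0.
- by move=> x; exact: poweR_ge0.
Qed.

Lemma integral_lq_sum (J : pred nat) (f : nat -> E -> \bar R) (w : E -> R) :
  (forall j, J j -> measurable_fun setT (f j)) -> pos_weight w ->
  \int[mu]_x ((lq_sum J f x `^ q^-1) `^ q * (w x)%:E) =
  \sum_(j <oo) (if J j then \int[mu]_x (f j x `^ q * (w x)%:E) else 0).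
Proof.
move=> mf pw.
have w0 x : 0 <= (w x)%:E by rewrite lee_fin ltW// pw.2.
pose t j x := (if J j then f j x `^ q else 0) * (w x)%:E.
have t0 j x : 0 <= (if J j then f j x `^ q else 0).
  by case: (J j) => //; exact: poweR_ge0.
have mt j : measurable_fun setT (t j).
  by apply: measurable_mul (pos_weightE pw); apply: measurable_lq_term; exact: mf.
transitivity (\int[mu]_x \sum_(j <oo) t j x).
  apply: eq_integral => x _; rewrite poweR_invK// ?lq_sum_ge0// lq_sumE muleC -nneseriesZl//.
  by apply: eq_eseriesr => j _; rewrite muleC.
rewrite integral_nneseries//; last by move=> j x _; rewrite mule_ge0.
apply: eq_eseriesr => j _; rewrite /t; case: (J j) => //.
by under eq_integral do rewrite mul0e; rewrite integral0.
Qed.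

(** For the exponent q, the integral of the q-th power of an l^q norm is the sum of the
    integrals of the terms. *)
Lemma lq_pairs_bound : weighted_bound mu B F q -> weighted_bound mu B lq_pairs q.
Proof.
move=> H r K r1 K0; have [C C0 HC] := H _ _ r1 K0; exists C => // w pw Ap f g.
move=> [J [fs [gs [Fj [-> ->]]]]].
rewrite !integral_lq_sum//; try by move=> j /Fj/F_pairs[].
have I0 (y : nat -> E -> \bar R) j : 0 <= (if J j then \int[mu]_x (y j x `^ q * (w x)%:E) else 0).
  by case: (J j) => //; apply: integral_ge0 => x _; exact: weighted_power_ge0.
rewrite -nneseriesZl//; apply: lee_nneseries => // j _.
have := Fj j; case: (J j) => [/(_ isT) h|_]; last by rewrite mule0.
exact: (HC _ pw Ap _ _ h).
Qed.

End vector_valued.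

Lemma basis_maximal_ae (v f : E -> \bar R) (vt : E -> R) x : measurable_fun setT f ->
  measurable_fun setT v -> pos_weight vt -> {ae mu, forall x, v x = (vt x)%:E} ->
  basis_maximal mu B v f x = basis_maximal mu B (EFin \o vt) f x.
Proof.
move=> mf mv pv vE; congr ereal_sup; apply: eq_imagel => Q [BQ Qx].
have mQ := basis_measurable hB BQ.
have mvt := pos_weightE pv.
congr (_^-1 * _); apply: ae_eq_integral => //.
- exact: measurable_funTS.
- exact: measurable_funTS.
- by apply: filterS vE => y -> _.
- by apply: measurable_funTS; apply: measurable_mul => //; exact: measurable_abs.
- by apply: measurable_funTS; apply: measurable_mul => //; exact: measurable_abs.
- by apply: filterS vE => y -> _.
Qed.

(** The equality of the integrands holds almost everywhere; completeness of the measure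
    then makes the left-hand one measurable. *)
Lemma associate_integrand_ae (u v b z : E -> \bar R) (ut vt : E -> R) :
  measurable_fun setT u -> measurable_fun setT v ->
  measurable_fun setT b -> (forall x, 0 <= b x) -> measurable_fun setT z ->
  pos_weight ut -> pos_weight vt ->
  {ae mu, forall x, u x = (ut x)%:E} -> {ae mu, forall x, v x = (vt x)%:E} ->
  \int[mu]_x (`|b x * (u x)^-1 * z x| * v x) =
  \int[mu]_x (`|z x| * (b x * (vt x / ut x)%:E)).
Proof.
move=> mu' mv mb b0 mz pu pv uE vE.
have mR : measurable_fun setT (fun x => `|z x| * (b x * (vt x / ut x)%:E)).
  apply: measurable_mul; first exact: measurable_abs.
  apply: measurable_mul => //; exact: pos_weightE (pos_weight_div pv pu).
have ptw x : u x = (ut x)%:E -> v x = (vt x)%:E ->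
    `|b x * (u x)^-1 * z x| * v x = `|z x| * (b x * (vt x / ut x)%:E).
  move=> -> ->; rewrite inver_pos ?pu.2// !abseM gee0_abs// gee0_abs ?lee_fin ?invr_ge0 ?(ltW (pu.2 x))//.
  by rewrite EFinM -[LHS]muleA [LHS]muleC -[LHS]muleA; congr (_ * _); rewrite muleCA.
have mae : {ae mu, forall x, `|b x * (u x)^-1 * z x| * v x = `|z x| * (b x * (vt x / ut x)%:E)}.
  by apply: filterS2 uE vE => x; exact: ptw.
apply: ae_eq_integral => //; last by apply: filterS mae => x ->.
by apply: (ae_measurable_fun cmu) mR; apply: filterS mae => x ->.
Qed.

(** The weights are replaced by real positive versions of them; the maximal operator and
    the associate norm do not change. Hypothesis M, scaled by 1 / K0, becomes the
    stability of the associate unit ball under th M_v. The first conclusion is the extrapolation for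
    F; the second is that for the pairs of l^q norms, which starts from the exponent q. *)
Theorem abstract_extrapolation (F : set ((E -> \bar R) * (E -> \bar R)))
    (u v : E -> \bar R) (N : (E -> \bar R) -> \bar R) (HN : function_norm mu N)
    (N_indic : forall A, measurable A -> \int[mu]_(x in A) v x < +oo ->
       N (fun x => (\1_A x)%:E) < +oo)
    (F_pairs : nonneg_pairs F) (weight_u : basis_weight_fun u) (weight_v : basis_weight_fun v)
    (v_Ainfty : exists2 p, (1 <= p)%R & basis_const p v < +oo)
    (H : exists2 p0, (0 < p0)%R & Lnorm_bound F p0)
    (M : exists2 K0 : R, (0 < K0)%R & forall f, measurable_fun setT f ->
        basis_associate N v (fun x => basis_maximal mu B v f x * (u x)^-1) <=
        K0%:E * basis_associate N v (fun x => f x * (u x)^-1)) :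
  (forall p : R, (0 < p)%R -> exists2 C : R, (0 < C)%R & forall f g, F (f, g) ->
     N (fun x => f x `^ p * u x) <= C%:E * N (fun x => g x `^ p * u x)) /\
  (forall p q : R, (0 < p)%R -> (0 < q)%R -> exists2 C : R, (0 < C)%R &
      forall (J : pred nat) (f g : nat -> E -> \bar R),
        (forall j, J j -> F (f j, g j)) ->
        N (fun x => lq_sum q J f x `^ (p / q) * u x) <=
        C%:E * N (fun x => lq_sum q J g x `^ (p / q) * u x)).
Proof.
have [mu' uP] := weight_u; have [mv vP] := weight_v.
have [ut pu uE] := real_version mu' uP.
have [vt pv vE] := real_version mv vP.
have [r [K [r1 K0 Apv]]] : exists r K : R, [/\ (1 < r)%R, (0 < K)%R & Ap_over mu B r K vt].
  have [p p1] := v_Ainfty; rewrite /basis_const; case: ifPn => [_|pn1] h.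
    by have [K K0 A] := A1_le_Ap_over hB mv pv vE h; exists 2%R, K; split => //; rewrite ltr1n.
  have {}p1 : (1 < p)%R by rewrite lt_neqAle eq_sym pn1.
  have [K K0 hK] : exists2 K : R, (0 < K)%R & basis_Ap mu B p v <= K%:E.
    move: h; case: (basis_Ap _ _ _ _) => [a _| //|_]; last by exists 1%R => //; rewrite leNye.
    exists (Num.max a 1)%R; first by rewrite lt_max ltr01 orbT.
    by rewrite lee_fin le_max lexx.
  by exists p, K; split => //; exact: (const_le_Ap_over hB p1 mv pv vE hK).
have vtQ A : measurable A -> \int[mu]_(x in A) v x = \int[mu]_(x in A) (vt x)%:E.
  move=> mA; apply: ae_eq_integral => //.
  - exact: measurable_funTS.
  - by apply: measurable_funTS; exact: pos_weightE.
  - by apply: filterS vE => x -> _.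
have Nind Q : B Q -> N (fun x => (\1_Q x)%:E) < +oo.
  move=> BQ; have mQ := basis_measurable hB BQ; apply: N_indic => //.
  by rewrite vtQ//; exact: (Ap_over_locally_finite Apv).
have [K1 K10 HM] := M.
pose th := (K1^-1)%R; have th0 : (0 < th)%R by rewrite invr_gt0.
have ball_max b : associate_ball mu N ut vt b ->
    associate_ball mu N ut vt (fun x => th%:E * basis_maximal mu B (EFin \o vt) b x).
  move=> [mb b0 hb].
  have mMb : measurable_fun setT (basis_maximal mu B (EFin \o vt) b).
    exact: measurable_basis_maximal hB _ _.
  have Mb0 x : 0 <= basis_maximal mu B (EFin \o vt) b x by exact: (basis_maximal_ge0 hB).
  split.
  - exact: measurable_scale.
  - by move=> x; rewrite mule_ge0// lee_fin ltW.
  move=> z mz Nz.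
  have b1 : basis_associate N v (fun x => b x * (u x)^-1) <= 1.
    apply: ge_ereal_sup => _ [y [my Ny] <-].
    by rewrite (associate_integrand_ae mu' mv mb b0 my pu pv uE vE); exact: hb.
  have Mb1 : basis_associate N v (fun x => basis_maximal mu B v b x * (u x)^-1) <= K1%:E.
    by apply: le_trans (HM _ mb) _; rewrite -[leRHS]mule1 lee_wpmul2l// lee_fin ltW.
  have mbE : basis_maximal mu B v b = basis_maximal mu B (EFin \o vt) b.
    by apply/funext => x; exact: basis_maximal_ae.
  rewrite mbE in Mb1.
  have : \int[mu]_x (`|z x| * (basis_maximal mu B (EFin \o vt) b x * (vt x / ut x)%:E)) <= K1%:E.
    rewrite -(associate_integrand_ae mu' mv mMb Mb0 mz pu pv uE vE).
    by apply: le_trans Mb1; apply: ereal_sup_ubound; exists z.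
  set I := (X in X <= _) => hI.
  have IE : \int[mu]_x (`|z x| * (th%:E * basis_maximal mu B (EFin \o vt) b x * (vt x / ut x)%:E)) =
      th%:E * I.
    rewrite /I -ge0_integralZl//.
    - by apply: eq_integral => x _; rewrite -(muleA th%:E) (muleCA _ th%:E).
    - apply: measurable_mul; first exact: measurable_abs.
      apply: measurable_mul => //; exact: pos_weightE (pos_weight_div pv pu).
    - by move=> x _; rewrite !mule_ge0// lee_fin divr_ge0// ltW// ?pv.2 ?pu.2.
    - by rewrite lee_fin ltW.
  by rewrite IE /th lee_pdivrMl// mule1.
have NE (y : E -> \bar R) : measurable_fun setT y ->
    N (fun x => y x * u x) = N (fun x => y x * (ut x)%:E).
  move=> my; apply: (fn_eq HN).
  - exact: measurable_mul.
  - by apply: measurable_mul => //; exact: pos_weightE.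
  - by apply: filterS uE => x ->.
have [p0 p00 Hp0] := H.
have wb := weighted_bound_of_Lnorm p00 F_pairs Hp0.
split.
  move=> p p_gt0.
  have [C C0 HC] := function_norm_extrapolation hB c0 HN pu pv r1 K0 Apv Nind th0 ball_max
    F_pairs p00 p_gt0 wb.
  exists C => // f g Ffg; have [mf mg f0 g0] := F_pairs _ _ Ffg.
  rewrite !NE; [exact: HC|exact: measurable_poweRr|exact: measurable_poweRr].
move=> p q p_gt0 q_gt0.
have wbq := weighted_bound_all hB c0 F_pairs p00 q_gt0 wb.
have [C C0 HC] := function_norm_extrapolation hB c0 HN pu pv r1 K0 Apv Nind th0 ball_max
    (lq_pairs_nonneg F_pairs (q := q)) q_gt0 p_gt0 (lq_pairs_bound F_pairs q_gt0 wbq).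
exists C => // J f g Fj.
have mS (y : nat -> E -> \bar R) : (forall j, J j -> measurable_fun setT (y j)) ->
    measurable_fun setT (fun x => lq_sum q J y x `^ (p / q)).
  by move=> my; apply/measurable_poweRr/measurable_lq_sum.
rewrite !NE; [|by apply: mS => j /Fj/F_pairs[]|by apply: mS => j /Fj/F_pairs[]].
have := HC (fun x => lq_sum q J f x `^ q^-1) (fun x => lq_sum q J g x `^ q^-1).
have powE (y : nat -> E -> \bar R) :
   (fun x => (lq_sum q J y x `^ q^-1) `^ p * (ut x)%:E) = (fun x => lq_sum q J y x `^ (p / q) * (ut x)%:E).
  by apply/funext => x; rewrite -poweRrM mulrC.
by rewrite !powE; apply; exists J, f, g.
Qed.

End basis_extrapolation.

(** * The cubes of R^n as a basis *)

Section Rn_basis.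
Context {R : realType} {n : nat}.
Notation E := (Rn R n).

Definition cube_param (Q : set E) : ('I_n -> R) * R :=
  xget (fun=> 0%R, 1%R) [set al | (0 < al.2)%R /\ Q = cube al.1 al.2].

Lemma cube_paramP (Q : set E) : cubes Q ->
  (0 < (cube_param Q).2)%R /\ Q = cube (cube_param Q).1 (cube_param Q).2.
Proof.
move=> [a [l [l0 QE]]]; rewrite /cube_param.
by case: xgetP => [al _ //|/(_ (a, l))] []; split.
Qed.

Definition dilate (Q : set E) : set E := triple (cube_param Q).1 (cube_param Q).2.

Lemma cubes_basis : cube_basis (lebesgue R n) cubes dilate (3 ^+ n).
Proof.
split.
- exact: measurable_cubes.
- exact: lebesgue_cubes.
- move=> Q /cube_paramP[l0 QE]; rewrite /dilate; split.
  + by apply: cubes_cube; rewrite mulr_gt0.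
  + by rewrite {1}QE; exact: sub_triple.
  + have -> : lebesgue R n Q = ((cube_param Q).2 ^+ n)%:E.
      by rewrite {1}QE lebesgue_cube// ltW.
    by rewrite /triple lebesgue_cube ?mulr_ge0 ?(ltW l0)// -EFinM exprMn.
- exists big_cube; split.
  + exact: cubes_big_cube.
  + exact: big_cube_nd.
  + exact: bigcup_big_cube.
- move=> P Q0; exact: countable_subcubes.
- move=> Q s cQ.
  pose a k := (cube_param (Q k)).1; pose l k := (cube_param (Q k)).2.
  have l0 k : (0 < l k)%R by case: (cube_paramP (cQ k)).
  have QE : Q = fun k => cube (a k) (l k).
    by apply/funext => k; case: (cube_paramP (cQ k)).
  have [D [Ds uD tD cD]] := vitali_cubes a s l0.
  exists D; split => //; first by rewrite QE.
  by move=> k /cD[j jD kj]; exists j => //; rewrite {1}QE.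
Qed.

Lemma bfs_function_norm (v : E -> \bar R) (X : banach_function_space v) :
  function_norm (lebesgue R n) X.
Proof.
split.
- exact: bfs_eq0.
- exact: bfs_triangle.
- exact: bfs_homogeneous.
- exact: bfs_monotone.
- by move=> fs f mfs mf fsf; case: (bfs_fatou X mfs mf fsf).
Qed.

Lemma lebesgue_complete : measure_is_complete (lebesgue R n).
Proof. exact: measure_is_complete_caratheodory. Qed.

End Rn_basis.

Unset Implicit Arguments.

Theorem theorem1p4 (R : realType) (n : nat) (n_gt0 : (0 < n)%N)
    (F : set ((Rn R n -> \bar R) * (Rn R n -> \bar R)))
    (u v : Rn R n -> \bar R) (X : banach_function_space v)
    (F_pairs : extrapolation_family F)
    (weight_u : weight u) (weight_v : weight v) (v_Ainfty : A_infty v)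
    (H : exists2 p0 : R, (0 < p0)%R &
      forall q K : R, (1 <= q)%R -> (1 <= K)%R ->
      exists2 C : R, (0 < C)%R &
        forall w : Rn R n -> \bar R, weight w -> Ap_const q w <= K%:E ->
        forall f g : Rn R n -> \bar R, F (f, g) ->
          weighted_Lnorm p0 w f <= C%:E * weighted_Lnorm p0 w g)
    (M : exists2 K0 : R, (0 < K0)%R &
      forall f : Rn R n -> \bar R, measurable_fun setT f ->
        associate_norm X (fun x => weighted_maximal v f x * (u x)^-1) <=
        K0%:E * associate_norm X (fun x => f x * (u x)^-1)) :
  (forall p : R, (0 < p)%R ->
    exists2 C : R, (0 < C)%R &
      forall f g : Rn R n -> \bar R, F (f, g) ->
        X (fun x => f x `^ p * u x) <= C%:E * X (fun x => g x `^ p * u x)) /\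
  (forall p q : R, (0 < p)%R -> (0 < q)%R ->
    exists2 C : R, (0 < C)%R &
      forall (J : pred nat) (f g : nat -> Rn R n -> \bar R),
        (forall j, J j -> F (f j, g j)) ->
        X (fun x => (\sum_(j <oo | J j) f j x `^ q) `^ (p / q) * u x) <=
        C%:E * X (fun x => (\sum_(j <oo | J j) g j x `^ q) `^ (p / q) * u x)).
Proof.
have c0 : (0 < 3 ^+ n :> R)%R by rewrite exprn_gt0.
exact: (abstract_extrapolation cubes_basis c0 lebesgue_complete (bfs_function_norm X)
  (bfs_indic X) F_pairs weight_u weight_v v_Ainfty.2 H M).
Qed.
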